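(* Let $S=S'\times S''$ be the direct product of two Damek--Ricci spaces, with right Haar measure $\rho$ and distance $d_{max}$. Then $(S,\rho,d_{max})$ is a Calderón--Zygmund space, i.e. there exist a family $\mathcal R$ of subsets of $S$ and a positive constant $\kappa_0$ such that $(S,\rho,d_{max})$ is a Calderón--Zygmund space with family of Calderón--Zygmund sets $\mathcal R$ and constant $\kappa_0$.
   Context: **Damek--Ricci spaces.** Let $\mathfrak n$ be a finite-dimensional real Lie algebra with inner product and norm $|\cdot|$, and $\mathfrak n=\mathfrak v\oplus\mathfrak z$ an orthogonal decomposition with $[\mathfrak n,\mathfrak z]=\{0\}$, $[\mathfrak n,\mathfrak n]\subseteq\mathfrak z$. For $Z\in\mathfrak z$ define $J_Z:\mathfrak v\to\mathfrak v$ by $\langle J_ZX,Y\rangle=\langle Z,[X,Y]\rangle$. $\mathfrak n$ is of $H$-type if $|J_ZX|=|Z||X|$ for all $X\in\mathfrak v$, $Z\in\mathfrak z$ (the abelian case $\mathfrak v=\mathbb R^d$, $d\ge1$, $\mathfrak z=\{0\}$ is also allowed). The Damek--Ricci space is the Lie group $\mathfrak v\times\mathfrak z\times\mathbb R^+$ with product $(X,Z,a)(X',Z',a')=(X+a^{1/2}X',Z+aZ'+\frac12a^{1/2}[X,X'],aa')$, identity $e=(0,0,1)$, right Haar measure $a^{-1}dX\,dZ\,da$. Its Lie algebra is $\mathfrak n\oplus\mathbb RH$, $H$ tangent to $t\mapsto(0,0,e^t)$ at $t=0$, with inner product extended so that $H$ is a unit vector orthogonal to $\mathfrak n$; its distance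 is that of the left-invariant Riemannian metric agreeing with this inner product at $e$. **Product.** If $S',S''$ are Damek--Ricci spaces with distances $d_{S'},d_{S''}$ and right Haar measures $\rho',\rho''$, then on the direct product group $S=S'\times S''$, $\rho=\rho'\otimes\rho''$ and $d_{max}((x',x''),(y',y''))=\max\{d_{S'}(x',y'),d_{S''}(x'',y'')\}$. **Calderón--Zygmund spaces.** Let $(X,\mu,d)$ be a metric measured space, $\mathcal R$ a family of (measurable) subsets of $X$ and $\kappa_0>0$. $(X,\mu,d)$ is a Calderón--Zygmund space with constant $\kappa_0$ (and family $\mathcal R$ of Calderón--Zygmund sets) if: (i) for every $R\in\mathcal R$ there exists $r>0$ such that $R$ is contained in a ball of radius at most $\kappa_0r$ and $\mu(R^* )\le\kappa_0\,\mu(R)$, where $R^*=\{x\in X:d(x,R)<r\}$; (ii) for every $f\in L^1(\mu)$ and $\alpha>\kappa_0\|f\|_{L^1(\mu)}/\mu(X)$ ($\alpha>0$ if $\mu(X)=\infty$) there is a decomposition $f=g+\sum_{i\in\mathbb N}b_i$ such that: $|g|\le\kappa_0\alpha$ $\mu$-a.e.; each $b_i$ is supported in a set $R_i\in\mathcal R$ and $\int b_i\,d\mu=0$; $\|b_i\|_{L^1(\mu)}\le\kappa_0\,\alpha\,\mu(R_i)$; $\sum_i\mu(R_i)\le\kappa_0\|f\|_{L^1(\mu)}/\alpha$. *)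

(* Defs.v *)
From HB Require Import structures.
From mathcomp Require Import all_boot all_order all_algebra.
From mathcomp Require Import all_classical all_reals all_analysis.
From mathcomp Require Import measurable_realfun.
From mathcomp Require Import ring lra.

Set Implicit Arguments.
Unset Strict Implicit.
Unset Printing Implicit Defensive.

Import Order.TTheory GRing.Theory Num.Theory.
Import numFieldNormedType.Exports.

Local Open Scope classical_set_scope.
Local Open Scope ring_scope.

(* A finite-dimensional real Lie algebra with an inner product and two
   subspaces, the candidates for v and z. *)
Record euclideanLieAlgebra (R : realType) := EuclideanLieAlgebra {
  lie_carrier :> vectType R;
  bracket : lie_carrier -> lie_carrier -> lie_carrier;
  inner : lie_carrier -> lie_carrier -> R;
  vpart : {vspace lie_carrier};
  zpart : {vspace lie_carrier};
  bracket_linearr : forall x, linear (bracket x);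
  bracket_linearl : forall y, linear (bracket ^~ y);
  bracketxx : forall x, bracket x x = 0;
  jacobi : forall x y w,
    bracket x (bracket y w) + bracket y (bracket w x) +
    bracket w (bracket x y) = 0;
  inner_linearl : forall y, scalar (inner ^~ y);
  innerC : forall x y, inner x y = inner y x;
  inner_gt0 : forall x, x != 0 -> 0 < inner x x }.

Arguments bracket {R e}.
Arguments inner {R e}.
Arguments vpart {R}.
Arguments zpart {R}.

Section htype.
Variables (R : realType) (n : euclideanLieAlgebra R).

Definition lie_norm (x : n) : R := Num.sqrt (inner x x).

(* J_Z X is the vector of v representing the functional Y |-> <Z, [X, Y]>;
   it exists and is unique, so the default value 0 plays no role. *)
Definition Jmap (Z X : n) : n :=
  xget 0 [set W | W \in vpart n /\
                  forall Y, Y \in vpart n -> inner W Y = inner Z (bracket X Y)].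

(* The abelian case z = 0, v = R^d with d >= 1 is included: for z = 0 the
   condition on J is void, and [n != 0] gives d >= 1. *)
Record is_htype : Prop := IsHtype {
  vz_full : (vpart n + zpart n)%VS = fullv;
  vz_orthogonal : forall X Z, X \in vpart n -> Z \in zpart n -> inner X Z = 0;
  bracket_center : forall x Z, Z \in zpart n -> bracket x Z = 0;
  bracket_derived : forall x y, bracket x y \in zpart n;
  Jmap_norm : forall X Z, X \in vpart n -> Z \in zpart n ->
    lie_norm (Jmap Z X) = lie_norm Z * lie_norm X;
  htype_neq0 : (0 < \dim (fullv : {vspace n}))%N }.

(* Orthonormal bases of v and z, used to take linear coordinates. *)
Record orthonormal_frame (m k : nat) := OrthonormalFrame {
  vframe : m.-tuple n;
  zframe : k.-tuple n;
  vframe_basis : basis_of (vpart n) vframe;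
  zframe_basis : basis_of (zpart n) zframe;
  vframe_orthonormal : forall i j : 'I_m,
    inner (tnth vframe i) (tnth vframe j) = (i == j)%:R;
  zframe_orthonormal : forall i j : 'I_k,
    inner (tnth zframe i) (tnth zframe j) = (i == j)%:R }.

End htype.

(* The Euclidean space of row vectors, with the product sigma-algebra (that is,
   the Borel one) and the Lebesgue measure. *)
Section rV_measurable.
Variables (R : realType) (n : nat).

Let coor (i : 'I_n) (x : 'rV[R]_n) : R := x ord0 i.

Let rV_set0 : g_sigma_preimage coor set0.
Proof. exact: sigma_algebra0. Qed.

Let rV_setC A : g_sigma_preimage coor A -> g_sigma_preimage coor (~` A).
Proof. exact: sigma_algebraC. Qed.

Let rV_bigcup (F : _^nat) : (forall i, g_sigma_preimage coor (F i)) ->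
  g_sigma_preimage coor (\bigcup_i (F i)).
Proof. exact: sigma_algebra_bigcup. Qed.

HB.instance Definition _ := @isMeasurable.Build default_measure_display
  'rV[R]_n (g_sigma_preimage coor) rV_set0 rV_setC rV_bigcup.

Lemma measurable_rV_coor (i : 'I_n) :
  measurable_fun [set: 'rV[R]_n] (fun x : 'rV[R]_n => x ord0 i : R).
Proof.
move=> _ Y mY; rewrite setTI; apply: sub_sigma_algebra.
rewrite (bigD1 i) //=; left.
by exists Y => //; rewrite setTI.
Qed.

Lemma measurable_rVP d (T : measurableType d) (f : T -> 'rV[R]_n) :
  (forall i, measurable_fun [set: T] (fun t => f t ord0 i)) ->
  measurable_fun [set: T] f.
Proof.
move=> mf; apply: (@measurability _ _ _ _ setT f
  (\big[setU/set0]_(i < n) preimage_set_system setT (coor i) measurable)) => //.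
move=> _ [B + <-]; move: B; apply: (big_ind (fun G : set (set 'rV[R]_n) =>
  forall B, G B -> measurable (setT `&` f @^-1` B))).
- by move=> B [].
- by move=> G H IG IH B [/IG|/IH].
- move=> i _ _ [C mC <-].
  by have := mf i measurableT C mC; rewrite !setTI.
Qed.

End rV_measurable.

(* The library product of sigma-finite measures under a name of its own, because
   the canonical sigma-finite structure attached to [\x] is only found for
   sub-probability measures. *)
Section sigma_finite_product.
Context d1 d2 (T1 : measurableType d1) (T2 : measurableType d2) (R : realType).
Variables (m1 : {sigma_finite_measure set T1 -> \bar R})
          (m2 : {sigma_finite_measure set T2 -> \bar R}).

Definition prod_measure : set (T1 * T2) -> \bar R := (m1 \x m2)%E.

HB.instance Definition _ := Measure.on prod_measure.

Let prod_measure_sigma_finite : sigma_finite setT prod_measure.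
Proof.
have /sigma_finiteP[F [TF ndF Foo]] := sigma_finiteT m1.
have /sigma_finiteP[G [TG ndG Goo]] := sigma_finiteT m2.
exists (fun n => F n `*` G n).
  rewrite -setXTT TF TG predeqE => -[x y]; split.
    move=> [/= [n _ Fnx] [k _ Gky]]; exists (maxn n k) => //; split.
      by move: x Fnx; exact/subsetPset/ndF/leq_maxl.
    by move: y Gky; exact/subsetPset/ndG/leq_maxr.
  by move=> [n _ []/= ? ?]; split; exists n.
move=> k; have [? ?] := Foo k; have [? ?] := Goo k.
split; first exact: measurableX.
by rewrite /prod_measure product_measure1E// lte_mul_pinfty// ge0_fin_numE.
Qed.

HB.instance Definition _ := Measure_isSigmaFinite.Build _ _ _ prod_measure
  prod_measure_sigma_finite.

End sigma_finite_product.

(* The push-forward of a sigma-finite measure under an isomorphism of measurable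
   spaces. *)
Section iso_measure.
Context d1 d2 (T1 : measurableType d1) (T2 : measurableType d2) (R : realType).
Variables (f : {mfun T1 >-> T2}) (g : {mfun T2 >-> T1}) (fK : cancel f g).
Variable mu : {sigma_finite_measure set T1 -> \bar R}.

Definition iso_measure (_ : cancel f g) : set T2 -> \bar R := pushforward mu f.

Let mf : measurable_fun setT f. Proof. exact: measurable_funPT. Qed.

Let iso_measure0 : iso_measure fK set0 = 0%E.
Proof. exact: measure0. Qed.

Let iso_measure_ge0 A : (0 <= iso_measure fK A)%E.
Proof. exact: measure_ge0. Qed.

Let iso_measure_sigma_additive : semi_sigma_additive (iso_measure fK).
Proof. exact: measure_semi_sigma_additive. Qed.

HB.instance Definition _ := isMeasure.Build _ _ _ (iso_measure fK)
  iso_measure0 iso_measure_ge0 iso_measure_sigma_additive.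

Let iso_measure_sigma_finite : sigma_finite setT (iso_measure fK).
Proof.
have [F FT Foo] := sigma_finiteT mu.
exists (fun i => g @^-1` F i).
  by rewrite -preimage_bigcup -FT preimage_setT.
move=> i; have [mF Fi] := Foo i; split.
  by rewrite -[X in measurable X]setTI; exact: measurable_funPT.
rewrite /iso_measure /pushforward -comp_preimage.
by rewrite (_ : _ \o _ = id)//; apply/funext => x; exact: fK.
Qed.

HB.instance Definition _ := Measure_isSigmaFinite.Build _ _ _ (iso_measure fK)
  iso_measure_sigma_finite.

End iso_measure.

Section lebesgue_rV.
Variable R : realType.

Definition rV_cons n (p : measurableTypeR R * 'rV[R]_n) : 'rV[R]_n.+1 :=
  row_mx (p.1%:M : 'rV[R]_1) p.2.

Lemma rV_cons0 n (p : measurableTypeR R * 'rV[R]_n) : rV_cons p ord0 ord0 = p.1.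
Proof.
rewrite /rV_cons; have -> : ord0 = lshift n (ord0 : 'I_1) by exact: val_inj.
by rewrite (@row_mxEl _ _ 1) !mxE.
Qed.

Lemma rV_consS n (p : measurableTypeR R * 'rV[R]_n) (i : 'I_n) :
  rV_cons p ord0 (lift ord0 i) = p.2 ord0 i.
Proof.
rewrite /rV_cons; have -> : lift ord0 i = rshift 1 i by exact: val_inj.
by rewrite (@row_mxEr _ _ 1).
Qed.

Lemma measurable_rV_cons n :
  measurable_fun [set: measurableTypeR R * 'rV[R]_n] (@rV_cons n).
Proof.
apply: measurable_rVP => i; case: (unliftP ord0 i) => [j|] ->.
  rewrite (_ : (fun _ => _) = (fun x : 'rV[R]_n => x ord0 j) \o snd).
    by apply: measurableT_comp => //; exact: measurable_rV_coor.
  by apply/funext => p /=; rewrite rV_consS.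
rewrite (_ : (fun _ => _) = fst) //.
by apply/funext => p /=; rewrite rV_cons0.
Qed.

Definition rV_uncons n (x : 'rV[R]_n.+1) : measurableTypeR R * 'rV[R]_n :=
  (x ord0 ord0, \row_i x ord0 (lift ord0 i)).

Lemma rV_uncons_cons n : cancel (@rV_cons n) (@rV_uncons n).
Proof.
case=> a x; rewrite /rV_uncons rV_cons0; congr pair.
by apply/rowP => i; rewrite mxE rV_consS.
Qed.

Lemma measurable_rV_uncons n :
  measurable_fun [set: 'rV[R]_n.+1] (@rV_uncons n).
Proof.
apply/measurable_fun_pairP; split; first exact: measurable_rV_coor.
apply: measurable_rVP => i.
rewrite (_ : (fun _ => _) = fun x : 'rV[R]_n.+1 => x ord0 (lift ord0 i)).
  exact: measurable_rV_coor.
by apply/funext => x /=; rewrite mxE.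
Qed.

HB.instance Definition _ n := isMeasurableFun.Build _ _ _ _ (@rV_cons n)
  (@measurable_rV_cons n).

HB.instance Definition _ n := isMeasurableFun.Build _ _ _ _ (@rV_uncons n)
  (@measurable_rV_uncons n).

Fixpoint rV_lebesgue n : {sigma_finite_measure set 'rV[R]_n -> \bar R} :=
  if n is m.+1
  then iso_measure (prod_measure (@lebesgue_measure R) (rV_lebesgue m))
         (@rV_uncons_cons m)
  else \d_(0 : 'rV[R]_0).

End lebesgue_rV.

(* The multiplicative group of positive reals, with the sigma-algebra induced
   from R and the measure a^-1 da. *)
Definition posreal (R : realType) : Type := {posnum R}.

Section posreal.
Variable R : realType.

HB.instance Definition _ := Choice.on (posreal R).
HB.instance Definition _ := isPointed.Build (posreal R) (1%:pos : {posnum R}).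

Definition posval (a : posreal R) : R := (a : {posnum R})%:num.

Lemma posval_inj : injective posval.
Proof. exact: val_inj. Qed.

Lemma posval_gt0 a : 0 < posval a.
Proof. by rewrite /posval. Qed.

HB.instance Definition _ := Measurable.copy (posreal R)
  (g_sigma_algebra_preimageType posval).

Definition posone : posreal R := (1%:pos : {posnum R}).

Definition posmul (a b : posreal R) : posreal R :=
  PosNum (mulr_gt0 (posval_gt0 a) (posval_gt0 b)).

Definition posinv (a : posreal R) : posreal R :=
  PosNum (etrans (invr_gt0 (posval a)) (posval_gt0 a)).

Lemma measurable_posval_image (A : set (posreal R)) :
  measurable A -> measurable (posval @` A : set R).
Proof.
move=> [B mB <-]; rewrite setTI.
rewrite (_ : _ @` _ = B `&` `]0, +oo[); first exact: measurableI.
apply/seteqP; split => [_ [a Ba <-]|x [Bx]] /=.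
  by rewrite in_itv/= andbT posval_gt0.
rewrite in_itv/= andbT => x0.
by exists (PosNum x0 : {posnum R}).
Qed.

Definition posreal_haar (A : set (posreal R)) : \bar R :=
  (\int[@lebesgue_measure R]_(a in posval @` A) (a^-1)%:E)%E.

Let posreal_haar0 : posreal_haar set0 = 0%E.
Proof. by rewrite /posreal_haar image_set0 integral_set0. Qed.

Let posreal_haar_ge0 A : (0 <= posreal_haar A)%E.
Proof.
apply: integral_ge0 => _ [a _ <-].
by rewrite lee_fin invr_ge0 ltW// posval_gt0.
Qed.

Let measurable_inv_pos (B : set R) : measurable B -> B `<=` `]0, +oo[ ->
  measurable_fun (B : set (measurableTypeR R)) (fun x : R => (x^-1)%:E).
Proof.
move=> mB B0; apply/measurable_EFinP.
have minv : measurable_fun (`]0, +oo[ : set R) (fun x : R => x^-1).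
  apply: open_continuous_measurable_fun; first exact: interval_open.
  move=> x; rewrite inE/= in_itv/= andbT => x0.
  by apply: inv_continuous; rewrite gt_eqF.
by apply: measurable_funS minv => //; exact: measurable_itv.
Qed.

Let posval_image_pos (A : set (posreal R)) : posval @` A `<=` `]0, +oo[.
Proof. by move=> _ [a _ <-] /=; rewrite in_itv/= andbT posval_gt0. Qed.

Let posreal_haar_sigma_additive : semi_sigma_additive posreal_haar.
Proof.
move=> F mF tF mUF; rewrite /posreal_haar image_bigcup.
rewrite ge0_integral_bigcup//=.
- by apply: is_cvg_ereal_nneg_natsum => k _; exact: posreal_haar_ge0.
- by move=> i; exact: measurable_posval_image.
- rewrite -image_bigcup; apply: measurable_inv_pos; last exact: posval_image_pos.
  exact: measurable_posval_image.
- by move=> _ [i _ [a _ <-]]; rewrite lee_fin invr_ge0 ltW// posval_gt0.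
- move=> i j _ _ [_ [[a Fia <-] [b Fjb /posval_inj ba]]].
  by apply: tF => //; exists a; split => //; rewrite -ba.
Qed.

HB.instance Definition _ := isMeasure.Build _ _ _ posreal_haar
  posreal_haar0 posreal_haar_ge0 posreal_haar_sigma_additive.

Let posreal_haar_sigma_finite : sigma_finite setT posreal_haar.
Proof.
exists (fun n => posval @^-1` `[n.+1%:R^-1, n.+1%:R]).
  apply/seteqP; split => // a _.
  have a0 := posval_gt0 a.
  pose k := maxn (Num.truncn (posval a)) (Num.truncn (posval a)^-1).
  exists k => //=; rewrite in_itv/=; apply/andP; split.
    rewrite invf_ple ?posrE// ?invr_gt0//; apply/ltW.
    apply: lt_le_trans (real_truncnS_gt (num_real _)) _.
    by rewrite ler_nat ltnS leq_maxr.
  apply/ltW; apply: lt_le_trans (real_truncnS_gt (num_real _)) _.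
  by rewrite ler_nat ltnS leq_maxl.
move=> n; set A := _ @^-1` _; have mA : measurable A.
  by exists `[n.+1%:R^-1, n.+1%:R]%classic => //; rewrite setTI.
split=> //; have mB := measurable_posval_image mA.
rewrite /posreal_haar.
apply: (@le_lt_trans _ _
    (\int[@lebesgue_measure R]_(a in posval @` A) (cst n.+1%:R%:E) a)%E).
  apply: ge0_le_integral => //.
  - by move=> _ [a _ <-]; rewrite lee_fin invr_ge0 ltW// posval_gt0.
  - exact: measurable_inv_pos.
  move=> _ [a + <-]; rewrite /A /= in_itv/= => /andP[na _].
  by rewrite lee_fin invf_ple ?posrE// ?posval_gt0.
rewrite integral_cst//.
apply: (@le_lt_trans _ _ (n.+1%:R%:E * n.+1%:R%:E)%E); last by rewrite -EFinM ltry.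
rewrite lee_pmul2l//.
apply: (@le_trans _ _ (@lebesgue_measure R `[0, n.+1%:R])).
  apply: le_measure; rewrite ?inE//.
  move=> _ [a + <-]; rewrite /A /= !in_itv/= => /andP[na ->].
  by rewrite ltW// posval_gt0.
by rewrite lebesgue_measure_itv/= lte_fin ltr0n/= oppr0 adde0.
Qed.

HB.instance Definition _ := Measure_isSigmaFinite.Build _ _ _ posreal_haar
  posreal_haar_sigma_finite.

End posreal.

Section damek_ricci.
Variables (R : realType) (n : euclideanLieAlgebra R) (m k : nat).
Variable F : orthonormal_frame n m k.

(* The bracket v x v -> z in the coordinates given by the frame. *)
Definition vvec (x : 'rV[R]_m) : n := \sum_i x ord0 i *: tnth (vframe F) i.

Definition frame_bracket (x y : 'rV[R]_m) : 'rV[R]_k :=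
  \row_l inner (tnth (zframe F) l) (bracket (vvec x) (vvec y)).

Lemma vvec_linear : linear vvec.
Proof.
move=> a x y; rewrite /vvec scaler_sumr -big_split /=; apply: eq_bigr => i _.
by rewrite !mxE scalerDl scalerA.
Qed.

Lemma frame_bracket_linearl y : linear (frame_bracket ^~ y).
Proof.
move=> a x x'; apply/rowP => l; rewrite !mxE vvec_linear.
by rewrite bracket_linearl innerC inner_linearl !(innerC _ (tnth _ _)).
Qed.

Lemma frame_bracket_linearr x : linear (frame_bracket x).
Proof.
move=> a y y'; apply/rowP => l; rewrite !mxE vvec_linear.
by rewrite bracket_linearr innerC inner_linearl !(innerC _ (tnth _ _)).
Qed.

Lemma frame_bracketxx x : frame_bracket x x = 0.
Proof.
apply/rowP => l; rewrite !mxE bracketxx innerC.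
have := inner_linearl (tnth (zframe F) l) (-1) 0 0.
by rewrite scaler0 addr0 mulN1r addNr.
Qed.

Lemma frame_bracket0l y : frame_bracket 0 y = 0.
Proof.
have := frame_bracket_linearl y (-1) 0 0.
by rewrite scaler0 addr0 scaleN1r addNr.
Qed.

Lemma frame_bracket0r x : frame_bracket x 0 = 0.
Proof.
have := frame_bracket_linearr x (-1) 0 0.
by rewrite scaler0 addr0 scaleN1r addNr.
Qed.

Lemma frame_bracketZl a x y : frame_bracket (a *: x) y = a *: frame_bracket x y.
Proof.
by rewrite -[a *: x]addr0 frame_bracket_linearl frame_bracket0l addr0.
Qed.

Lemma frame_bracketZr a x y : frame_bracket x (a *: y) = a *: frame_bracket x y.
Proof.
by rewrite -[a *: y]addr0 frame_bracket_linearr frame_bracket0r addr0.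
Qed.

(* The group v x z x R^+, in coordinates. The phantom argument carries the group
   law. *)
Definition DRspace (_ : orthonormal_frame n m k) : Type :=
  ('rV[R]_m * 'rV[R]_k * posreal R)%type.

HB.instance Definition _ := Measurable.on (DRspace F).

Definition DRone : DRspace F := (0, 0, posone R).

Definition DRmul (x y : DRspace F) : DRspace F :=
  let: (X, Z, a) := x in let: (X', Z', a') := y in
  (X + Num.sqrt (posval a) *: X',
   Z + posval a *: Z' + (2^-1 * Num.sqrt (posval a)) *: frame_bracket X X',
   posmul a a').

Definition DRinv (x : DRspace F) : DRspace F :=
  let: (X, Z, a) := x in
  (- (Num.sqrt (posval a))^-1 *: X, - (posval a)^-1 *: Z, posinv a).

Let sqrt_posvalK (a : posreal R) : Num.sqrt (posval a) ^+ 2 = posval a.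
Proof. by rewrite sqr_sqrtr// ltW// posval_gt0. Qed.

Let sqrt_posval_neq0 (a : posreal R) : Num.sqrt (posval a) != 0.
Proof. by rewrite gt_eqF// sqrtr_gt0 posval_gt0. Qed.

Let DRmulA : associative DRmul.
Proof.
move=> [[X Z] a] [[X' Z'] b] [[X'' Z''] c] /=.
rewrite sqrtrM; last by rewrite ltW// posval_gt0.
congr (_, _, _).
- by rewrite scalerDr addrA scalerA.
- rewrite [X' + _]addrC [X + _]addrC.
  rewrite frame_bracket_linearr frame_bracket_linearl.
  move: (frame_bracket X X'') (frame_bracket X X') (frame_bracket X' X'').
  move=> p q r; apply/rowP => l; rewrite !mxE.
  by have := sqrt_posvalK a; move: (Num.sqrt _) => s <-; ring.
- by apply: posval_inj; rewrite /posval/= mulrA.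
Qed.

Let DRmul1 : left_id DRone DRmul.
Proof.
move=> [[X Z] a]; rewrite /DRmul/DRone (_ : posval (posone R) = 1)//.
rewrite sqrtr1 !scale1r !add0r frame_bracket0l scaler0 addr0.
by congr (_, _, _); apply: posval_inj; rewrite /posval/= mul1r.
Qed.

Let DRmulr1 : right_id DRone DRmul.
Proof.
move=> [[X Z] a]; rewrite /= frame_bracket0r !scaler0 !addr0.
by congr (_, _, _); apply: posval_inj; rewrite /posval/= mulr1.
Qed.

Let DRmulV : left_inverse DRone DRinv DRmul.
Proof.
move=> [[X Z] a]; rewrite /DRmul /DRinv.
have -> : posval (posinv a) = (posval a)^-1 by [].
rewrite sqrtrV; last by rewrite ltW// posval_gt0.
rewrite frame_bracketZl frame_bracketxx !scaler0 addr0.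
rewrite !scaleNr !addNr.
congr (_, _, _); apply: posval_inj.
exact: mulVf (lt0r_neq0 (posval_gt0 a)).
Qed.

Let DRmulrV : right_inverse DRone DRinv DRmul.
Proof.
move=> [[X Z] a] /=.
rewrite frame_bracketZr frame_bracketxx !scaler0 addr0 !scalerA.
rewrite !mulrN !mulfV ?sqrt_posval_neq0 ?gt_eqF ?posval_gt0//.
rewrite !scaleN1r !subrr.
congr (_, _, _); apply: posval_inj.
exact: mulfV (lt0r_neq0 (posval_gt0 a)).
Qed.

HB.instance Definition _ := isGroup.Build (DRspace F)
  DRmulA DRmul1 DRmulr1 DRmulV DRmulrV.

End damek_ricci.

Section damek_ricci_metric.
Variables (R : realType) (n : euclideanLieAlgebra R) (m k : nat).
Variable F : orthonormal_frame n m k.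

(* a^-1 dX dZ da *)
Definition DRmeasure : {sigma_finite_measure set (DRspace F) -> \bar R} :=
  prod_measure (prod_measure (rV_lebesgue R m) (rV_lebesgue R k))
    (@posreal_haar R).

Definition DRcoord (x : DRspace F) : 'rV[R]_m * 'rV[R]_k * R :=
  (x.1.1, x.1.2, posval x.2).

(* The norm on the tangent space at e, which is n + R H. The frame being
   orthonormal, the coordinates of a tangent vector are orthonormal ones; the
   last is along H, since t |-> (0, 0, e^t) has velocity (0, 0, 1) at t = 0. *)
Definition DRnorm (w : 'rV[R]_m * 'rV[R]_k * R) : R :=
  Num.sqrt (\sum_i w.1.1 ord0 i ^+ 2 + \sum_j w.1.2 ord0 j ^+ 2 + w.2 ^+ 2).

Definition is_C1_curve (gam : R -> DRspace F) : Prop :=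
  (forall t, derivable (DRcoord \o gam) t 1) /\
  continuous (derive1 (DRcoord \o gam)).

(* The norm of gam'(t) for the left-invariant metric: gam'(t) is translated to e
   by the differential of the left translation by gam(t)^-1. *)
Definition DRspeed (gam : R -> DRspace F) (t : R) : R :=
  DRnorm (derive1 (fun s => DRcoord ((gam t)^-1 * gam s)%g) t).

Definition DRlength (gam : R -> DRspace F) : R :=
  \int[@lebesgue_measure R]_(t in `[0, 1]) DRspeed gam t.

(* [DRjoined x y l]: some piecewise C^1 curve from x to y has length l. The
   pieces are parametrized by [0, 1], which affects neither their regularity nor
   their length; a C^1 curve on [0, 1] is one that extends to a C^1 curve on R. *)
Inductive DRjoined (x : DRspace F) : DRspace F -> R -> Prop :=
| DRjoined_refl : DRjoined x x 0
| DRjoined_arc y l gam : DRjoined x y l -> is_C1_curve gam -> gam 0 = y ->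
    DRjoined x (gam 1) (l + DRlength gam).

Definition DRdist (x y : DRspace F) : R := inf [set l | DRjoined x y l].

End damek_ricci_metric.

Definition dist_max (R : realType) (T1 T2 : Type) (d1 : T1 -> T1 -> R)
    (d2 : T2 -> T2 -> R) (x y : T1 * T2) : R :=
  Num.max (d1 x.1 y.1) (d2 x.2 y.2).

Section calderon_zygmund.
Context d (T : measurableType d) (R : realType).
Variables (mu : {measure set T -> \bar R}) (dist : T -> T -> R).
Local Open Scope ereal_scope.

(* With the convention d(x, set0) = +oo. *)
Definition dist_to_set (x : T) (A : set T) : \bar R :=
  ereal_inf [set (dist x y)%:E | y in A].

Definition L1norm (f : T -> R) : \bar R := \int[mu]_x `|(f x)%:E|.

Definition CZ_set (kappa : R) (A : set T) : Prop :=
  exists2 r : R, (0 < r)%R &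
    (exists c s, (s <= kappa * r)%R /\ A `<=` [set y | (dist c y < s)%R]) /\
    mu [set x | dist_to_set x A < r%:E] <= kappa%:E * mu A.

Definition CZ_decomposition (Rfam : set (set T)) (kappa : R)
    (f : T -> R) (alpha : R) : Prop :=
  exists (g : T -> R) (b : nat -> T -> R) (A : nat -> set T),
    [/\ measurable_fun setT g,
        {ae mu, forall x, (\sum_(0 <= i < N) b i x)%R @[N --> \oo] --> (f x - g x)%R},
        {ae mu, forall x, (`|g x| <= kappa * alpha)%R},
        (forall i, [/\ Rfam (A i), mu.-integrable setT (EFin \o b i),
           (forall x, ~ A i x -> b i x = 0%R),
           \int[mu]_x (b i x)%:E = 0 &
           L1norm (b i) <= (kappa * alpha)%:E * mu (A i)]) &
        \sum_(0 <= i <oo) mu (A i) <= (kappa / alpha)%:E * L1norm f].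

Definition is_CZ_space (Rfam : set (set T)) (kappa : R) : Prop :=
  [/\ (0 < kappa)%R,
      Rfam `<=` measurable,
      (forall A, Rfam A -> CZ_set kappa A) &
      forall (f : T -> R) (alpha : R),
        mu.-integrable setT (EFin \o f) -> (0 < alpha)%R ->
        (mu setT < +oo -> kappa%:E * L1norm f < alpha%:E * mu setT) ->
        CZ_decomposition Rfam kappa f alpha].

End calderon_zygmund.

(* Main.v *)
Require Import Defs.
From mathcomp Require Import all_boot all_order all_algebra.
From mathcomp Require Import all_classical all_reals all_analysis.
From mathcomp Require Import measurable_realfun.
From mathcomp Require Import ring lra zify.

(* In the coordinates (X, Z, a) of a Damek-Ricci space put h = ln a. The right
   Haar measure is Lebesgue measure in (X, Z, h), and it is preserved by
   (X, Z, h) |-> (X, Z - shear X, h) for every measurable function shear of X. The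
   noncommutativity of N is dealt with by one such shear: it is built from a
   discontinuous primitive of x dy, summed along the triadic expansions of x and
   y, such that preimages of triadic boxes lie, at every scale, in left translates
   of boxes of N of comparable size. Hence plain triadic boxes in the
   sheared coordinates give nested partitions of S' and S''.

   A cell of logarithmic height l = 3 ^ s centred at h = c has sides of order
   e^(c/2) l e^(2l) in X and e^c l e^(16l) in Z. Its l-neighbourhood has comparable
   measure, because a path of length l changes h by at most l and X and Z by
   amounts exponential in l, and it has diameter O(l), because its points are
   joined by paths climbing to the height c + 50l. Products of two cells of the
   same height l are therefore Calderon-Zygmund sets of the product. Refining them
   step by step, first h and then the sides, changes the measure by bounded
   factors, and the cells around a point grow without bound; so every f and alpha
   admit a family of maximal cells on which the mean of |f| exceeds alpha, and the
   stopping-time construction gives the decomposition. Off these cells f is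
   bounded because a set can be covered, up to small measure, by cells. *)

Set Implicit Arguments.
Unset Strict Implicit.
Unset Printing Implicit Defensive.

Import Order.TTheory GRing.Theory Num.Theory.
Import numFieldNormedType.Exports.

Local Open Scope classical_set_scope.
Local Open Scope ring_scope.

(** * Calderon-Zygmund decomposition from nested partitions *)

(** Volume grows exponentially with the radius, so at large scales neither doubling nor a covering
    lemma for balls is at hand. Partitions are used because products of partitions are again
    partitions, so that selecting cells is no harder in a product than in one factor. Both factors
    share the logarithmic height l because a single radius r must control the diameters and the
    neighbourhoods in both.

    Cutting the height from 3l to l moves the target sides by factors exponential in l, which are
    unbounded. Hence a stage is a pair (s, u): at scale 3 ^ s the sides start from their values one
    scale up, and u counts cuts by 3, until the new values are reached. Each scale has infinitely
    many stages and there is no first scale, so the order is not well-founded; a first heavy stage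
    exists at a point only because heavy cells have bounded measure while the cells at scale s have
    measure at least 9 ^ s for large s.

    Regularity of the measure with respect to unions of cells stands in for a maximal inequality and
    for Lebesgue differentiation. *)

Section cells.
Context d (T : measurableType d) (R : realType).
Variable mu : {measure set T -> \bar R}.
Variables (Th K : countType) (before : Th -> Th -> Prop) (idx : Th -> T -> K).

Definition cell (th : Th) (x : T) : set T := [set y | idx th y = idx th x].

(** [before] runs from coarse to fine without a first element; [cell_first] asks for a first stage
    only when the cells concerned have bounded measure. In [cell_parent] the stage depends on the
    point and need not be the immediate predecessor, since at a first heavy cell every earlier stage
    is light. *)
Record cell_system (C : R) : Prop := CellSystem {
  cell_total : forall th1 th2, th1 <> th2 -> before th1 th2 \/ before th2 th1;
  cell_nested : forall th1 th2 x y, before th1 th2 ->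
    idx th2 x = idx th2 y -> idx th1 x = idx th1 y;
  cell_measurable : forall th x, measurable (cell th x);
  cell_gt0 : forall th x, (0 < mu (cell th x))%E;
  cell_fin : forall th x, (mu (cell th x) < +oo)%E;
  cell_parent : forall th x, exists2 th', before th' th &
    (mu (cell th' x) <= C%:E * mu (cell th x))%E;
  cell_first : forall x (V : R) (P : Th -> Prop),
    (forall th, P th -> (mu (cell th x) <= V%:E)%E) -> (exists th, P th) ->
    exists2 th, P th & forall th', before th' th -> ~ P th';
  cell_generate :
    measurable `<=` <<s [set A | exists th x, A = cell th x] >> }.

Variables (C : R) (HC : cell_system C) (th0 : Th).

Let kcell (th : Th) (k : K) : set T := [set y | idx th y = k].

Let kcellP th k : kcell th k = set0 \/ exists x, kcell th k = cell th x.
Proof.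
have [->|/set0P[x <-]] := eqVneq (kcell th k) set0; first by left.
by right; exists x.
Qed.

Section selection.
Variable P : Th -> K -> Prop.

Definition first_at th x := P th (idx th x) /\
  forall th', before th' th -> ~ P th' (idx th' x).

(** With [pickle_inv], unlike [unpickle], each pair is decoded from one number only, which makes
    these sets disjoint. *)
Definition selected (i : nat) : set T :=
  if @pickle_inv (Th * K)%type i is Some (th, k) then
    [set x | idx th x = k /\ first_at th x] else set0.

(** Earlier partitions are coarser, so whether [th] is first at [x] depends only on the cell of
    [x]. *)
Lemma selectedP i : selected i = set0 \/
  exists th x, selected i = cell th x /\ first_at th x.
Proof.
have [->|/set0P[x]] := eqVneq (selected i) set0; first by left.
rewrite /selected; case: pickle_inv => [[th k]|//] [xk fx]; right.
exists th, x; split => //; apply/seteqP; split => [y [yk fy]|y yx]/=.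
  by rewrite /cell/= yk.
have yk : idx th y = k by rewrite yx.
split => //; case: fx => Px nP; split; first by rewrite yk -xk.
move=> th' th'th; rewrite (_ : idx th' y = idx th' x); first exact: nP.
by apply: cell_nested HC _ _ _ _ th'th _; rewrite yk.
Qed.

Lemma measurable_selected i : measurable (selected i).
Proof.
have [->|[th [x [-> _]]]] := selectedP i; first exact: measurable0.
exact: cell_measurable HC _ _.
Qed.

Lemma trivIset_selected : trivIset setT selected.
Proof.
apply/trivIsetP => i j _ _ ij; apply/seteqP; split => // x [].
rewrite /selected; have := @pickle_invK (Th * K)%type i.
have := @pickle_invK (Th * K)%type j.
case: (pickle_inv i) => [[t1 c1]|//]; case: (pickle_inv j) => [[t2 c2]|//] /=.
move=> j2 i1 [x1 [P1 N1]] [x2 [P2 N2]].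
have [t12|/eqP t12] := eqVneq t1 t2.
  by move/eqP: ij; rewrite -i1 -j2 t12 -x1 -x2 t12.
by have [/N2|/N1] := cell_total HC t12.
Qed.

Lemma selected_cover x (V : R) :
  (forall th, P th (idx th x) -> (mu (cell th x) <= V%:E)%E) ->
  (exists th, P th (idx th x)) -> exists i, selected i x.
Proof.
move=> PV Pex; have [th Pth nP] := cell_first HC PV Pex.
by exists (pickle (th, idx th x)); rewrite /selected pickleK_inv.
Qed.

End selection.

(** The topology with the cells as a base; the base is countable and each cell is also closed. *)
Definition cell_open (U : set T) := forall x, U x -> exists th, cell th x `<=` U.

Lemma cell_open_cell th x : cell_open (cell th x).
Proof. by move=> y yx; exists th => z; rewrite /cell/= => ->. Qed.

Lemma cell_open_bigcup I (D : set I) (F : I -> set T) :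
  (forall i, D i -> cell_open (F i)) -> cell_open (\bigcup_(i in D) F i).
Proof.
move=> oF x [i Di Fix]; have [th thF] := oF _ Di _ Fix.
by exists th => y /thF Fiy; exists i.
Qed.

Lemma cell_openI U V : cell_open U -> cell_open V -> cell_open (U `&` V).
Proof.
move=> oU oV x [Ux Vx]; have [s sU] := oU _ Ux; have [t tV] := oV _ Vx.
have [st|/eqP st] := eqVneq s t.
  by exists s => y ys; split; [exact: sU|apply: tV; rewrite -st].
have [b|b] := cell_total HC st.
  exists t => y yt; split; last exact: tV.
  by apply: sU; exact: cell_nested HC _ _ _ _ b yt.
exists s => y yt; split; first exact: sU.
by apply: tV; exact: cell_nested HC _ _ _ _ b yt.
Qed.

Lemma cell_openE U : cell_open U -> exists A : (set T)^nat, U = \bigcup_i A i /\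
  forall i, A i = set0 \/ exists th x, A i = cell th x.
Proof.
move=> oU.
pose A i := if @pickle_inv (Th * K)%type i is Some (th, k) then
  (if `[< kcell th k `<=` U >] then kcell th k else set0) else set0.
exists A; split; last first.
  move=> i; rewrite /A; case: pickle_inv => [[th k]|]; last by left.
  case: ifPn => _; last by left.
  by have [->|[x ->]] := kcellP th k; [left|right; exists th, x].
apply/seteqP; split => [x Ux|x [i _]].
  have [th thU] := oU _ Ux; exists (pickle (th, idx th x)) => //.
  by rewrite /A pickleK_inv ifT//; exact/asboolP.
rewrite /A; case: pickle_inv => [[th k]|//]; case: ifPn => // /asboolP kU kx.
exact: kU.
Qed.

Lemma measurable_cell_open U : cell_open U -> measurable U.
Proof.
move=> /cell_openE[A [-> cA]]; apply: bigcupT_measurable => i.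
have [->|[th [x ->]]] := cA i; first exact: measurable0.
exact: cell_measurable HC _ _.
Qed.

(** * Outer regularity by open sets of the cell topology *)

Section regularity.
Variable x0 : T.
Let Q := cell th0 x0.

(** Outer regularity of [B] and of its complement at once: the part of [U] outside [B] lies in the
    overlap of [U] and [V]. The symmetry makes complements immediate, and leaves only countable
    unions to prove. *)
Let regular (B : set T) := forall e : R, 0 < e -> exists U V : set T,
  [/\ cell_open U /\ U `<=` Q, cell_open V /\ V `<=` Q, B `&` Q `<=` U,
      Q `\` B `<=` V & (mu (U `&` V) <= e%:E)%E].

Let Qfin U : cell_open U -> U `<=` Q -> (mu U < +oo)%E.
Proof.
move=> oU UQ; apply: le_lt_trans (cell_fin HC th0 x0).
by apply: le_measure => //; rewrite inE; [exact: measurable_cell_open|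
  exact: cell_measurable HC _ _].
Qed.

Let regular_cell th x : regular (cell th x).
Proof.
move=> e e0; exists (cell th x `&` Q), (Q `\` cell th x); split.
- split; last by move=> y [].
  by apply: cell_openI; exact: cell_open_cell.
- split; last by move=> y [].
  apply: cell_openI; first exact: cell_open_cell.
  by move=> y yx; exists th => z zy zx; apply: yx; rewrite /cell/= -zy.
- by [].
- by [].
- rewrite (_ : _ `&` _ = set0) ?measure0 ?lee_fin ?ltW//.
  by apply/seteqP; split => // y [[? _] [_]].
Qed.

Let regularC B : regular B -> regular (~` B).
Proof.
move=> rB e /rB[U [V [oU oV BU BV UV]]]; exists V, U; split => //.
- by move=> y [nB Qy]; apply: BV.
- by move=> y [Qy /contrapT By]; apply: BU.
- by rewrite setIC.
Qed.

Let regular_bigcup (B : (set T)^nat) :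
  (forall n, regular (B n)) -> regular (\bigcup_n B n).
Proof.
move=> rB e e0.
have e20 n : 0 < e / 2 / (2 ^ n.+1)%:R by rewrite !divr_gt0// ltr0n expn_gt0.
have /choice[UV UVP] : forall n, exists p : set T * set T,
    [/\ cell_open p.1 /\ p.1 `<=` Q, cell_open p.2 /\ p.2 `<=` Q,
    B n `&` Q `<=` p.1, Q `\` B n `<=` p.2 &
    (mu (p.1 `&` p.2) <= (e / 2 / (2 ^ n.+1)%:R)%:E)%E].
  by move=> n; have [U [V H]] := rB n _ (e20 n); exists (U, V).
pose U := \bigcup_n (UV n).1.
have oU : cell_open U by apply: cell_open_bigcup => n _; have [[]] := UVP n.
have UQ : U `<=` Q by move=> x [n _]; have [[_ UQ] _ _ _ _] := UVP n; exact: UQ.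
pose F N := U `\` \bigcup_(n < N) (UV n).1.
have mU1 n : measurable (UV n).1 by apply: measurable_cell_open; have [[]] := UVP n.
have mU2 n : measurable (UV n).2 by apply: measurable_cell_open; have [_ []] := UVP n.
have mF N : measurable (F N).
  apply: measurableD; first exact: measurable_cell_open.
  by apply: bigcup_measurable => k _.
have F0 : \bigcap_n F n = set0.
  apply/seteqP; split => // x Fx; have [[n _ Ux] _] := Fx 0%N I.
  by have [_] := Fx n.+1 I; apply; exists n => //=.
have [N FN] : exists N, (mu (F N) <= (e / 2)%:E)%E.
  have : mu (F n) @[n --> \oo] --> 0%E.
    rewrite -(measure0 mu) -F0; apply: nonincreasing_cvg_mu => //.
    - apply: le_lt_trans (Qfin oU UQ).
      by apply: le_measure; rewrite ?inE//; [exact: measurable_cell_open|move=> x []].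
    - by rewrite F0.
    - move=> n m nm; apply/subsetPset => x [Ux nx]; split => // -[k/= kn Uk].
      by apply: nx; exists k => //=; exact: leq_trans nm.
  have e2 : (0 < (e / 2)%:E)%E by rewrite lte_fin divr_gt0.
  move=> /fine_cvgP[/= fi ci].
  have /cvgrPdist_lt/(_ (e/2)) := ci; rewrite divr_gt0// => /(_ isT) ci'.
  have [N _ HN] := filterI fi ci'; have /= := HN N (leqnn N).
  rewrite sub0r normrN => -[fN lN]; exists N; rewrite -(fineK fN) lee_fin ltW//.
  by apply: le_lt_trans lN; exact: ler_norm.
(* An infinite intersection of open sets need not be open, so only the first [N] are intersected.
   The points of [U] outside the first [N] sets [(UV n).1] form the tail [F N], of measure at most
   [e / 2]. *)
pose V := (\bigcap_(n < N) (UV n).2) `&` Q.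
exists U, V; split.
- by [].
- split; last by move=> x [].
  rewrite /V; elim: N {F0 FN V} => [|N IH].
    by rewrite bigcap_mkord big_ord0 setTI; exact: cell_open_cell.
  have := cell_openI IH (_ : cell_open (UV N).2).
  rewrite !bigcap_mkord big_ord_recr/= setIAC; apply.
  by have [_ []] := UVP N.
- by move=> x [[n _ Bx] Qx]; exists n => //; have [_ _ + _ _] := UVP n; apply.
- move=> x [Qx nB]; split => // n _; have [_ _ _ + _] := UVP n; apply.
  by split => // Bx; apply: nB; exists n.
have UVI : U `&` V `<=` (\bigcup_n ((UV n).1 `&` (UV n).2)) `|` F N.
  move=> x [Ux [Vx _]]; have [[n /= nN Un]|nU] := pselect ((\bigcup_(n < N) (UV n).1) x).
    by left; exists n => //; split => //; exact: Vx.
  by right.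
have mW : measurable (\bigcup_n ((UV n).1 `&` (UV n).2)).
  by apply: bigcupT_measurable => n; exact: measurableI.
apply: (@le_trans _ _ (mu ((\bigcup_n ((UV n).1 `&` (UV n).2)) `|` F N))).
  apply: le_measure; rewrite ?inE//.
    apply: measurableI; first exact: measurable_cell_open.
    apply: measurableI; last exact: cell_measurable HC _ _.
      rewrite bigcap_mkcond; apply: bigcapT_measurable => n.
    by case: ifPn => _; [exact: mU2|exact: measurableT].
  exact: measurableU.
apply: le_trans (measureU2 _ mW (mF N)) _.
rewrite [leRHS](_ : _ = (e / 2)%:E + (e / 2)%:E)%E; last by rewrite -EFinD -splitr.
rewrite leeD//.
apply: le_trans (measure_sigma_subadditive mu _ mW (@subset_refl _ _)) _.
  by move=> n; exact: measurableI.
apply: le_trans (_ : _ <= \sum_(0 <= i <oo) (0 + (e / 2 / (2 ^ i.+1)%:R)%:E))%E _.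
  apply: lee_nneseries => n _ //; rewrite add0e.
  by have [] := UVP n.
have e2 : 0 <= e / 2 by rewrite divr_ge0// ltW.
apply: le_trans (epsilon_trick xpredT (fun=> lexx 0%E) e2) _.
by rewrite eseries0 ?add0e.
Qed.

Lemma cell_regular (B : set T) (e : R) : measurable B -> 0 < e ->
  exists U, [/\ cell_open U, U `<=` Q, B `&` Q `<=` U &
    (mu U <= mu (B `&` Q) + e%:E)%E].
Proof.
(* The regular sets form a sigma-algebra containing the cells. *)
move=> mB e0; have : regular B.
  have := cell_generate HC mB; apply.
  split; last by move=> _ [th [x ->]]; exact: regular_cell.
  split.
  - move=> e' e'0; exists set0, Q; split => //.
    + by split => x.
    + by split => //; exact: cell_open_cell.
    + by rewrite set0I measure0 lee_fin ltW.
  - by move=> A rA; rewrite setTD; exact: regularC.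
  - exact: regular_bigcup.
move=> /(_ e e0)[U [V [[oU UQ] [oV VQ] BU BV UVe]]].
exists U; split => //.
have mQ : measurable Q by exact: cell_measurable HC _ _.
have mU := measurable_cell_open oU; have mV := measurable_cell_open oV.
apply: (@le_trans _ _ (mu ((B `&` Q) `|` (U `&` V)))).
  apply: le_measure; rewrite ?inE//.
    by apply: measurableU; exact: measurableI.
  move=> x Ux; have [Bx|nBx] := pselect (B x); first by left; split => //; exact: UQ.
  by right; split => //; apply: BV; split => //; exact: UQ.
apply: le_trans (measureU2 _ _ _) _; try exact: measurableI.
by rewrite leeD2l.
Qed.

End regularity.

(** * The stopping-time decomposition *)

Section decomposition.
Variables (f : T -> R) (alpha : R).
Hypotheses (fint : mu.-integrable setT (EFin \o f)) (a0 : 0 < alpha).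

Let mf : measurable_fun setT f.
Proof. by apply/measurable_EFinP; exact: measurable_int fint. Qed.

Let mnf (D : set T) : measurable_fun D (fun x => `|(f x)%:E|%E).
Proof.
apply: measurable_funTS; apply: measurableT_comp => //.
exact/measurable_EFinP.
Qed.

Let absint (A : set T) : \bar R := (\int[mu]_(x in A) `|(f x)%:E|)%E.

Let absint_le (A B : set T) : measurable A -> measurable B -> A `<=` B ->
  (absint A <= absint B)%E.
Proof. by move=> mA mB AB; apply: ge0_subset_integral. Qed.

Let absintT : (absint setT < +oo)%E.
Proof. by have /integrableP[_] := fint. Qed.

Let absint_fin A : measurable A -> absint A \is a fin_num.
Proof.
move=> mA; rewrite ge0_fin_numE; first by rewrite (le_lt_trans _ absintT)// absint_le.
exact: integral_ge0.
Qed.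

Definition heavy (th : Th) (k : K) : Prop :=
  (alpha%:E * mu [set x | idx th x = k]
    < \int[mu]_(x in [set x | idx th x = k]) `|(f x)%:E|)%E.

Let heavyE th x : heavy th (idx th x) =
  (alpha%:E * mu (cell th x) < absint (cell th x))%E.
Proof. by []. Qed.

Let mcell := cell_measurable HC.

Let heavy_bounded th x : heavy th (idx th x) ->
  (mu (cell th x) <= (fine (absint setT) / alpha)%:E)%E.
Proof.
rewrite heavyE => /ltW h.
have fc : mu (cell th x) \is a fin_num.
  by rewrite ge0_fin_numE// (cell_fin HC).
have := le_trans h (absint_le (mcell th x) measurableT (@subsetT _ _)).
rewrite -(fineK fc) -(fineK (absint_fin measurableT)) -EFinM !lee_fin.
by rewrite ler_pdivlMr// mulrC.
Qed.

Let light : set T := [set x | forall th, ~ heavy th (idx th x)].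

Let lightE : light = ~` (\bigcup_i selected heavy i).
Proof.
apply/seteqP; split => [x lx [i _]|x nx th hx].
  have [->//|[th [y [-> [hy _]]]]] := selectedP heavy i.
  by move=> xy; apply: (lx th); rewrite xy.
apply: nx; have [|i ix] := @selected_cover heavy x _ (fun th => @heavy_bounded th x).
  by exists th.
by exists i.
Qed.

Let measurable_light : measurable light.
Proof.
rewrite lightE; apply: measurableC; apply: bigcupT_measurable => i.
exact: measurable_selected.
Qed.

(* A set of light points is almost filled by disjoint light cells, on each of
   which the mean of |f| is at most alpha. *)
Let light_mean (B : set T) x0 : measurable B -> B `<=` light ->
  (absint (B `&` cell th0 x0) <= alpha%:E * mu (B `&` cell th0 x0))%E.
Proof.
move=> mB Bl; set Q := cell th0 x0; set A := B `&` Q.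
have mA : measurable A by apply: measurableI => //; exact: mcell.
apply/lee_addgt0Pr => e e0.
have ea : 0 < e / alpha by rewrite divr_gt0.
have [U [oU UQ AU Ue]] := cell_regular x0 mB ea.
have mU := measurable_cell_open oU.
pose P th k := [set y | idx th y = k] `<=` U /\ exists2 y, idx th y = k & A y.
pose S := \bigcup_i selected P i.
have mS : measurable S.
  by apply: bigcupT_measurable => i; exact: measurable_selected.
have AS : A `<=` S.
  move=> x Ax; have Ux := AU _ Ax; have [th thU] := oU _ Ux.
  have [t [tU _]||i ix] := @selected_cover P x (fine (mu U)); last by exists i.
    rewrite fineK; first by apply: le_measure; rewrite ?inE//; exact: mcell.
    rewrite ge0_fin_numE//; apply: le_lt_trans (cell_fin HC th0 x0).
    by apply: le_measure; rewrite ?inE//; exact: mcell.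
  by exists th; split => //; exists x.
have SU : S `<=` U.
  move=> x [i _]; have [->//|[th [y [-> [[yU _] _]]]]] := selectedP P i.
  exact: yU.
apply: (@le_trans _ _ (absint S)); first exact: absint_le.
apply: (@le_trans _ _ (alpha%:E * mu S)%E); last first.
  apply: (@le_trans _ _ (alpha%:E * (mu A + (e / alpha)%:E))%E).
    rewrite lee_pmul2l//; apply: le_trans Ue.
    by apply: le_measure; rewrite ?inE.
  rewrite ge0_muleDr//; last by rewrite lee_fin ltW.
  by rewrite -EFinM mulrC divfK ?gt_eqF.
rewrite /absint ge0_integral_bigcup//; last first.
- exact: trivIset_selected.
- by move=> i; exact: measurable_selected.
rewrite measure_semi_bigcup//; last first.
- exact: trivIset_selected.
- by move=> i; exact: measurable_selected.
rewrite -nneseriesZl//.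
apply: lee_nneseries => i _; first by move=> _; apply: integral_ge0.
have [->|[th [y [-> [[_ [z zy Az]] _]]]]] := selectedP P i.
  by rewrite integral_set0 measure0 mule0.
have /Bl/(_ th)/negP := Az.1; rewrite zy /heavy -leNgt; exact.
Qed.

(** On the light points of a cell where |f| > 2 alpha, the integral of |f| is at least 2 alpha times
    the measure, and by [light_mean] at most alpha times it; so the measure is 0. Any factor above 1
    would do. *)
Let ae_light_le : {ae mu, forall x, light x -> `|f x| <= 2 * alpha}.
Proof.
pose B := light `&` [set x | 2 * alpha < `|f x|].
have mB : measurable B.
  apply: measurableI => //; rewrite -[X in measurable X]setTI.
  have : measurable_fun setT (fun x => `|f x|) by exact: measurableT_comp.
  move=> /(_ measurableT `]2 * alpha, +oo[%classic (measurable_itv _)).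
  by congr (measurable _); apply/seteqP; split => x; rewrite /= in_itv/= andbT.
have BQ x0 : mu.-negligible (B `&` cell th0 x0).
  have mA : measurable (B `&` cell th0 x0) by apply: measurableI => //; exact: mcell.
  apply/negligibleP => //; change (mu (B `&` cell th0 x0) = 0%E).
  have fA : mu (B `&` cell th0 x0) \is a fin_num.
    rewrite ge0_fin_numE//; apply: le_lt_trans (cell_fin HC th0 x0).
    by apply: le_measure; rewrite ?inE//; exact: mcell.
  have : ((2 * alpha)%:E * mu (B `&` cell th0 x0) <=
          alpha%:E * mu (B `&` cell th0 x0))%E.
    apply: le_trans (light_mean x0 mB _); last by move=> x [].
    rewrite -integral_cst//; apply: ge0_le_integral => //.
      by move=> x _; rewrite lee_fin mulr_ge0// ltW.
    by move=> x [[_ /= +] _]; rewrite lee_fin => /ltW.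
  rewrite -(fineK fA) -!EFinM lee_fin => h.
  suff -> : fine (mu (B `&` cell th0 x0)) = 0 by [].
  have : 0 <= fine (mu (B `&` cell th0 x0)) by exact: fine_ge0.
  by rewrite le_eqVlt => /predU1P[//|m0]; have := mulr_gt0 a0 m0; lra.
pose F i := if @unpickle K i is Some k then B `&` kcell th0 k else set0.
have Fn i : mu.-negligible (F i).
  rewrite /F; case: unpickle => [k|]; last exact: negligible_set0.
  by have [->|[x ->]] := kcellP th0 k; rewrite ?setI0//; exact: negligible_set0.
have := negligible_bigcup Fn; apply: negligibleS => x /= nx.
exists (pickle (idx th0 x)) => //; rewrite /F pickleK; split => //.
split; first by apply: contrapT => nlx; apply: nx.
by rewrite /= ltNge; apply/negP => h; apply: nx.
Qed.

Let A := selected heavy.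

Let mA i : measurable (A i). Proof. exact: measurable_selected. Qed.

Let Afin i : mu (A i) \is a fin_num.
Proof.
have [E|[th [y [E _]]]] := selectedP heavy i; rewrite /A E ?measure0//.
by rewrite ge0_fin_numE//; exact: (cell_fin HC).
Qed.

(** A selected cell is the first heavy one around its points, so the larger cell [cell th' y] is not
    heavy. *)
Let absint_le_A i : (absint (A i) <= (C * alpha)%:E * mu (A i))%E.
Proof.
have [E|[th [y [E [_ nh]]]]] := selectedP heavy i; rewrite /A E.
  by rewrite measure0 mule0 /absint integral_set0.
have [th' th'th Hle] := cell_parent HC th y.
apply: (@le_trans _ _ (absint (cell th' y))).
  apply: absint_le; [exact: mcell|exact: mcell|].
  by move=> z; exact: (cell_nested HC th'th).
have /negP := nh _ th'th; rewrite /heavy -leNgt => /le_trans; apply.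
by rewrite mulrC EFinM -muleA lee_pmul2l.
Qed.

Let alpha_le_A i : (alpha%:E * mu (A i) <= absint (A i))%E.
Proof.
have [E|[th [y [E [h _]]]]] := selectedP heavy i; rewrite /A E.
  by rewrite measure0 mule0 /absint integral_set0.
exact: ltW.
Qed.

Let avg i : R := fine (\int[mu]_(x in A i) (f x)%:E) / fine (mu (A i)).

Let fintA i : mu.-integrable (A i) (EFin \o f).
Proof. exact: integrableS fint. Qed.

Let avgE i : ((avg i)%:E * mu (A i) = \int[mu]_(x in A i) (f x)%:E)%E.
Proof.
have fi : (\int[mu]_(x in A i) (f x)%:E)%E \is a fin_num.
  exact: integrable_fin_num (fintA i).
(* Cells have positive measure, so division by 0 concerns only the empty [A i]. *)
have [E|/eqP n0] := eqVneq (fine (mu (A i))) 0.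
  have A0 : mu (A i) = 0%E by rewrite -(fineK (Afin i)) E.
  rewrite A0 mule0; apply/esym.
  by apply: null_set_integral => //; exact: measurable_int (fintA i).
rewrite -{1}(fineK (Afin i)) -EFinM /avg divfK ?fineK//.
exact/eqP.
Qed.

Let avg_abs i : ((`|avg i|)%:E * mu (A i) <= absint (A i))%E.
Proof.
rewrite -[X in (_ * X)%E](gee0_abs (measure_ge0 mu (A i))) -abse_EFin -abseM avgE.
by apply: le_abse_integral => //; apply: measurable_funTS; exact/measurable_EFinP.
Qed.

Let b i : T -> R := (fun x => f x - avg i) \_ (A i).

Let b_int_in i : mu.-integrable (A i) (EFin \o (fun x => f x - avg i)).
Proof.
rewrite (_ : _ \o _ = (fun x => (EFin \o f) x - (EFin \o cst (avg i)) x)%E)//.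
apply: integrableB => //.
apply: measurable_bounded_integrable => //.
  by rewrite -ge0_fin_numE.
by exists `|avg i|; split; [exact: num_real|move=> M /ltW h x _].
Qed.

Let b_int i : mu.-integrable setT (EFin \o b i).
Proof. by rewrite /b -restrict_EFin; apply/(integrable_mkcond _ (mA i)); exact: b_int_in. Qed.

Let b_mean i : (\int[mu]_x (b i x)%:E = 0)%E.
Proof.
have -> : (fun x => (b i x)%:E) = (EFin \o (fun x => f x - avg i)) \_ (A i).
  by rewrite restrict_EFin.
rewrite -integral_mkcond.
rewrite (_ : _ \o _ = (fun x => (EFin \o f) x - (EFin \o cst (avg i)) x)%E)//.
rewrite integralB//; last first.
  apply: measurable_bounded_integrable => //; first by rewrite -ge0_fin_numE.
  by exists `|avg i|; split; [exact: num_real|move=> M /ltW h x _].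
rewrite [X in (_ - X)%E](_ : _ = (avg i)%:E * mu (A i))%E; last first.
  exact: (integral_cst mu (mA i) (avg i)%:E).
rewrite avgE subee//.
exact: integrable_fin_num (fintA i).
Qed.

Let b_norm i : (L1norm mu (b i) <= (2 * C * alpha)%:E * mu (A i))%E.
Proof.
rewrite /L1norm; have -> : (fun x => `|(b i x)%:E|%E) =
    (fun x => `|(f x - avg i)%:E|%E) \_ (A i).
  apply/funext => x; rewrite /b !patchE; case: ifP => // _.
  by rewrite abse0.
rewrite -integral_mkcond.
apply: (@le_trans _ _ (\int[mu]_(x in A i) (`|(f x)%:E| + (`|avg i|)%:E))%E).
  apply: ge0_le_integral => //.
  - by move: (b_int_in i) => /integrableP[+ _] => /(measurableT_comp _); apply.
  - by apply: emeasurable_funD.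
  - by move=> x _; rewrite -EFinD lee_fin ler_normB.
rewrite ge0_integralD// integral_cst//.
apply: le_trans (leeD (absint_le_A i) (le_trans (avg_abs i) (absint_le_A i))) _.
rewrite -(fineK (Afin i)) -!EFinM -EFinD lee_fin le_eqVlt; apply/orP; left.
by apply/eqP; ring.
Qed.

(** At each point at most one term of the series is nonzero, so the limit exists everywhere; [g] is
    [avg i] on [A i] and [f] on [light]. *)
Let g : T -> R := fun x => f x - limn (fun N => \sum_(0 <= i < N) b i x).

Let b_out i x : ~ A i x -> b i x = 0.
Proof. by move=> nAx; rewrite /b patchE memNset. Qed.

Let b_sum_cvg x i : (forall j, j <> i -> b j x = 0) ->
  (fun N => \sum_(0 <= i < N) b i x) @ \oo --> b i x.
Proof.
move=> bj; apply: cvg_near_cst; exists i.+1 => // N /= iN.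
rewrite big_mkord (bigD1 (Ordinal iN))//= big1 ?addr0// => j ji.
by apply: bj => ji'; move/eqP: ji; apply; exact: val_inj.
Qed.

Let A_inj x i j : A i x -> A j x -> i = j.
Proof.
move=> Aix Ajx; have [//|/eqP ij] := eqVneq i j.
have := @trivIset_selected heavy; rewrite -/A => /trivIsetP/(_ i j I I).
by move=> /(_ (introN eqP ij))/seteqP[/(_ x)]; case.
Qed.

Let b_sum_in x i : A i x -> (fun N => \sum_(0 <= i < N) b i x) @ \oo --> b i x.
Proof.
move=> Aix; apply: b_sum_cvg => j ji; apply: b_out => Ajx.
by apply: ji; exact: A_inj Ajx Aix.
Qed.

Let b_sum_light x : light x -> (fun N => \sum_(0 <= i < N) b i x) @ \oo --> (0 : R).
Proof.
move=> lx; have b0 i : b i x = 0.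
  by apply: b_out => Aix; move: lx; rewrite lightE; apply; exists i.
by have := @b_sum_cvg x 0%N (fun j _ => b0 j); rewrite b0.
Qed.

Let g_in x i : A i x -> g x = avg i.
Proof.
move=> Aix; rewrite /g (cvg_lim (@Rhausdorff R) (b_sum_in Aix)).
by rewrite /b patchE mem_set// subKr.
Qed.

Let g_light x : light x -> g x = f x.
Proof. by move=> lx; rewrite /g (cvg_lim (@Rhausdorff R) (b_sum_light lx)) subr0. Qed.

Let b_cvg x : (fun N => \sum_(0 <= i < N) b i x) @ \oo --> f x - g x.
Proof.
rewrite /g subKr; have [lx|] := pselect (light x).
  by rewrite (cvg_lim (@Rhausdorff R) (b_sum_light lx)); exact: b_sum_light.
rewrite lightE => /contrapT[i _ Aix].
by rewrite (cvg_lim (@Rhausdorff R) (b_sum_in Aix)); exact: b_sum_in.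
Qed.

Let measurable_g : measurable_fun setT g.
Proof.
rewrite (_ : g = fun x => f x - (f x - g x)); last by apply/funext => x; rewrite subKr.
apply: measurable_funB => //.
apply: (@measurable_fun_cvg _ _ _ _ (fun N x => \sum_(0 <= i < N) b i x)).
  move=> N; apply: measurable_sum => i.
  by apply/measurable_EFinP; exact: measurable_int (b_int i).
by move=> x _; exact: b_cvg.
Qed.

Let avg_le i : A i !=set0 -> `|avg i| <= C * alpha.
Proof.
move=> [x Aix]; have := le_trans (avg_abs i) (absint_le_A i).
have A0 : 0 < fine (mu (A i)).
  rewrite fine_gt0//; apply/andP; split; last by rewrite -ge0_fin_numE.
  have [E|[th [y [E _]]]] := selectedP heavy i.
    by move: Aix; rewrite /A E.
  by rewrite /A E; exact: cell_gt0 HC _ _.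
by rewrite -(fineK (Afin i)) -!EFinM lee_fin ler_pM2r.
Qed.

(** [Rfam set0] serves the codes [i] that select nothing. The bound 2 comes from [ae_light_le], and
    2 C from [b_norm], where |f| and its mean contribute C alpha each. *)
Theorem cell_CZ_decomposition (Rfam : set (set T)) (kappa : R) :
  2 <= kappa -> 2 * C <= kappa -> Rfam set0 -> (forall th x, Rfam (cell th x)) ->
  CZ_decomposition mu Rfam kappa f alpha.
Proof.
move=> k2 kC R0 Rc; exists g, b, A; split => //.
- by apply: aeW => x; exact: b_cvg.
- case: ae_light_le => N [mN N0 HN]; exists N; split => // x /= ngx.
  apply: HN => /= hx; apply: ngx.
  have [lx|] := pselect (light x).
    rewrite (g_light lx); apply: le_trans (hx lx) _.
    by rewrite ler_pM2r.
  rewrite lightE => /contrapT[i _ Aix]; rewrite (g_in Aix).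
  apply: le_trans (avg_le _) _; first by exists x.
  rewrite ler_pM2r//; have : 0 <= C * alpha.
    by apply: le_trans (normr_ge0 _) (avg_le (ex_intro _ x Aix)).
  by rewrite pmulr_lge0//; lra.
- move=> i; split => //.
  + by have [E|[th [y [E _]]]] := selectedP heavy i; rewrite /A E.
  + by move=> x; exact: b_out.
  + apply: le_trans (b_norm i) _.
    by rewrite lee_wpmul2r// lee_fin ler_pM2r.
- apply: (@le_trans _ _ (\sum_(0 <= i <oo) ((alpha^-1)%:E * absint (A i)))%E).
    apply: lee_nneseries => // i _; rewrite -(fineK (Afin i)) -(fineK (absint_fin (mA i))).
    rewrite -EFinM lee_fin -ler_pdivrMl ?invr_gt0// invrK.
    by have := alpha_le_A i; rewrite -(fineK (Afin i)) -(fineK (absint_fin (mA i))) -EFinM lee_fin.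
  rewrite nneseriesZl; last by move=> i _; exact: integral_ge0.
  rewrite -ge0_integral_bigcup//; last exact: trivIset_selected.
  apply: (@le_trans _ _ ((alpha^-1)%:E * absint setT)%E).
    rewrite lee_pmul2l// ?lte_fin ?invr_gt0//; apply: absint_le => //.
    exact: bigcupT_measurable.
  rewrite lee_wpmul2r//; first exact: integral_ge0.
  by rewrite lee_fin -[leLHS]mul1r ler_pM2r ?invr_gt0//; lra.
Qed.

End decomposition.
End cells.

(** * Triadic intervals *)

Section triadic.
Variable R : realType.
Implicit Types (i j p : int) (x y z : R).

(* 3 ^ i, in a form that compares well with the other exponentials *)
Definition pow3 i : R := expR (i%:~R * ln 3).

Lemma pow3_gt0 i : 0 < pow3 i. Proof. exact: expR_gt0. Qed.
Hint Resolve pow3_gt0 : core.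

Lemma pow3D i j : pow3 (i + j) = pow3 i * pow3 j.
Proof. by rewrite /pow3 intrD mulrDl expRD. Qed.

Lemma pow30 : pow3 0 = 1. Proof. by rewrite /pow3 mul0r expR0. Qed.

Lemma pow31 : pow3 1 = 3.
Proof. by rewrite /pow3 mul1r lnK// posrE. Qed.

Lemma pow3S i : pow3 (i + 1) = 3 * pow3 i.
Proof. by rewrite pow3D pow31 mulrC. Qed.

Lemma pow3P i : pow3 i = 3 * pow3 (i - 1).
Proof. by rewrite -pow3S subrK. Qed.

Lemma ln3_gt0 : 0 < ln 3 :> R. Proof. by rewrite ln_gt0// ltr1n. Qed.

Lemma ler_pow3 i j : i <= j -> pow3 i <= pow3 j.
Proof.
by move=> ij; rewrite ler_expR ler_pM2r ?ln3_gt0// ler_int.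
Qed.

Lemma pow3_nat (n : nat) : pow3 n%:Z = 3 ^+ n.
Proof. by rewrite /pow3 expRM_natl lnK// posrE. Qed.

Lemma pow3N i : pow3 (- i) = (pow3 i)^-1.
Proof. by rewrite /pow3 mulrNz mulNr expRN. Qed.

(** Intervals centred at the multiples of 3 ^ i: such partitions are nested for ratio 3, though not
    for ratio 2. As 0 is a centre at every scale, [tric i x] vanishes for large [i], on which the
    convergence of [area] rests. *)
Definition tri i x : int := Num.floor (x / pow3 i + 2^-1).
Definition tric i x : R := (tri i x)%:~R * pow3 i.

Lemma triP i x (n : int) : (tri i x = n) <->
  (n%:~R - 2^-1) * pow3 i <= x < (n%:~R + 2^-1) * pow3 i.
Proof.
have e0 := pow3_gt0 i.
have /andP[h1 h2] := floor_itv (x / pow3 i + 2^-1).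
split => [<-|/andP[H1 H2]].
  rewrite -ler_pdivlMr// -ltr_pdivrMr//; move: h2; rewrite intrD => h2.
  by apply/andP; split; rewrite /tri; lra.
apply: floor_def; rewrite intrD.
move: H1 H2; rewrite -ler_pdivlMr// -ltr_pdivrMr// => H1 H2.
by apply/andP; split; lra.
Qed.

Lemma tric_close i x : `|x - tric i x| <= pow3 i / 2.
Proof.
have /andP[h1 h2] := (triP i x _).1 erefl.
by rewrite /tric ler_norml; apply/andP; split; nra.
Qed.

Lemma tri_eq_tric i x y : tri i x = tri i y -> tric i x = tric i y.
Proof. by rewrite /tric => ->. Qed.

Lemma tri_eq_close i x y : tri i x = tri i y -> `|x - y| <= pow3 i.
Proof.
move=> /tri_eq_tric xy; have := tric_close i x; have := tric_close i y.
by rewrite xy !ler_norml => /andP[? ?] /andP[? ?]; apply/andP; split; lra.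
Qed.

(** The children of the interval [q] are [3 q - 1], [3 q] and [3 q + 1]. *)
Lemma tri_step i x : tri (i + 1) x = ((tri i x + 1) %/ 3)%Z.
Proof.
apply/triP; have /andP[h1 h2] := (triP i x _).1 erefl.
set n := tri i x in h1 h2 *; rewrite pow3S.
have e0 := pow3_gt0 i.
set q := ((n + 1) %/ 3)%Z.
have [q1 q2] : (3 * q <= n + 1)%R /\ (n + 1 <= 3 * q + 2)%R by rewrite /q; lia.
have {}q1 : 3 * q%:~R <= n%:~R + 1 :> R by rewrite -(intrM _ 3) -(intrD _ _ 1) ler_int.
have {}q2 : n%:~R + 1 <= 3 * q%:~R + 2 :> R.
  by rewrite -(intrM _ 3) -(intrD _ _ 1) -(intrD _ _ 2) ler_int.
apply/andP; split.
  apply: le_trans h1; rewrite mulrA ler_pM2r//; lra.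
by apply: lt_le_trans h2 _; rewrite mulrA ler_pM2r//; lra.
Qed.

Lemma tri_coarse i j x y : i <= j -> tri i x = tri i y -> tri j x = tri j y.
Proof.
move=> ij xy; have [n ->] : exists n : nat, j = i + n%:Z.
  by exists `|j - i|%N; lia.
elim: n {ij} => [|n IH]; first by rewrite addr0.
by rewrite -addn1 PoszD addrA !tri_step IH.
Qed.

Lemma tric_step i x : `|tric i x - tric (i + 1) x| <= 2 * pow3 i.
Proof.
have := tric_close i x; have := tric_close (i + 1) x; rewrite pow3S.
by rewrite !ler_norml => /andP[? ?] /andP[? ?]; apply/andP; split; lra.
Qed.

Lemma tric_le i x : `|tric i x| <= `|x| + pow3 i.
Proof.
have := tric_close i x; have e0 := pow3_gt0 i; have := ler_norm x.
have : - x <= `|x| by rewrite -normrN ler_norm.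
by rewrite !ler_norml => ? ? /andP[? ?]; apply/andP; split; lra.
Qed.

Lemma tric_neq0 i x : tric i x != 0 -> pow3 i <= 2 * `|x|.
Proof.
move=> c0; have : tri i x != 0 by apply: contraNneq c0 => h; rewrite /tric h mul0r.
have /andP[h1 h2] := (triP i x _).1 erefl; have e0 := pow3_gt0 i.
have xx := ler_norm x; have xx' : - x <= `|x| by rewrite -normrN ler_norm.
move=> n0; have [n1|n1] : (tri i x <= -1)%R \/ (1 <= tri i x)%R by lia.
  have : (tri i x)%:~R <= -1 :> R by rewrite -(ler_int R) in n1.
  by nra.
have : 1 <= (tri i x)%:~R :> R by rewrite -(ler_int R) in n1.
by nra.
Qed.

Lemma measurable_tric d (T : measurableType d) (f : T -> R) i :
  measurable_fun setT f -> measurable_fun setT (fun t => tric i (f t)).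
Proof.
move=> mf _ Y _; rewrite setTI.
rewrite (_ : _ @^-1` Y = \bigcup_(n in [set n : int | Y (n%:~R * pow3 i)])
   (f @^-1` `[(n%:~R - 2^-1) * pow3 i, (n%:~R + 2^-1) * pow3 i[)).
  rewrite bigcup_mkcond; apply: countable_bigcupT_measurable => [|n]; first exact: countableP.
  case: ifPn => // _.
  by rewrite -[X in measurable X]setTI; apply: mf => //; exact: measurable_itv.
apply/seteqP; split => [t Yt|t [n Yn]].
  by exists (tri i (f t)) => //=; rewrite in_itv/=; exact/triP.
by rewrite /= in_itv/= => /triP h; rewrite /tric h.
Qed.

(* The sum over the triadic scales [i] of [tric i x * (tric (i-1) y - tric i y)]
   is a discontinuous substitute for a primitive of [x dy]: on a triadic square
   of side [3 ^ p] it agrees with the integral of the form, up to [O(9 ^ p)]. *)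
Definition area_term i x y : R := tric i x * (tric (i - 1) y - tric i y).

Definition area_part p (n : nat) x y : R :=
  \sum_(j < n) area_term (p - j%:Z) x y.

(** A series over all integer scales: pairing [j + 1] with [- j] makes the n-th partial sum run over
    the scales from [n] down to [1 - n]. *)
Definition area_seq x y : R^nat :=
  series (fun j : nat => area_term (j%:Z + 1) x y + area_term (- j%:Z) x y).

Definition area x y : R := limn (area_seq x y).

Lemma area_seqE x y (n : nat) : area_seq x y n = area_part n%:Z n.*2 x y.
Proof.
elim: n => [|n IH]; first by rewrite /area_seq /series/= big_geq// /area_part big_ord0.
rewrite /area_seq seriesSr -/(area_seq x y n) IH /area_part doubleS.
rewrite big_ord_recl big_ord_recr/= subr0.
rewrite addrCA -addn1 PoszD; congr (_ + _).
congr (_ + _); last by congr (area_term _ x y); rewrite /bump/=; lia.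
by apply: eq_bigr => j _; congr (area_term _ x y); rewrite /bump/=; lia.
Qed.

Lemma area_partD p (n k : nat) x y :
  area_part p (n + k) x y = area_part p n x y + area_part (p - n%:Z) k x y.
Proof.
rewrite /area_part big_split_ord/=; congr (_ + _).
by apply: eq_bigr => j _; congr (area_term _ x y); rewrite PoszD opprD addrA.
Qed.

(** With [tric p x] in place of [tric q x] the increments of [y] telescope. Each scale adds an error
    of at most 4 * 3 ^ p * 3 ^ (q - 1), which is exactly the growth of the right-hand side. *)
Lemma area_part_cell p (n : nat) x y x' y' :
  tri p x = tri p x' -> tri p y = tri p y' ->
  `|area_part p n x y - area_part p n x' y'
    - tric p x * (tric (p - n%:Z) y - tric (p - n%:Z) y')|
  <= 2 * pow3 p * (pow3 p - pow3 (p - n%:Z)).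
Proof.
move=> xx yy; elim: n => [|n IH].
  by rewrite /area_part !big_ord0 !subr0 (tri_eq_tric yy) !subrr mulr0 subrr normr0 mulr0.
rewrite /area_part !big_ord_recr/= -!/(area_part _ _ _ _) /area_term.
set q := p - n%:Z in IH *.
have -> : p - n.+1%:Z = q - 1 by rewrite /q -addn1 PoszD opprD addrA.
have qp : pow3 q <= pow3 p by apply: ler_pow3; rewrite /q; lia.
have cx : `|tric q x - tric p x| <= pow3 p.
  have := tric_close q x; have := tric_close p x; have := pow3_gt0 q.
  by rewrite !ler_norml => ? /andP[? ?] /andP[? ?]; apply/andP; split; lra.
have cx' : `|tric q x' - tric p x| <= pow3 p.
  rewrite (tri_eq_tric xx).
  have := tric_close q x'; have := tric_close p x'; have := pow3_gt0 q.
  by rewrite !ler_norml => ? /andP[? ?] /andP[? ?]; apply/andP; split; lra.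
have dy z : `|tric (q - 1) z - tric q z| <= 2 * pow3 (q - 1).
  by have := tric_step (q - 1) z; rewrite subrK.
have q3 := pow3P q.
move: IH; set S := area_part p n x y; set S' := area_part p n x' y' => IH.
have -> : S + tric q x * (tric (q - 1) y - tric q y) -
    (S' + tric q x' * (tric (q - 1) y' - tric q y')) -
    tric p x * (tric (q - 1) y - tric (q - 1) y') =
  (S - S' - tric p x * (tric q y - tric q y')) +
  ((tric q x - tric p x) * (tric (q - 1) y - tric q y) -
  (tric q x' - tric p x) * (tric (q - 1) y' - tric q y')) by ring.
apply: le_trans (ler_normD _ _) _.
apply: le_trans (lerD IH (ler_normB _ _)) _; rewrite !normrM.
have h1 := ler_pM (normr_ge0 _) (normr_ge0 _) cx (dy y).
have h2 := ler_pM (normr_ge0 _) (normr_ge0 _) cx' (dy y').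
by nra.
Qed.

(** The scales are at least [p + 1], and a term at scale [i] only looks at the scales [i] and
    [i - 1]. *)
Lemma area_part_coarse p (n : nat) x y x' y' : tri p x = tri p x' ->
  tri p y = tri p y' -> area_part (p + n%:Z) n x y = area_part (p + n%:Z) n x' y'.
Proof.
move=> xx yy; apply: eq_bigr => j _; rewrite /area_term.
have h z z' : tri p z = tri p z' -> tri (p + n%:Z - j%:Z - 1) z = tri (p + n%:Z - j%:Z - 1) z'.
  by apply: tri_coarse; have := ltn_ord j; lia.
have h' z z' : tri p z = tri p z' -> tri (p + n%:Z - j%:Z) z = tri (p + n%:Z - j%:Z) z'.
  by apply: tri_coarse; have := ltn_ord j; lia.
by rewrite (tri_eq_tric (h' _ _ xx)) (tri_eq_tric (h' _ _ yy)) (tri_eq_tric (h _ _ yy)).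
Qed.

(** The fine term decays with the increment of [y]. The coarse one vanishes unless 3 ^ (j + 1) <= 2
    |x|; then 9 ^ j <= |x| ^ 2, which turns its growth into decay. *)
Lemma area_term_le (j : nat) x y :
  `|area_term (j%:Z + 1) x y + area_term (- j%:Z) x y|
  <= (2 * (`|x| + 1) + 8 * `|x| ^+ 3) * 3^-1 ^+ j.
Proof.
have ej : 3^-1 ^+ j = pow3 (- j%:Z) by rewrite pow3N pow3_nat exprVn.
rewrite ej mulrDl; set e := pow3 (- j%:Z).
have e0 : 0 < e by exact: pow3_gt0.
have e1 : e <= 1 by rewrite -pow30; apply: ler_pow3; lia.
have x0 := normr_ge0 x.
apply: le_trans (ler_normD _ _) _; rewrite addrC; apply: lerD; rewrite /area_term normrM.
  have h1 := tric_le (- j%:Z) x.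
  have := tric_step (- j%:Z - 1) y; rewrite subrK => h2.
  apply: le_trans (ler_pM (normr_ge0 _) (normr_ge0 _) h1 h2) _.
  have := pow3P (- j%:Z); rewrite -/e => h3.
  have := pow3_gt0 (- j%:Z - 1); nra.
have [->|c0] := eqVneq (tric (j%:Z + 1) x) 0.
  by rewrite normr0 mul0r mulr_ge0 ?mulr_ge0 ?exprn_ge0// ltW.
have h0 := tric_neq0 c0; have h1 := tric_le (j%:Z + 1) x.
rewrite addrK; have h2' := tric_step j%:Z y.
have he : pow3 j%:Z * e = 1 by rewrite /e pow3N divff// gt_eqF.
move: h0 h1; rewrite pow3S => h0 h1.
apply: le_trans (ler_pM (normr_ge0 _) (normr_ge0 _) h1 h2') _.
have P0 := pow3_gt0 j%:Z; set P := pow3 j%:Z in P0 he h0 *.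
set X := `|x| in x0 h0 *.
apply: (@le_trans _ _ (6 * X * P * (P * e))); first by rewrite he mulr1; nra.
have -> : 6 * X * P * (P * e) = 6 * X * (P * P) * e by ring.
rewrite ler_pM2r//.
have PX : P <= X by lra.
have := ler_pM (ltW P0) (ltW P0) PX PX => PP.
have := ler_wpM2l x0 PP; have : 0 <= X * (X * X) by rewrite !mulr_ge0.
by rewrite !exprS expr0; lra.
Qed.

Lemma area_cvg x y : area_seq x y n @[n --> \oo] --> area x y.
Proof.
apply: normed_cvg.
apply: (@series_le_cvg _ _
  (geometric (2 * (`|x| + 1) + 8 * `|x| ^+ 3) (3^-1))).
- by move=> n; exact: normr_ge0.
- by move=> n; rewrite mulr_ge0// ?exprn_ge0// ?invr_ge0// addr_ge0// mulr_ge0// ?addr_ge0//.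
- by move=> n; exact: area_term_le.
- by apply: is_cvg_geometric_series; rewrite normfV ger0_norm// invf_lt1// ltr1n.
Qed.

Lemma measurable_area d (T : measurableType d) (f g : T -> R) :
  measurable_fun setT f -> measurable_fun setT g ->
  measurable_fun setT (fun t => area (f t) (g t)).
Proof.
move=> mf mg.
apply: (@measurable_fun_cvg _ _ _ _ (fun (k : nat) t => area_seq (f t) (g t) k)).
  move=> n; rewrite /area_seq /series/=; apply: measurable_sum => j.
  by apply: measurable_funD; apply: measurable_funM; try apply: measurable_funB;
    exact: measurable_tric.
by move=> t _; exact: area_cvg.
Qed.

(** The scales above [p] cancel, those below are [area_part_cell] in the limit, and replacing
    [tric p x] by [x'] costs at most half of 9 ^ p. *)
Lemma area_cell p x y x' y' : tri p x = tri p x' -> tri p y = tri p y' ->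
  `|area x y - area x' y' - x' * (y - y')| <= 4 * pow3 p ^+ 2.
Proof.
move=> xx yy; have p0 := pow3_gt0 p.
suff H : `|area x y - area x' y' - tric p x * (y - y')| <= 2 * pow3 p ^+ 2.
  have -> : area x y - area x' y' - x' * (y - y') =
    (area x y - area x' y' - tric p x * (y - y')) - (x' - tric p x) * (y - y') by ring.
  apply: le_trans (ler_normB _ _) _; rewrite normrM.
  have h1 := tric_close p x'; rewrite -(tri_eq_tric xx) in h1.
  have := ler_pM (normr_ge0 _) (normr_ge0 _) h1 (tri_eq_close yy).
  by move: H; rewrite !expr2; nra.
pose a n : R := `|area_seq x y n - area_seq x' y' n - tric p x * (y - y')|.
pose b n : R := 2 * pow3 p ^+ 2 + `|tric p x| * 3^-1 ^+ n.
apply: (@ler_cvg_to _ (\oo)%classic _ _ a b).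
- apply: cvg_norm; apply: cvgB; last exact: cvg_cst.
  by apply: cvgB; exact: area_cvg.
- rewrite -[X in _ --> X]addr0; apply: cvgD; first exact: cvg_cst.
  rewrite -(mulr0 `|tric p x|); apply: cvgMr.
  by apply: cvg_expr; rewrite normfV ger0_norm// invf_lt1// ltr1n.
(* The 2n scales split into the k = n - p coarse ones above [p] and the l = n + p fine ones, ending
   at p - l = - n. *)
exists `|p|%N => // n /= pn; rewrite /a /b !area_seqE.
have [k nk] : exists k : nat, n%:Z = p + k%:Z by exists `|n%:Z - p|%N; lia.
have [l kl] : exists l : nat, n.*2 = (k + l)%N by exists (n.*2 - k)%N; lia.
rewrite kl !area_partD nk (area_part_coarse _ xx yy) addrK.
set u := area_part (p + k%:Z) k x' y'.
have lE : p - l%:Z = - n%:Z by lia.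
have := area_part_cell l xx yy; rewrite lE.
have en : 3^-1 ^+ n = pow3 (- n%:Z) by rewrite pow3N pow3_nat exprVn.
rewrite en; set e := pow3 (- n%:Z); have e0 : 0 < e := pow3_gt0 _.
set v := area_part p l x y; set v' := area_part p l x' y' => H.
have -> : u + v - (u + v') - tric p x * (y - y') =
  (v - v' - tric p x * (tric (- n%:Z) y - tric (- n%:Z) y')) -
  tric p x * ((y - tric (- n%:Z) y) - (y' - tric (- n%:Z) y')) by ring.
apply: le_trans (ler_normB _ _) _; apply: lerD.
  apply: le_trans H _; rewrite expr2; nra.
rewrite normrM ler_wpM2l//.
apply: le_trans (ler_normB _ _) _.
have := tric_close (- n%:Z) y; have := tric_close (- n%:Z) y'; rewrite -/e; lra.
Qed.

End triadic.

(** * Lengths of curves in a Damek-Ricci space *)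

Section calculus.
Variable R : realType.

Lemma eq_ler (x y : R) : x = y -> x <= y. Proof. by move=> ->. Qed.

Lemma is_derive_linear_comp (V : normedModType R) (L : V -> R) (g : R -> V) t :
  scalar L -> continuous L -> derivable g t 1 ->
  is_derive t 1 (L \o g) (L (derive1 g t)).
Proof.
move=> lL cL dg; rewrite derive1E.
have L0 : L 0 = 0 by have := lL (-1) 0 0; rewrite scaler0 addr0 mulN1r addNr.
have LZ a x : L (a *: x) = a * L x by rewrite -[a *: x]addr0 lL L0 addr0.
have LB x y : L (x - y) = L x - L y by rewrite addrC -scaleN1r lL mulN1r addrC.
have H : (fun h => h^-1 *: ((L \o g \o shift t) (h *: 1) - (L \o g) t)) @ 0^'
    --> L ('D_1 g t).
  rewrite (_ : (fun _ => _) = L \o (fun h => h^-1 *: ((g \o shift t) (h *: 1) - g t))).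
    by apply: continuous_cvg; [exact: cL|exact: dg].
  by apply/funext => h; rewrite /= LZ LB.
apply: DeriveDef; first by apply/cvg_ex; exists (L ('D_1 g t)); exact: H.
exact: (cvg_lim (@Rhausdorff R) H).
Qed.

Lemma is_derive_pair (V W : normedModType R) (f : R -> V) (g : R -> W) (t : R) df dg :
  is_derive t 1 f df -> is_derive t 1 g dg -> is_derive t 1 (fun s => (f s, g s)) (df, dg).
Proof.
move=> hf hg.
have H : (fun h => h^-1 *: (((fun s => (f s, g s)) \o shift t) (h *: 1) - (f t, g t)))
    @ 0^' --> (df, dg).
  rewrite (_ : (fun _ => _) = fun h => (h^-1 *: ((f \o shift t) (h *: 1) - f t),
    h^-1 *: ((g \o shift t) (h *: 1) - g t))); last by apply/funext.
  rewrite -(@derive_val _ _ _ _ _ _ _ hf) -(@derive_val _ _ _ _ _ _ _ hg).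
  by apply: cvg_pair; [case: hf|case: hg].
apply: DeriveDef; first by apply/cvg_ex; exists (df, dg).
exact: (cvg_lim (@norm_hausdorff _ _) H).
Qed.

(** By the mean value theorem applied to [f + g] and [g - f], whose derivatives are nonnegative. *)
Lemma derive_dominated (f g df dg : R -> R) (t : R) : 0 <= t ->
  (forall s : R, 0 <= s <= t -> is_derive s 1 f (df s)) ->
  (forall s : R, 0 <= s <= t -> is_derive s 1 g (dg s)) ->
  (forall s : R, 0 <= s <= t -> `|df s| <= dg s) ->
  `|f t - f 0| <= g t - g 0.
Proof.
move=> t0 hf hg h.
have cont (u du : R -> R) : (forall s : R, 0 <= s <= t -> is_derive s 1 u (du s)) ->
    {within `[0, t], continuous u}.
  move=> hu; apply: derivable_within_continuous => s; rewrite in_itv/= => st.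
  exact: @ex_derive _ _ _ _ _ _ _ (hu s st).
have oc (s : R) : s \in `]0, t[%R -> 0 <= s <= t.
  by rewrite in_itv/= => /andP[/ltW-> /ltW->].
have hD (s : R) : 0 <= s <= t -> is_derive s 1 (f + g) (df s + dg s).
  by move=> st; exact: is_deriveD (hf s st) (hg s st).
have hB (s : R) : 0 <= s <= t -> is_derive s 1 (g - f) (dg s - df s).
  by move=> st; exact: is_deriveB (hg s st) (hf s st).
have [c1 c1t E1] := MVT_segment t0 (fun s st => hD s (oc s st)) (cont _ _ hD).
have [c2 c2t E2] := MVT_segment t0 (fun s st => hB s (oc s st)) (cont _ _ hB).
move: c1t c2t; rewrite !in_itv/= => c1t c2t.
have := h _ c1t; have := h _ c2t; rewrite !ler_norml => /andP[a1 a2] /andP[a3 a4].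
have P1 : 0 <= (df c1 + dg c1) * (t - 0) by rewrite mulr_ge0 ?subr0//; lra.
have P2 : 0 <= (dg c2 - df c2) * (t - 0) by rewrite mulr_ge0 ?subr0//; lra.
move: E1 E2; rewrite !fctE => E1 E2; apply/andP; split; lra.
Qed.

Lemma is_derive_primitive (v : R -> R) : continuous v -> exists V : R -> R,
  [/\ V 0 = 0, V 1 = \int[@lebesgue_measure R]_(t in `[0, 1]) v t &
      forall s : R, 0 <= s <= 1 -> is_derive s 1 V (v s)].
Proof.
(* Integrating over a larger interval gives two-sided derivatives at 0 and 1 as well. *)
move=> cv; pose P s := \int[@lebesgue_measure R]_(t in `[-1, s]) v t.
have iv : (@lebesgue_measure R).-integrable `[-1, 2] (EFin \o v).
  apply: continuous_compact_integrable; first exact: segment_compact.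
  exact: continuous_subspaceT.
exists (fun s => P s - P 0); split.
- by rewrite subrr.
- rewrite /P Rintegral_itvB ?bnd_simp//; last first.
    by apply: (integrableS _ _ _ iv) => //; apply: subset_itvl; rewrite bnd_simp; lra.
  rewrite Rintegral_itv_obnd_cbnd//; apply: (integrableS _ _ _ iv) => //.
  by apply: subset_itv; rewrite bnd_simp; lra.
move=> s /andP[s0 s1].
have s2 : s < 2 by lra.
have s1' : -1 < s by lra.
have [dP P'] := @continuous_FTC1_closed R v (-1) s 2 s2 iv s1' (cv s).
rewrite -[v s]subr0; apply: is_deriveB.
by apply: DeriveDef; [exact: dP|rewrite -derive1E; exact: P'].
Qed.

End calculus.

Section bracket_coefficients.
Variables (R : realType) (n : euclideanLieAlgebra R) (m k : nat).
Variable F : orthonormal_frame n m k.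
Local Notation br := (frame_bracket F).

Definition bracket_coef (l : 'I_k) (a b : 'I_m) : R :=
  br (delta_mx 0 a) (delta_mx 0 b) ord0 l.

Lemma frame_bracketDl x x' y : br (x + x') y = br x y + br x' y.
Proof. by rewrite -[x]scale1r frame_bracket_linearl !scale1r. Qed.

Lemma frame_bracketDr x y y' : br x (y + y') = br x y + br x y'.
Proof. by rewrite -[y]scale1r frame_bracket_linearr !scale1r. Qed.

Lemma frame_bracketNl x y : br (- x) y = - br x y.
Proof. by rewrite -scaleN1r frame_bracketZl scaleN1r. Qed.

Lemma frame_bracketNr x y : br x (- y) = - br x y.
Proof. by rewrite -scaleN1r frame_bracketZr scaleN1r. Qed.

Lemma frame_bracketC x y : br y x = - br x y.
Proof.
have := frame_bracketxx F (x + y).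
rewrite frame_bracketDl !frame_bracketDr !frame_bracketxx add0r addr0 => /eqP.
by rewrite addr_eq0 => /eqP ->; rewrite opprK.
Qed.

Lemma frame_bracketE x y l :
  br x y ord0 l = \sum_a \sum_b x ord0 a * y ord0 b * bracket_coef l a b.
Proof.
rewrite {1}(row_sum_delta x) (big_morph (br ^~ y) (fun u v => frame_bracketDl u v y)
  (frame_bracket0l F y)) summxE; apply: eq_bigr => a _.
rewrite frame_bracketZl [LHS]mxE {1}(row_sum_delta y).
rewrite (big_morph (br (delta_mx 0 a)) (frame_bracketDr _) (frame_bracket0r F _)).
rewrite summxE mulr_sumr; apply: eq_bigr => b _.
by rewrite frame_bracketZr [in LHS]mxE mulrA.
Qed.

Definition bracket_bound : R := \sum_l \sum_a \sum_b `|bracket_coef l a b|.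

Lemma bracket_bound_ge0 : 0 <= bracket_bound.
Proof. by do 3! apply: sumr_ge0 => ? _. Qed.

Lemma ler_frame_bracket (x y : 'rV[R]_m) (s t : R) l : 0 <= s -> 0 <= t ->
  (forall a, `|x ord0 a| <= s) ->
  (forall b, `|y ord0 b| <= t) -> `|br x y ord0 l| <= bracket_bound * (s * t).
Proof.
move=> s0 t0 xs yt; rewrite frame_bracketE.
apply: (@le_trans _ _ ((\sum_a \sum_b `|bracket_coef l a b|) * (s * t))).
  rewrite mulr_suml; apply: le_trans (ler_norm_sum _ _ _) _; apply: ler_sum => a _.
  rewrite mulr_suml; apply: le_trans (ler_norm_sum _ _ _) _; apply: ler_sum => b _.
  by rewrite mulrC !normrM ler_wpM2l// ler_pM.
rewrite ler_wpM2r ?mulr_ge0// /bracket_bound (bigD1 l)//= lerDl.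
by do 3! apply: sumr_ge0 => ? _.
Qed.

Lemma continuous_bigD (T : topologicalType) (I : Type) (r : seq I) (P : pred I)
    (f : I -> T -> R) : (forall i, P i -> continuous (f i)) ->
  continuous (fun x => \sum_(i <- r | P i) f i x).
Proof.
by apply: continuous_big => x; exact: add_continuous.
Qed.

Lemma continuous_frame_bracket x l : continuous (fun y => br x y ord0 l).
Proof.
under eq_fun do rewrite frame_bracketE.
apply: (@continuous_bigD 'rV[R]_m _ _ _ (fun a y => \sum_b _)) => a _.
apply: (@continuous_bigD 'rV[R]_m _ _ _
  (fun b y => x ord0 a * y ord0 b * bracket_coef l a b)) => b _ y.
under eq_fun do rewrite mulrAC.
apply: (@continuous_comp _ _ _ (fun y : 'rV[R]_m => y ord0 b)
  (fun z => x ord0 a * bracket_coef l a b * z)).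
  exact: coord_continuous.
exact: mulrl_continuous.
Qed.

End bracket_coefficients.

Section speed.
Variables (R : realType) (n : euclideanLieAlgebra R) (m k : nat).
Variable F : orthonormal_frame n m k.
Local Notation br := (frame_bracket F).
Local Notation DRc := (@DRcoord R n m k F).
Local Notation V := ('rV[R]_m * 'rV[R]_k * R)%type.

(* The tangent vector [w] at [y], translated to the identity. *)
Definition DRlocal (y : DRspace F) (w : V) : V :=
  let a := posval y.2 in
  ((Num.sqrt a)^-1 *: w.1.1, a^-1 *: (w.1.2 - 2^-1 *: br y.1.1 w.1.1), a^-1 * w.2).

Lemma DRlocal_zE y w j : (DRlocal y w).1.2 ord0 j =
  (posval y.2)^-1 * (w.1.2 ord0 j - 2^-1 * br y.1.1 w.1.1 ord0 j).
Proof. by rewrite /DRlocal /=; move: (br _ _) => u; rewrite !mxE. Qed.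

Lemma DRcoord_mulVg (y p : DRspace F) (a := posval y.2) : DRc (y^-1 * p)%g =
  ((Num.sqrt a)^-1 *: (p.1.1 - y.1.1),
   a^-1 *: (p.1.2 - y.1.2 - 2^-1 *: br y.1.1 p.1.1), a^-1 * posval p.2).
Proof.
rewrite /a; case: y p {a} => [[X Z] a] [[X' Z'] b].
have a0 := posval_gt0 a.
rewrite /DRcoord /= sqrtrV ?ltW//; congr (_, _, _).
- by rewrite addrC scaleNr -scalerBr.
- rewrite !scaleNr frame_bracketNl frame_bracketZl -[in RHS](sqr_sqrtr (ltW a0)).
  rewrite -(sqr_sqrtr (ltW a0)); set s := Num.sqrt _; set u := br X X'.
  rewrite sqrtr_sqr ger0_norm ?sqrtr_ge0//.
  apply/rowP => j; rewrite !mxE expr2 invfM; ring.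
Qed.

Lemma continuous_tanx i : continuous (fun v : V => v.1.1 ord0 i).
Proof.
move=> v; apply: (@continuous_comp _ _ _ (fun v : V => v.1.1) (fun x : 'rV[R]_m => x ord0 i)).
  by apply: continuous_comp; [exact: cvg_fst|exact: cvg_fst].
exact: coord_continuous.
Qed.

Lemma continuous_tanz j : continuous (fun v : V => v.1.2 ord0 j).
Proof.
move=> v; apply: (@continuous_comp _ _ _ (fun v : V => v.1.2) (fun x : 'rV[R]_k => x ord0 j)).
  by apply: continuous_comp; [exact: cvg_fst|exact: cvg_snd].
exact: coord_continuous.
Qed.

Lemma continuous_tana : continuous (fun v : V => v.2).
Proof. by move=> v; exact: cvg_snd. Qed.

Lemma continuous_tanbracket x j : continuous (fun v : V => br x v.1.1 ord0 j).
Proof.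
move=> v; apply: (@continuous_comp _ _ _ (fun v : V => v.1.1) (fun y => br x y ord0 j)).
  by apply: continuous_comp; [exact: cvg_fst|exact: cvg_fst].
exact: continuous_frame_bracket.
Qed.

Variables (gam : R -> DRspace F) (t : R).
Hypothesis dg : derivable (DRc \o gam) t 1.
Let dgam := derive1 (DRc \o gam) t.

Lemma is_derive_DRx i : is_derive t 1 (fun s => (gam s).1.1 ord0 i) (dgam.1.1 ord0 i).
Proof.
have lL : scalar (fun v : V => v.1.1 ord0 i) by move=> a u v; rewrite !mxE.
exact: (is_derive_linear_comp lL (@continuous_tanx i) dg).
Qed.

Lemma is_derive_DRz j : is_derive t 1 (fun s => (gam s).1.2 ord0 j) (dgam.1.2 ord0 j).
Proof.
have lL : scalar (fun v : V => v.1.2 ord0 j) by move=> a u v; rewrite !mxE.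
exact: (is_derive_linear_comp lL (@continuous_tanz j) dg).
Qed.

Lemma is_derive_DRa : is_derive t 1 (fun s => posval (gam s).2) dgam.2.
Proof.
have lL : scalar (fun v : V => v.2) by [].
exact: (is_derive_linear_comp lL continuous_tana dg).
Qed.

Lemma is_derive_DRbracket x j :
  is_derive t 1 (fun s => br x (gam s).1.1 ord0 j) (br x dgam.1.1 ord0 j).
Proof.
have lL : scalar (fun v : V => br x v.1.1 ord0 j).
  by move=> a u v; rewrite /= frame_bracket_linearr [LHS]mxE [in LHS]mxE.
exact: (is_derive_linear_comp lL (@continuous_tanbracket x j) dg).
Qed.

(** By [DRcoord_mulVg] left translation by a fixed element is affine in the coordinates, and
    [DRlocal] is its linear part. *)
Lemma DRspeedE : DRspeed gam t = DRnorm (DRlocal (gam t) dgam).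
Proof.
rewrite /DRspeed; congr DRnorm; set y := gam t; set a := posval y.2.
have a0 : 0 < a by exact: posval_gt0.
pose G s : V := DRc (y^-1 * gam s)%g.
have hX i : is_derive t 1 (fun s => (G s).1.1 ord0 i) ((DRlocal y dgam).1.1 ord0 i).
  rewrite (_ : (fun s => _) = (fun s => (- ((Num.sqrt a)^-1 *: y.1.1)) ord0 i +
      (Num.sqrt a)^-1 * (gam s).1.1 ord0 i)); last first.
    by apply/funext => s; rewrite /G DRcoord_mulVg !mxE mulrBr addrC.
  have -> : (DRlocal y dgam).1.1 ord0 i = 0 + (Num.sqrt a)^-1 *: dgam.1.1 ord0 i.
    by rewrite add0r !mxE.
  by apply: is_deriveD; apply: is_deriveZ; exact: is_derive_DRx.
have hZ j : is_derive t 1 (fun s => (G s).1.2 ord0 j) ((DRlocal y dgam).1.2 ord0 j).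
  rewrite (_ : (fun s => _) = (fun s => (- (a^-1 *: y.1.2)) ord0 j +
      (a^-1 * (gam s).1.2 ord0 j - a^-1 * 2^-1 * br y.1.1 (gam s).1.1 ord0 j))); last first.
    by apply/funext => s; rewrite /G DRcoord_mulVg; rewrite ![in LHS]mxE -/a !mxE; ring.
  have -> : (DRlocal y dgam).1.2 ord0 j = 0 + (a^-1 *: dgam.1.2 ord0 j -
     (a^-1 * 2^-1) *: br y.1.1 dgam.1.1 ord0 j).
    by rewrite add0r [LHS]mxE [in LHS]mxE [X in _ + X]mxE [in X in _ - X]mxE mulrBr mulrA.
  apply: is_deriveD; apply: is_deriveB; apply: is_deriveZ; first exact: is_derive_DRz.
  exact: is_derive_DRbracket.
have hA : is_derive t 1 (fun s => (G s).2) (DRlocal y dgam).2.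
  rewrite (_ : (fun s => _) = (fun s => a^-1 * posval (gam s).2)); last first.
    by apply/funext => s; rewrite /G DRcoord_mulVg.
  by apply: is_deriveZ; exact: is_derive_DRa.
have dG : derivable G t 1.
  rewrite (_ : G = fun s => (((G s).1.1, (G s).1.2), (G s).2)); last first.
    by apply/funext => s; case: (G s) => [[]].
  have dX : derivable (fun s => (G s).1.1) t 1.
    apply/derivable_mxP => i j; rewrite ord1.
    exact: @ex_derive _ _ _ _ _ _ _ (hX j).
  have dZ : derivable (fun s => (G s).1.2) t 1.
    apply/derivable_mxP => i j; rewrite ord1.
    exact: @ex_derive _ _ _ _ _ _ _ (hZ j).
  have := is_derive_pair (is_derive_pair (derivableP dX) (derivableP dZ)) hA.
  by move=> /@ex_derive.
have lX i : scalar (fun v : V => v.1.1 ord0 i) by move=> b u v; rewrite !mxE.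
have lZ i : scalar (fun v : V => v.1.2 ord0 i) by move=> b u v; rewrite !mxE.
have lA : scalar (fun v : V => v.2) by [].
rewrite -/G [LHS]surjective_pairing [(_).1 in LHS]surjective_pairing.
rewrite [RHS]surjective_pairing [(_).1 in RHS]surjective_pairing.
congr (_, _, _).
- apply/rowP => i; rewrite -(@derive_val _ _ _ _ _ _ _ (hX i)).
  exact: (esym (@derive_val _ _ _ _ _ _ _ (is_derive_linear_comp (lX i) (@continuous_tanx i) dG))).
- apply/rowP => i; rewrite -(@derive_val _ _ _ _ _ _ _ (hZ i)).
  exact: (esym (@derive_val _ _ _ _ _ _ _ (is_derive_linear_comp (lZ i) (@continuous_tanz i) dG))).
- rewrite -(@derive_val _ _ _ _ _ _ _ hA).
  exact: (esym (@derive_val _ _ _ _ _ _ _ (is_derive_linear_comp lA continuous_tana dG))).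
Qed.

End speed.

(** * Where a path of given length can end *)

Section lower_bound.
Variables (R : realType) (n : euclideanLieAlgebra R) (m k : nat).
Variable F : orthonormal_frame n m k.
Local Notation br := (frame_bracket F).
Local Notation DRc := (@DRcoord R n m k F).
Local Notation B := (bracket_bound F).

Lemma ler_DRnorm_x (w : 'rV[R]_m * 'rV[R]_k * R) i : `|w.1.1 ord0 i| <= DRnorm w.
Proof.
rewrite -sqrtr_sqr ler_wsqrtr// (bigD1 i)//= -!addrA lerDl.
by rewrite !addr_ge0 ?sqr_ge0// sumr_ge0// => *; exact: sqr_ge0.
Qed.

Lemma ler_DRnorm_z (w : 'rV[R]_m * 'rV[R]_k * R) j : `|w.1.2 ord0 j| <= DRnorm w.
Proof.
rewrite -sqrtr_sqr ler_wsqrtr// (bigD1 j)//= addrCA -!addrA lerDl.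
by rewrite !addr_ge0 ?sqr_ge0// sumr_ge0// => *; exact: sqr_ge0.
Qed.

Lemma ler_DRnorm_a (w : 'rV[R]_m * 'rV[R]_k * R) : `|w.2| <= DRnorm w.
Proof.
rewrite -sqrtr_sqr ler_wsqrtr// lerDr.
by rewrite !addr_ge0 ?sqr_ge0// sumr_ge0// => *; exact: sqr_ge0.
Qed.

Lemma DRspeed_ge0 (gam : R -> DRspace F) t : 0 <= DRspeed gam t.
Proof. exact: sqrtr_ge0. Qed.

Lemma DRlength_ge0 (gam : R -> DRspace F) : 0 <= DRlength gam.
Proof. by apply: Rintegral_ge0 => t _; exact: DRspeed_ge0. Qed.

(* The bounds satisfied by the end point [y] of a path of length [l] from [x]; in
   this form they propagate along a concatenation of paths. *)
Definition DRnear (x y : DRspace F) (l : R) : Prop := [/\ 0 <= l,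
  `|ln (posval y.2) - ln (posval x.2)| <= l,
  forall i, `|y.1.1 ord0 i - x.1.1 ord0 i|
    <= 2 * Num.sqrt (posval x.2) * (expR (l / 2) - 1) &
  forall j, `|y.1.2 ord0 j - x.1.2 ord0 j - 2^-1 * br x.1.1 y.1.1 ord0 j|
    <= posval x.2 * (expR l - 1 + B * (expR (l / 2) - 1) ^+ 2)].

Section curve.
Variable gam : R -> DRspace F.
Hypothesis C1 : is_C1_curve gam.
Let a t := posval (gam t).2.
Let v := DRspeed gam.
Let D := derive1 (DRc \o gam).

Let a_gt0 t : 0 < a t. Proof. exact: posval_gt0. Qed.
Let dgam t : derivable (DRc \o gam) t 1. Proof. by case: C1. Qed.
Let cD : continuous D. Proof. by case: C1. Qed.

Let speed_x t i : `|(D t).1.1 ord0 i| <= Num.sqrt (a t) * v t.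
Proof.
rewrite /v DRspeedE//; have := ler_DRnorm_x (DRlocal (gam t) (D t)) i.
rewrite [(DRlocal _ _).1.1]/= mxE normrM ger0_norm ?invr_ge0 ?sqrtr_ge0//.
by rewrite ler_pdivrMl ?sqrtr_gt0 ?posval_gt0.
Qed.

Let speed_z t j :
  `|(D t).1.2 ord0 j - 2^-1 * br (gam t).1.1 (D t).1.1 ord0 j| <= a t * v t.
Proof.
rewrite /v DRspeedE//; have := ler_DRnorm_z (DRlocal (gam t) (D t)) j.
rewrite DRlocal_zE normrM ger0_norm; last by rewrite invr_ge0 ltW// posval_gt0.
by rewrite ler_pdivrMl// posval_gt0.
Qed.

Let speed_a t : `|(a t)^-1 * (D t).2| <= v t.
Proof.
by rewrite /v DRspeedE//; exact: (ler_DRnorm_a (DRlocal (gam t) (D t))).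
Qed.

Let cont_of_derive (f df : R -> R) : (forall t : R, is_derive t 1 f (df t)) -> continuous f.
Proof.
move=> h t; apply/differentiable_continuous/derivable1_diffP.
exact: @ex_derive _ _ _ _ _ _ _ (h t).
Qed.

Let cv : continuous v.
Proof.
rewrite (_ : v = fun t => DRnorm (DRlocal (gam t) (D t))); last first.
  by apply/funext => t; exact: DRspeedE.
have ca : continuous a by apply: cont_of_derive => t; exact: is_derive_DRa.
have cx i : continuous (fun t => (gam t).1.1 ord0 i).
  by apply: cont_of_derive => t; exact: is_derive_DRx.
have cDx i : continuous (fun t => (D t).1.1 ord0 i).
  move=> t; apply: (@continuous_comp _ _ _ D (fun w => w.1.1 ord0 i)); first exact: cD.
  exact: continuous_tanx.
have cDz j : continuous (fun t => (D t).1.2 ord0 j).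
  move=> t; apply: (@continuous_comp _ _ _ D (fun w => w.1.2 ord0 j)); first exact: cD.
  exact: continuous_tanz.
have cDa : continuous (fun t => (D t).2).
  by move=> t; apply: (@continuous_comp _ _ _ D (fun w => w.2)); [exact: cD|exact: continuous_tana].
have cM (f g : R -> R) : continuous f -> continuous g -> continuous (fun t => f t * g t).
  by move=> cf cg t; apply: cvgM; [exact: cf|exact: cg].
have cV (f : R -> R) : (forall t, f t != 0) -> continuous f -> continuous (fun t => (f t)^-1).
  by move=> f0 cf t; apply: cvgV => //; exact: cf.
have cS (f : R -> R) : continuous f -> continuous (fun t => Num.sqrt (f t)).
  move=> cf t; apply: (@continuous_comp _ _ _ f (@Num.sqrt R)); first exact: cf.
  exact: sqrt_continuous.
have cD2 (f g : R -> R) : continuous f -> continuous g -> continuous (fun t => f t + g t).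
  by move=> cf cg t; apply: cvgD; [exact: cf|exact: cg].
have cN (f : R -> R) : continuous f -> continuous (fun t => - f t).
  by move=> cf t; apply: cvgN; exact: cf.
have cC (c : R) : continuous (fun _ : R => c) by move=> t; exact: cvg_cst.
have cbr j : continuous (fun t => br (gam t).1.1 (D t).1.1 ord0 j).
  under eq_fun do rewrite frame_bracketE.
  apply: continuous_bigD => i _; apply: continuous_bigD => l _.
  by apply: (cM (fun t => (gam t).1.1 ord0 i * (D t).1.1 ord0 l)) => //; exact: cM.
have sq (f : R -> R) : continuous f -> continuous (fun t => f t ^+ 2).
  by move=> cf; under eq_fun do rewrite expr2; exact: cM.
rewrite /DRnorm; apply: (cS); apply: (cD2); first apply: (cD2).
- apply: continuous_bigD => i _; apply: (sq); rewrite /DRlocal/=.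
  under eq_fun do rewrite mxE.
  apply: (cM) => //; apply: (cV); last exact: cS.
  by move=> t; rewrite gt_eqF// sqrtr_gt0; exact: a_gt0.
- apply: continuous_bigD => j _; apply: (sq).
  under eq_fun do rewrite DRlocal_zE.
  apply: (cM); first by apply: (cV) => // t; exact: lt0r_neq0 (a_gt0 t).
  by apply: (cD2) => //; apply: (cN); exact: cM.
- apply: (sq); rewrite /DRlocal/=; apply: (cM) => //.
  by apply: (cV) => // t; exact: lt0r_neq0 (a_gt0 t).
Qed.

(** Let V be the arc length so far and E = exp ((l + V) / 2), so that E' = E v / 2 and the square
    root of the height is at most r E. Then |X'| <= r E v, the derivative of 2 r E. The derivative
    of Z - [x, X] / 2 is a term of size at most a v plus [X - x, X'] / 2; these are dominated by the
    derivatives of a0 E ^ 2 and of a0 B (E - 1) ^ 2. *)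
Lemma DRnear_arc (x : DRspace F) (l : R) :
  DRnear x (gam 0) l -> DRnear x (gam 1) (l + DRlength gam).
Proof.
move=> [l0 hA hX hZ]; have [V [V0 V1 dV]] := is_derive_primitive cv.
set a0 := posval x.2 in hA hX hZ *; set r := Num.sqrt a0 in hX *.
have a00 : 0 < a0 by exact: posval_gt0.
have r0 : 0 < r by rewrite sqrtr_gt0.
have rr : r * r = a0 by rewrite -expr2 sqr_sqrtr// ltW.
have v0 t : 0 <= v t by exact: DRspeed_ge0.
pose E s := expR ((l + V s) / 2).
have E0 : E 0 = expR (l / 2) by rewrite /E V0 addr0.
have E1 : E 1 = expR ((l + DRlength gam) / 2) by rewrite /E V1.
have EE s : E s * E s = expR (l + V s) by rewrite -expRD -splitr.
have EE0 : expR l = E 0 * E 0 by rewrite EE V0 addr0.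
have EE1 : expR (l + DRlength gam) = E 1 * E 1 by rewrite EE V1.
have Egt0 s : 0 < E s by exact: expR_gt0.
have dE (s : R) : 0 <= s <= 1 -> is_derive s 1 E (E s * (2^-1 * v s)).
  move=> s1; have dg : is_derive s 1 (fun s => (l + V s) / 2) (2^-1 * v s).
    rewrite (_ : (fun _ => _) = (fun s => 2^-1 * (l + V s))); last first.
      by apply/funext => ?; rewrite mulrC.
    have -> : 2^-1 * v s = 2^-1 *: (0 + v s) by rewrite add0r.
    by apply: is_deriveZ; apply: is_deriveD; exact: dV.
  exact: (@is_derive1_comp R expR (fun s => (l + V s) / 2)).
have sub (t s : R) : 0 <= t <= 1 -> 0 <= s <= t -> 0 <= s <= 1.
  by move=> /andP[_ t1] /andP[-> st]; exact: le_trans st t1.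
have Vge0 (t : R) : 0 <= t <= 1 -> 0 <= V t.
  move=> t1; have t0 : 0 <= t by case/andP: t1.
  have H := @derive_dominated R (cst 0) V (cst 0) v t t0.
  have {H} : `|(0 : R) - 0| <= V t - V 0; last by rewrite subrr normr0 V0 subr0.
  apply: H.
  - by move=> s /(sub _ _ t1)/dV.
  - by move=> s _; rewrite normr0.
have E1le (t : R) : 0 <= t <= 1 -> 1 <= E t.
  move=> t1; rewrite /E -expR0 ler_expR divr_ge0// addr_ge0//; exact: Vge0.
have hA' (t : R) : 0 <= t <= 1 -> `|ln (a t) - ln a0| <= l + V t.
  move=> t1; have t0 : 0 <= t by case/andP: t1.
  have := @derive_dominated R (fun s => ln (a s)) V (fun s => (a s)^-1 * (D s).2) v t t0.
  rewrite V0 subr0 => H.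
  have -> : ln (a t) - ln a0 = (ln (a t) - ln (a 0)) + (ln (a 0) - ln a0) by ring.
  apply: le_trans (ler_normD _ _) _; rewrite addrC; apply: lerD => //; apply: H.
  - move=> s st; apply: (@is_derive1_comp R (@ln R) a).
      exact: is_derive1_ln.
    exact: is_derive_DRa.
  - by move=> s /(sub _ _ t1)/dV.
  - by move=> s _; exact: speed_a.
have ha (t : R) : 0 <= t <= 1 -> Num.sqrt (a t) <= r * E t.
  move=> t1; have := hA' t t1; rewrite ler_norml => /andP[_ h].
  rewrite -[leRHS]ger0_norm ?mulr_ge0 ?(ltW r0) ?(ltW (Egt0 t))// -sqrtr_sqr.
  rewrite ler_wsqrtr// expr2 mulrACA rr EE -[a t]lnK ?posrE// -[X in X * _]lnK ?posrE//.
  by rewrite -expRD ler_expR; lra.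
have hD (t : R) i : 0 <= t <= 1 -> `|(D t).1.1 ord0 i| <= r * E t * v t.
  by move=> t1; apply: le_trans (speed_x t i) _; rewrite ler_wpM2r//; exact: ha.
have hX' (t : R) i : 0 <= t <= 1 ->
    `|(gam t).1.1 ord0 i - x.1.1 ord0 i| <= 2 * r * (E t - 1).
  move=> t1; have t0 : 0 <= t by case/andP: t1.
  have := @derive_dominated R (fun s => (gam s).1.1 ord0 i) (fun s => (2 * r) * E s)
    (fun s => (D s).1.1 ord0 i) (fun s => (2 * r) * (E s * (2^-1 * v s))) t t0.
  move=> H; have := hX i; rewrite -E0 => h0.
  have {}H : `|(gam t).1.1 ord0 i - (gam 0).1.1 ord0 i| <= 2 * r * E t - 2 * r * E 0.
    apply: H => s st; have s1 := sub _ _ t1 st.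
    - exact: is_derive_DRx.
    - by apply: is_deriveZ; exact: dE.
    - apply: le_trans (hD _ _ s1) _; rewrite le_eqVlt; apply/orP; left; apply/eqP.
      by field.
  move: H h0; rewrite !ler_norml => /andP[? ?] /andP[? ?].
  apply/andP; split; lra.
have i01 : 0 <= (1 : R) <= 1 by rewrite ler01 lexx.
have L0 := DRlength_ge0 gam.
split; first exact: addr_ge0.
- by have := hA' 1 i01; rewrite V1.
- by move=> i; rewrite -E1; exact: hX'.
move=> j.
pose f s := (gam s).1.2 ord0 j - 2^-1 * br x.1.1 (gam s).1.1 ord0 j.
pose g s := a0 * (E s * E s + B * ((E s - 1) * (E s - 1))).
have H : `|f 1 - f 0| <= g 1 - g 0.
  apply: (@derive_dominated R f g
    (fun s => (D s).1.2 ord0 j - 2^-1 * br x.1.1 (D s).1.1 ord0 j)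
    (fun s => a0 * (E s * (E s * v s) + B * ((E s - 1) * (E s * v s)))) 1 ler01) => s s1.
  - apply: is_deriveB; first exact: is_derive_DRz.
    by apply: is_deriveZ; exact: is_derive_DRbracket.
  - have dE1 : is_derive s 1 (fun s => E s - 1) (E s * (2^-1 * v s) - 0).
      by apply: is_deriveB; exact: dE.
    have dEE := is_deriveM (dE s s1) (dE s s1); have dE1E1 := is_deriveM dE1 dE1.
    have dg := is_deriveZ a0 (is_deriveD dEE (is_deriveZ B dE1E1)).
    apply: (is_derive_eq dg); by rewrite /GRing.scale/=; field.
  have -> : (D s).1.2 ord0 j - 2^-1 * br x.1.1 (D s).1.1 ord0 j =
    ((D s).1.2 ord0 j - 2^-1 * br (gam s).1.1 (D s).1.1 ord0 j) +
    2^-1 * br ((gam s).1.1 - x.1.1) (D s).1.1 ord0 j.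
    by rewrite frame_bracketDl frame_bracketNl [X in _ + _ * X]mxE [X in _ + _ * (_ + X)]mxE; ring.
  apply: le_trans (ler_normD _ _) _; rewrite mulrDr.
  have Es := E1le s s1; have vs := v0 s.
  apply: lerD.
    apply: le_trans (speed_z s j) _.
    have := ha s s1; rewrite mulrA => h.
    have h' := ler_pM (sqrtr_ge0 _) (sqrtr_ge0 _) h h.
    rewrite !mulrA ler_wpM2r//; apply: le_trans (le_trans _ h') _.
      by rewrite -expr2 sqr_sqrtr// ltW.
    by rewrite -rr; apply: eq_ler; ring.
  rewrite normrM ger0_norm ?invr_ge0// ler_pdivrMl//.
  have Hb := @ler_frame_bracket R n m k F ((gam s).1.1 - x.1.1) (D s).1.1
    (2 * r * (E s - 1)) (r * E s * v s) j.
  apply: le_trans (Hb _ _ _ _) _.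
  - by rewrite mulr_ge0 ?subr_ge0// mulr_ge0// ltW.
  - by rewrite mulr_ge0// mulr_ge0// ltW.
  - by move=> i; have := hX' s i s1; rewrite [X in _ -> `|X| <= _]mxE [X in _ -> `|_ + X| <= _]mxE.
  - by move=> i; exact: hD.
  - by rewrite -rr; apply: eq_ler; ring.
rewrite EE1 -E1; move: H (hZ j); rewrite /f /g EE0 -E0 expr2.
set u := (gam 1).1.2 _ _; set u' := 2^-1 * _; set w := (gam 0).1.2 _ _.
set w' := 2^-1 * _; rewrite !ler_norml => /andP[? ?] /andP[? ?].
by apply/andP; rewrite -/a0; split; rewrite expr2; lra.
Qed.

End curve.

Lemma DRjoined_near (x y : DRspace F) (l : R) : DRjoined x y l -> DRnear x y l.
Proof.
elim=> [|y' l' gam _ IH C1 g0]; last by apply: DRnear_arc => //; rewrite g0.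
split => //.
- by rewrite subrr normr0.
- by move=> i; rewrite subrr normr0 mul0r expR0 subrr mulr0.
- move=> j; rewrite frame_bracketxx subrr mxE mulr0 subr0 normr0 mul0r expR0 subrr.
  by rewrite expr2 !mulr0 addr0 mulr0.
Qed.

End lower_bound.

(** * Upper bounds for the distance by explicit paths *)

Section upper_bound.
Variables (R : realType) (n : euclideanLieAlgebra R) (m k : nat).
Variable F : orthonormal_frame n m k.
Local Notation br := (frame_bracket F).
Local Notation DRc := (@DRcoord R n m k F).

Definition posexp (u : R) : posreal R := PosNum (expR_gt0 u).

Lemma posval_exp u : posval (posexp u) = expR u. Proof. by []. Qed.

Lemma posexp_ln (a : posreal R) : posexp (ln (posval a)) = a.
Proof. by apply: posval_inj; rewrite ?posval_exp lnK// posrE posval_gt0. Qed.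

Section line.
Variables (X dX : 'rV[R]_m) (Z dZ : 'rV[R]_k) (u du : R).

Definition DRline (t : R) : DRspace F :=
  (X + t *: dX, Z + t *: dZ, posexp (u + t * du)).

Let D t : 'rV[R]_m * 'rV[R]_k * R := (dX, dZ, du * expR (u + t * du)).

Let line_affine (V : normedModType R) (v w : V) (t : R) :
  is_derive t 1 (fun s : R => v + s *: w) w.
Proof.
have H : (fun h => h^-1 *: (((fun s : R => v + s *: w) \o shift t) (h *: 1) - (v + t *: w)))
    @ 0^' --> w.
  apply: cvg_near_cst; near=> h.
  have h0 : h != 0 by near: h; exact: nbhs_dnbhs_neq.
  rewrite /= opprD addrACA subrr add0r -scalerBl addrK scalerA.
  by rewrite [h *: 1]mulr1 mulVf// scale1r.
apply: DeriveDef; first by apply/cvg_ex; exists w.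
exact: (cvg_lim (@norm_hausdorff _ _) H).
Unshelve. all: by end_near. Qed.

Let is_derive_exp (t : R) :
  is_derive t 1 (fun s : R => expR (u + s * du)) (du * expR (u + t * du)).
Proof.
have := @is_derive1_comp R expR (fun s => u + s *: du) t _ _ (is_derive_expR _)
  (line_affine u du t).
by rewrite mulrC.
Qed.

Let is_derive_DRline (t : R) : is_derive t 1 (DRc \o DRline) (D t).
Proof.
exact: (is_derive_pair (is_derive_pair (line_affine X dX t) (line_affine Z dZ t))
  (is_derive_exp t)).
Qed.

Let derive_DRline : derive1 (DRc \o DRline) = D.
Proof.
apply/funext => t; rewrite derive1E.
exact: @derive_val _ _ _ _ _ _ _ (is_derive_DRline t).
Qed.

Lemma DRline_C1 : is_C1_curve DRline.
Proof.
split=> [t|]; first exact: @ex_derive _ _ _ _ _ _ _ (is_derive_DRline t).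
rewrite derive_DRline => t.
have c1 : (fun=> (dX, dZ)) x @[x --> t] --> (dX, dZ) by exact: cvg_cst.
have ce : {for t, continuous (fun s : R => expR (u + s * du))}.
  apply/differentiable_continuous/derivable1_diffP.
  exact: @ex_derive _ _ _ _ _ _ _ (is_derive_exp t).
have c2 : (fun s => du * expR (u + s * du)) x @[x --> t] --> du * expR (u + t * du).
  exact: (continuous_comp ce (@mulrl_continuous R^o du _)).
exact: (cvg_pair c1 c2).
Qed.

Lemma DRline0 : DRline 0 = (X, Z, posexp u).
Proof. by rewrite /DRline !scale0r !addr0 mul0r addr0. Qed.

Lemma DRline1 : DRline 1 = (X + dX, Z + dZ, posexp (u + du)).
Proof. by rewrite /DRline !scale1r mul1r. Qed.

(** Since [X + t dX, dX] = [X, dX], the speed varies with the height only; it is constant in the two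
    cases used, vertical lines and lines of constant height. *)
Lemma DRspeed_line t : DRspeed DRline t = DRnorm
  ((expR (- (u + t * du) / 2)) *: dX,
   expR (- (u + t * du)) *: (dZ - 2^-1 *: br X dX), du).
Proof.
rewrite DRspeedE; last exact: @ex_derive _ _ _ _ _ _ _ (is_derive_DRline t).
rewrite derive_DRline; congr DRnorm.
have aE : posval (DRline t).2 = expR (u + t * du) by [].
rewrite /DRlocal aE; apply: congr2; last first.
  change ((expR (u + t * du))^-1 * (du * expR (u + t * du)) = du).
  by rewrite mulrCA mulVf ?mulr1// gt_eqF// expR_gt0.
apply: congr2; last first.
  change ((expR (u + t * du))^-1 *: (dZ - 2^-1 *: br (X + t *: dX) dX) =
    expR (- (u + t * du)) *: (dZ - 2^-1 *: br X dX)).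
  by rewrite expRN frame_bracketDl frame_bracketZl frame_bracketxx scaler0 addr0.
congr (_ *: _); rewrite -[RHS]ger0_norm ?expR_ge0// -sqrtr_sqr expr2 -expRD.
by rewrite mulNr -opprD -splitr expRN sqrtrV// expR_ge0.
Qed.

Lemma DRlength_line c : (forall t, DRspeed DRline t = c) -> DRlength DRline = c.
Proof.
move=> h; rewrite /DRlength; under eq_Rintegral do rewrite h.
rewrite Rintegral_cst//= lebesgue_measure_itv/= lte_fin ltr01.
by rewrite oppr0 adde0 /= mulr1.
Qed.

End line.

Lemma sum_sqr_le (I : finType) (f : I -> R) :
  \sum_i f i ^+ 2 <= (\sum_i `|f i|) ^+ 2.
Proof.
have [H _] : \sum_i f i ^+ 2 <= (\sum_i `|f i|) ^+ 2 /\ 0 <= \sum_i `|f i|.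
  apply: (big_ind2 (fun a b : R => a <= b ^+ 2 /\ 0 <= b)).
  - by rewrite expr0n.
  - move=> a b c d [ab b0] [cd d0]; split; last exact: addr_ge0.
    by have := mulr_ge0 b0 d0; move: ab cd; rewrite !expr2; nra.
  - by move=> i _; rewrite real_normK ?num_real.
exact: H.
Qed.

Lemma DRnorm_le (w : 'rV[R]_m * 'rV[R]_k * R) :
  DRnorm w <= \sum_i `|w.1.1 ord0 i| + \sum_j `|w.1.2 ord0 j| + `|w.2|.
Proof.
have s0 (p : nat) (v : 'rV[R]_p) : 0 <= \sum_i `|v ord0 i| by apply: sumr_ge0.
have A := sum_sqr_le (fun i => w.1.1 ord0 i); have B := sum_sqr_le (fun i => w.1.2 ord0 i).
have C : w.2 ^+ 2 = `|w.2| ^+ 2 by rewrite real_normK ?num_real.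
have := s0 _ w.1.1; have := s0 _ w.1.2; have := normr_ge0 w.2.
rewrite /DRnorm; move: A B C.
set a := \sum_i `|w.1.1 _ _|; set b := \sum_i `|w.1.2 _ _|; set c := `|w.2|.
set a2 := \sum_i _; set b2 := \sum_i _ => A B -> c0 b0 a0.
rewrite -[leRHS]ger0_norm ?addr_ge0// -sqrtr_sqr ler_wsqrtr//.
have := mulr_ge0 a0 b0; have := mulr_ge0 a0 c0; have := mulr_ge0 b0 c0.
move: A B; rewrite !expr2; nra.
Qed.

(* The path goes up to the height [exp h], moves there along a one-parameter
   subgroup of N, and comes down. *)
Lemma DRjoined_path (x y : DRspace F) (h M N : R) :
  (forall i, `|y.1.1 ord0 i - x.1.1 ord0 i| <= M) ->
  (forall j, `|y.1.2 ord0 j - x.1.2 ord0 j - 2^-1 * br x.1.1 y.1.1 ord0 j| <= N) ->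
  exists2 l, DRjoined x y l & l <= `|h - ln (posval x.2)| + `|ln (posval y.2) - h|
    + m%:R * (expR (- h / 2) * M) + k%:R * (expR (- h) * N).
Proof.
move=> hM hN; set p := ln (posval x.2); set q := ln (posval y.2).
pose g1 := DRline x.1.1 0 x.1.2 0 p (h - p).
pose g2 := DRline x.1.1 (y.1.1 - x.1.1) x.1.2 (y.1.2 - x.1.2) h 0.
pose g3 := DRline y.1.1 0 y.1.2 0 h (q - h).
have l1 (X : 'rV[R]_m) (Z : 'rV[R]_k) u du : DRlength (DRline X 0 Z 0 u du) = `|du|.
  apply: DRlength_line => t; rewrite DRspeed_line frame_bracket0r !scaler0 subrr scaler0.
  rewrite /DRnorm/= big1 ?add0r => [|i _]; last by rewrite mxE expr0n.
  by rewrite big1 ?add0r ?sqrtr_sqr// => i _; rewrite mxE expr0n.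
have J1 : DRjoined x (g1 1) (0 + `|h - p|).
  rewrite -(l1 x.1.1 x.1.2 p (h - p)); apply: (DRjoined_arc (DRjoined_refl x)).
    exact: DRline_C1.
  by rewrite /g1 DRline0 posexp_ln; case: x {hM hN p q g1 g2 g3} => [[]].
have J2 : DRjoined x (g2 1) (0 + `|h - p| + DRlength g2).
  apply: (DRjoined_arc J1); first exact: DRline_C1.
  by rewrite /g2 /g1 DRline0 DRline1 !addr0 subrKC.
have J3 : DRjoined x (g3 1) (0 + `|h - p| + DRlength g2 + `|q - h|).
  rewrite -(l1 y.1.1 y.1.2 h (q - h)); apply: (DRjoined_arc J2).
    exact: DRline_C1.
  by rewrite /g3 /g2 DRline0 DRline1 !addr0 !subrKC.
exists (0 + `|h - p| + DRlength g2 + `|q - h|).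
  by move: J3; rewrite /g3 DRline1 !addr0 subrKC posexp_ln; case: (y) => [[]].
suff H : DRlength g2 <= m%:R * (expR (- h / 2) * M) + k%:R * (expR (- h) * N) by lra.
rewrite (DRlength_line (c := DRnorm (expR (- h / 2) *: (y.1.1 - x.1.1),
   expR (- h) *: (y.1.2 - x.1.2 - 2^-1 *: br x.1.1 (y.1.1 - x.1.1)), 0))); last first.
  by move=> t; rewrite DRspeed_line mulr0 addr0.
have sum_cst d (c : R) : d%:R * c = \sum_(i < d) c.
  by rewrite sumr_const card_ord mulr_natl.
apply: le_trans (DRnorm_le _) _; rewrite normr0 addr0; apply: lerD.
  rewrite sum_cst; apply: ler_sum => i _.
  by rewrite !mxE normrM (ger0_norm (expR_ge0 _)) ler_wpM2l ?expR_ge0.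
rewrite sum_cst; apply: ler_sum => j _.
move: (hN j); rewrite /= frame_bracketDr frame_bracketNr frame_bracketxx subr0.
move: (br _ _) => u hj.
by rewrite !mxE normrM (ger0_norm (expR_ge0 _)) ler_wpM2l ?expR_ge0.
Qed.

Lemma DRdist_le (x y : DRspace F) (h M N : R) :
  (forall i, `|y.1.1 ord0 i - x.1.1 ord0 i| <= M) ->
  (forall j, `|y.1.2 ord0 j - x.1.2 ord0 j - 2^-1 * br x.1.1 y.1.1 ord0 j| <= N) ->
  DRdist x y <= `|h - ln (posval x.2)| + `|ln (posval y.2) - h|
    + m%:R * (expR (- h / 2) * M) + k%:R * (expR (- h) * N).
Proof.
move=> hM hN; have [l Jl ll] := DRjoined_path h hM hN.
apply: le_trans ll; apply: ge_inf => //.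
by exists 0 => l' /DRjoined_near[].
Qed.

Lemma DRdist_lt_near (x y : DRspace F) (r : R) :
  DRdist x y < r -> exists2 l, l < r & DRnear x y l.
Proof.
(* The infimum of an empty set would be 0, so some path has to be exhibited; any height and any
   bounds do. *)
move=> /inf_lt[|l /DRjoined_near H lr]; last by exists l.
have [|j|l Jl _] := @DRjoined_path x y 0 (\sum_i `|y.1.1 ord0 i - x.1.1 ord0 i|)
  (\sum_j `|y.1.2 ord0 j - x.1.2 ord0 j - 2^-1 * br x.1.1 y.1.1 ord0 j|).
- by move=> i; rewrite (bigD1 i)//= lerDl sumr_ge0.
- by rewrite (bigD1 j)//= lerDl sumr_ge0.
- by exists l.
Qed.

End upper_bound.

(** * Measures of boxes *)

Section monotone_measures.

(* The integral of a nonnegative function is a supremum over the simple functions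
   below it, hence monotone even without measurability. *)
Lemma ge0_integral_mono d (T : measurableType d) (R : realType)
    (mu : {measure set T -> \bar R}) (f g : T -> \bar R) :
  (forall x, 0 <= f x)%E -> (forall x, f x <= g x)%E ->
  (\int[mu]_x f x <= \int[mu]_x g x)%E.
Proof.
move=> f0 fg; have g0 x : (0 <= g x)%E by exact: le_trans (f0 x) (fg x).
rewrite !ge0_integralTE//; apply: le_ereal_sup => _ [h hf <-]; exists h => // x.
exact: le_trans (hf x) (fg x).
Qed.

Lemma posreal_haar_mono (R : realType) (A B : set (posreal R)) :
  A `<=` B -> (posreal_haar A <= posreal_haar B)%E.
Proof.
move=> AB; rewrite /posreal_haar [leLHS]integral_mkcond [leRHS]integral_mkcond.
have pos (C : set (posreal R)) x :
    (0 <= ((fun y : R => (y^-1)%:E) \_ (@posval R @` C)) x)%E.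
  rewrite patchE; case: ifPn => // /set_mem[a _ <-].
  by rewrite lee_fin invr_ge0 ltW// posval_gt0.
apply: ge0_integral_mono => // x; rewrite [leLHS]patchE; case: ifPn => [|_]; last exact: pos.
move=> /set_mem[a Aa <-]; rewrite patchE mem_set//.
by exists a => //; exact: AB.
Qed.

(** Stated for arbitrary sets because the neighbourhoods in [CZ_set] are not shown to be measurable.
    The hypothesis on [m2] is for sections, which may then be nonmeasurable too. *)
Lemma prod_measure_mono d1 d2 (T1 : measurableType d1) (T2 : measurableType d2)
    (R : realType) (m1 : {sigma_finite_measure set T1 -> \bar R})
    (m2 : {sigma_finite_measure set T2 -> \bar R}) (A B : set (T1 * T2)) :
  (forall A' B', A' `<=` B' -> (m2 A' <= m2 B')%E) -> A `<=` B ->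
  (prod_measure m1 m2 A <= prod_measure m1 m2 B)%E.
Proof.
move=> m2m AB; rewrite /prod_measure /product_measure1.
apply: ge0_integral_mono => x; first exact: measure_ge0.
by apply: m2m; exact: le_xsection.
Qed.

End monotone_measures.

Section box_measure.
Variable R : realType.

Definition rVbox n (xi : 'I_n -> R) (r : R) : set 'rV[R]_n :=
  [set x | forall i, xi i <= x ord0 i < xi i + r].

Lemma measurable_itvco d (T : measurableType d) (f g : T -> R) r :
  measurable_fun setT f -> measurable_fun setT g ->
  measurable [set t | g t <= f t < g t + r].
Proof.
move=> mf mg.
rewrite (_ : [set _ | _] = (f \- g) @^-1` `[0, r[).
  by rewrite -[X in measurable X]setTI; apply: measurable_funB => //; exact: measurable_itv.
by apply/seteqP; split => t /=; rewrite in_itv/= => /andP[? ?]; apply/andP; split; lra.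
Qed.

Lemma measurable_forall_ord d (T : measurableType d) n (A : 'I_n -> set T) :
  (forall i, measurable (A i)) -> measurable [set t | forall i, A i t].
Proof.
move=> mA; rewrite (_ : [set _ | _] = \bigcap_i A i).
  by apply: fin_bigcap_measurable => //; exact: finite_finset.
by apply/seteqP; split => t /= h i; [move=> _; exact: h|exact: h].
Qed.

Lemma measurable_rVbox n (xi : 'I_n -> R) r : measurable (rVbox xi r).
Proof.
apply: measurable_forall_ord => i; apply: measurable_itvco => //.
exact: measurable_rV_coor.
Qed.

Lemma lebesgue_itvco (a r : R) : 0 <= r ->
  lebesgue_measure (`[a, a + r[%classic : set R) = r%:E.
Proof.
move=> r0; rewrite lebesgue_measure_itv/= lte_fin; case: ifPn => [_|].
  by rewrite -EFinD; congr EFin; ring.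
by rewrite -leNgt => h; congr EFin; lra.
Qed.

Lemma rV_lebesgue_box n (xi : 'I_n -> R) r : 0 <= r ->
  rV_lebesgue R n (rVbox xi r) = (r ^+ n)%:E.
Proof.
move=> r0; elim: n xi => [|n IH] xi.
  rewrite /= diracE mem_set ?expr0//; by move=> [].
rewrite /= /iso_measure /pushforward.
rewrite (_ : _ @^-1` _ = `[xi ord0, xi ord0 + r[%classic `*`
    rVbox (fun i => xi (lift ord0 i)) r); last first.
  apply/seteqP; split => -[a x] /=.
    move=> h; split => /=; first by have := h ord0; rewrite in_itv/= rV_cons0.
    by move=> i; have := h (lift ord0 i); rewrite rV_consS.
  move=> [/=]; rewrite in_itv/= => ha hx i.
  by case: (unliftP ord0 i) => [j|] ->; rewrite ?rV_consS ?rV_cons0//; exact: hx.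
rewrite /prod_measure product_measure1E//; last exact: measurable_rVbox.
transitivity (r%:E * (r ^+ n)%:E)%E; last by rewrite -EFinM exprS.
by congr (_ * _)%E; [exact: lebesgue_itvco|exact: IH].
Qed.

Lemma posreal_haar_itv (u r : R) : 0 < r ->
  posreal_haar [set a : posreal R | u <= ln (posval a) < u + r] = r%:E.
Proof.
move=> r0; rewrite /posreal_haar.
rewrite (_ : _ @` _ = `[expR u, expR (u + r)[%classic); last first.
  apply/seteqP; split => [_ [a /= /andP[h1 h2] <-]|x] /=.
    by rewrite in_itv/= -[X in _ <= X < _]lnK ?posrE ?posval_gt0// ler_expR ltr_expR h1.
  rewrite in_itv/= => /andP[h1 h2]; have x0 : 0 < x by exact: lt_le_trans (expR_gt0 _) h1.
  exists (PosNum x0 : {posnum R}) => //=; rewrite /posval/=.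
  by rewrite -ler_expR -ltr_expR lnK ?posrE// h1.
have lt : expR u < expR (u + r) by rewrite ltr_expR; lra.
have pos x : x \in `[expR u, expR (u + r)]%R -> 0 < x.
  by rewrite in_itv/= => /andP[h _]; exact: lt_le_trans (expR_gt0 _) h.
have cinv : {within `[expR u, expR (u + r)], continuous (fun x : R => x^-1)}.
  apply: continuous_in_subspaceT => x /set_mem/pos x0.
  by apply: inv_continuous; rewrite gt_eqF.
rewrite integral_itv_bndo_bndc; last first.
  apply/measurable_EFinP.
  have minv : measurable_fun (`]0, +oo[ : set R) (fun x : R => x^-1).
    apply: open_continuous_measurable_fun; first exact: interval_open.
    move=> x; rewrite inE/= in_itv/= andbT => x0.
    by apply: inv_continuous; rewrite gt_eqF.
  apply: measurable_funS minv; first exact: measurable_itv.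
  by move=> x /=; rewrite !in_itv/= andbT => /andP[h _]; exact: lt_le_trans (expR_gt0 _) h.
rewrite (@continuous_FTC2 R _ (@ln R))//.
- by rewrite !expRK -EFinB; congr EFin; ring.
- split.
  + move=> x; rewrite in_itv/= => /andP[h _]; apply: ex_derive.
    exact: is_derive1_ln (lt_trans (expR_gt0 _) h).
  + by apply: cvg_at_right_filter; exact: continuous_ln (expR_gt0 _).
  + by apply: cvg_at_left_filter; exact: continuous_ln (expR_gt0 _).
- move=> x; rewrite in_itv/= => /andP[h _].
  rewrite derive1E; apply: derive_val.
  exact: is_derive1_ln (lt_trans (expR_gt0 _) h).
Qed.

Variables (n : euclideanLieAlgebra R) (m k : nat).
Variable F : orthonormal_frame n m k.

(** The corner [zeta] may depend on X, so this covers both the sheared cells and the left translates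
    of boxes of N; the volume does not depend on [zeta]. *)
Definition DRbox (xi : 'I_m -> R) r (zeta : 'rV[R]_m -> 'I_k -> R) s u t :
    set (DRspace F) :=
  [set x | [/\ rVbox xi r x.1.1, rVbox (zeta x.1.1) s x.1.2 &
               u <= ln (posval x.2) < u + t]].

Lemma measurable_posval : measurable_fun setT (@posval R).
Proof. by move=> _ B mB; rewrite setTI; exists B => //; rewrite setTI. Qed.

Let Nbox (xi : 'I_m -> R) r (zeta : 'rV[R]_m -> 'I_k -> R) s :
    set ('rV[R]_m * 'rV[R]_k) :=
  [set p | rVbox xi r p.1 /\ rVbox (zeta p.1) s p.2].

Section measure.
Variables (xi : 'I_m -> R) (r : R) (zeta : 'rV[R]_m -> 'I_k -> R) (s u t : R).
Hypothesis mzeta : forall j, measurable_fun setT (fun x => zeta x j).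

Let DRboxE : DRbox xi r zeta s u t =
  Nbox xi r zeta s `*` [set a | u <= ln (posval a) < u + t].
Proof. by apply/seteqP; split => [x [? ? ?]|x [[? ?] ?]]. Qed.

Let measurable_Nbox : measurable (Nbox xi r zeta s).
Proof.
have -> : Nbox xi r zeta s = (rVbox xi r `*` setT) `&`
    [set p : 'rV[R]_m * 'rV[R]_k | forall j, zeta p.1 j <= p.2 ord0 j < zeta p.1 j + s].
  by apply/seteqP; split => [p [? ?]|p [[? _] ?]].
apply: measurableI; first by apply: measurableX => //; exact: measurable_rVbox.
apply: measurable_forall_ord => j; apply: measurable_itvco.
  by apply: measurableT_comp (measurable_rV_coor _) _.
exact: measurableT_comp (mzeta j) _.
Qed.

Let measurable_height : measurable [set a : posreal R | u <= ln (posval a) < u + t].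
Proof.
apply: measurable_itvco => //.
exact: (measurableT_comp (@measurable_ln R) measurable_posval).
Qed.

Lemma measurable_DRbox : measurable (DRbox xi r zeta s u t).
Proof. by rewrite DRboxE; apply: measurableX. Qed.

Lemma DRmeasure_box : 0 <= r -> 0 <= s -> 0 < t ->
  DRmeasure F (DRbox xi r zeta s u t) = (r ^+ m * s ^+ k * t)%:E.
Proof.
move=> r0 s0 t0; rewrite DRboxE /DRmeasure /= /prod_measure product_measure1E//.
transitivity ((r ^+ m * s ^+ k)%:E * t%:E)%E; last by rewrite -EFinM.
congr (_ * _)%E; last exact: posreal_haar_itv.
rewrite /= /prod_measure /product_measure1.
rewrite (_ : _ \o _ = (cst (s ^+ k)%:E) \_ (rVbox xi r)); last first.
  apply/funext => x /=; rewrite patchE; case: ifPn => xr.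
    rewrite -(rV_lebesgue_box (zeta x) s0); congr (rV_lebesgue R k _).
    apply/seteqP; split => y; rewrite /xsection/= inE /Nbox/=; first by case.
    by move=> hy; split => //; exact: set_mem xr.
  rewrite (_ : xsection _ _ = set0) ?measure0//.
  apply/seteqP; split => // y; rewrite /xsection/= inE /Nbox/= => -[h _].
  by move/negP: xr; apply; exact: mem_set.
rewrite -integral_mkcond integral_cst; last exact: measurable_rVbox.
transitivity ((s ^+ k)%:E * (r ^+ m)%:E)%E; last by rewrite -EFinM mulrC.
by congr (_ * _)%E; exact: rV_lebesgue_box.
Qed.

End measure.
End box_measure.

(** * The cells of a Damek-Ricci space *)

Section shear.
Variables (R : realType) (n : euclideanLieAlgebra R) (m k : nat).
Variable F : orthonormal_frame n m k.
Local Notation br := (frame_bracket F).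
Local Notation B := (bracket_bound F).

(* Subtracting [shear X] from the z-coordinate turns the left translates of boxes
   of N into sets close to Euclidean boxes, simultaneously at all triadic scales. *)
Definition shear (X : 'rV[R]_m) (l : 'I_k) : R :=
  \sum_a \sum_b 2^-1 * bracket_coef F l a b * area (X ord0 a) (X ord0 b).

(** [shear] acts as a primitive of [X, dX] / 2, and [X', X] = [X', X - X'] is the linear part of its
    increment from X'; [area_cell] bounds the remainder coefficient by coefficient. *)
Lemma shear_cell p (X X' : 'rV[R]_m) l :
  (forall a, tri p (X ord0 a) = tri p (X' ord0 a)) ->
  `|shear X l - shear X' l - 2^-1 * br X' X ord0 l| <= 2 * B * pow3 R p ^+ 2.
Proof.
move=> h.
have -> : 2^-1 * br X' X ord0 l = 2^-1 * br X' (X - X') ord0 l.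
  by rewrite frame_bracketDr frame_bracketNr frame_bracketxx subr0.
rewrite frame_bracketE /shear mulr_sumr -!sumrB.
apply: (@le_trans _ _ (\sum_a \sum_b `|bracket_coef F l a b| * (2 * pow3 R p ^+ 2))).
  apply: le_trans (ler_norm_sum _ _ _) _; apply: ler_sum => a _.
  rewrite mulr_sumr -!sumrB.
  apply: le_trans (ler_norm_sum _ _ _) _; apply: ler_sum => b _.
  have := area_cell (h a) (h b); set D := area _ _ - _ - _ => hD.
  rewrite (_ : _ - _ - _ = 2^-1 * bracket_coef F l a b * D); last first.
    by rewrite /D !mxE; ring.
  rewrite normrM normrM ger0_norm ?invr_ge0//.
  have := ler_wpM2l (normr_ge0 (bracket_coef F l a b)) hD; lra.
under eq_bigr do rewrite -mulr_suml; rewrite -mulr_suml.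
rewrite (_ : 2 * B * _ = B * (2 * pow3 R p ^+ 2)); last by ring.
apply: ler_wpM2r; first by rewrite mulr_ge0// exprn_ge0// ltW// pow3_gt0.
rewrite /bracket_bound [leRHS](bigD1 l)//= lerDl.
by do 3! apply: sumr_ge0 => ? _.
Qed.

Lemma measurable_shear l : measurable_fun setT (fun X => shear X l).
Proof.
apply: measurable_sum => a; apply: measurable_sum => b.
apply: measurable_funM => //.
by apply: measurable_area; exact: measurable_rV_coor.
Qed.

Lemma measurable_frame_bracket X l : measurable_fun setT (fun Y => br X Y ord0 l).
Proof.
under eq_fun do rewrite frame_bracketE.
apply: measurable_sum => a; apply: measurable_sum => b.
apply: measurable_funM => //; apply: measurable_funM => //.
exact: measurable_rV_coor.
Qed.

End shear.

(** * The scales of the sides of a cell *)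

Section levels.
Variable R : realType.
Implicit Types (s : int) (u : nat) (h c : R).
Local Notation pow3 := (pow3 R).

Definition level (t : R) : int := Num.ceil (t / ln 3).

Lemma level_ge t : expR t <= pow3 (level t).
Proof. by rewrite ler_expR -ler_pdivrMr ?ln3_gt0// ceil_ge. Qed.

Lemma level_le t : pow3 (level t) <= 3 * expR t.
Proof.
rewrite -(pow31 R) -expRD ler_expR mul1r -ler_pdivlMr ?ln3_gt0//.
rewrite mulrDl divff ?gt_eqF ?ln3_gt0// addrC; apply: ltW.
have := @ceilB1_lt R (t / ln 3); rewrite intrB; rewrite -/(level t); lra.
Qed.

Lemma le_level t t' : t <= t' -> level t <= level t'.
Proof. by move=> tt'; apply: le_ceil; rewrite ler_pM2r ?invr_gt0 ?ln3_gt0. Qed.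

(* The sides of the cell are [3 ^ p] with
   [p = level (lambda c + s ln 3 + beta 3 ^ s)], for [c] the logarithmic height of
   its centre and [3 ^ s] its logarithmic height: at small scales this is a
   Riemannian box of radius [3 ^ s], at large ones an admissible set of Hebisch
   and Steger. *)
Definition target (lambda beta : R) s (N : int) : int :=
  level (lambda * (N%:~R * pow3 s) + s%:~R * ln 3 + beta * pow3 s).

(** [(N + 1) %/ 3] is the parent height interval. The side descends from the parent's target by one
    triadic step per [u], then stays at its own target. *)
Definition side (lambda beta : R) s u (N : int) : int :=
  Num.max (target lambda beta s N)
    (target lambda beta (s + 1) ((N + 1) %/ 3)%Z - u%:Z).

Lemma pow3_expR s t : pow3 s * expR t = expR (s%:~R * ln 3 + t).
Proof. by rewrite expRD. Qed.

Section side.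
Variables (lambda beta : R).
Local Notation T := (target lambda beta).
Local Notation S := (side lambda beta).

Lemma side_anti s u u' N : (u <= u')%N -> S s u' N <= S s u N.
Proof. by rewrite /side; lia. Qed.

Lemma side_step s u N : S s u N <= S s u.+1 N + 1.
Proof. by rewrite /side; lia. Qed.

Lemma side_stable s N : exists u0 : nat, forall u, (u0 <= u)%N -> S s u N = T s N.
Proof.
rewrite /side; set a := T s N; set b := T (s + 1) _.
by exists `|b - a|%N => u; lia.
Qed.

Lemma pow3_target_ge s N : pow3 s * expR (lambda * (N%:~R * pow3 s) + beta * pow3 s)
  <= pow3 (T s N).
Proof.
apply: le_trans (level_ge _).
by rewrite pow3_expR ler_expR; lra.
Qed.

Lemma pow3_target_le s N : pow3 (T s N) <=
  3 * (pow3 s * expR (lambda * (N%:~R * pow3 s) + beta * pow3 s)).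
Proof.
apply: le_trans (level_le _) _; rewrite ler_pM2l//.
by rewrite pow3_expR ler_expR; lra.
Qed.

Hypotheses (l0 : 0 <= lambda) (lb : lambda <= beta).

(** The centre moves by at most 2 * 3 ^ s, which costs 2 lambda 3 ^ s; tripling 3 ^ s gains 2 beta 3
    ^ s. *)
Lemma target_step s h : T s (tri s h) <= T (s + 1) (tri (s + 1) h).
Proof.
apply: le_level; rewrite -[(tri s h)%:~R * _]/(tric s h).
rewrite -[(tri (s + 1) h)%:~R * _]/(tric (s + 1) h).
have := tric_step s h; rewrite ler_norml pow3S intrD => /andP[h1 h2].
have L0 := ln3_gt0 R; have s0 := pow3_gt0 R s.
have := ler_wpM2l l0 h2; have := ler_wpM2r (ltW s0) lb; nra.
Qed.

Lemma target_mono s s' h : s <= s' -> T s (tri s h) <= T s' (tri s' h).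
Proof.
move=> ss'; have -> : s' = s + `|s' - s|%N%:Z by lia.
elim: `|_|%N => [|d IH]; first by rewrite addr0.
by apply: le_trans IH _; rewrite -addn1 PoszD addrA target_step.
Qed.

Lemma sideE s u h : S s u (tri s h) =
  Num.max (T s (tri s h)) (T (s + 1) (tri (s + 1) h) - u%:Z).
Proof. by rewrite /side -tri_step. Qed.

Lemma side0 s h : S s 0 (tri s h) = T (s + 1) (tri (s + 1) h).
Proof. by rewrite sideE subr0; apply/max_idPr; exact: target_step. Qed.

(** The target at scale [s] separates the two sides. *)
Lemma side_mono s s' u u' h : s' < s -> S s' u' (tri s' h) <= S s u (tri s h).
Proof.
move=> ss'; apply: (@le_trans _ _ (T s (tri s h))); last by rewrite /side; lia.
apply: le_trans (side_anti s' (tri s' h) (leq0n u')) _.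
by rewrite side0 target_mono//; lia.
Qed.

Lemma pow3_side_ge s u h :
  pow3 s * expR (lambda * tric s h + beta * pow3 s) <= pow3 (S s u (tri s h)).
Proof.
apply: le_trans (pow3_target_ge s (tri s h)) _.
by apply: ler_pow3; rewrite /side; lia.
Qed.

(** The side is at most the target one scale up: 9 is 3 for rounding to a power of 3 times 3 for the
    scale, and the exponent gains 2 lambda from the shift of the centre. *)
Lemma pow3_side_le s u h : pow3 (S s u (tri s h)) <=
  9 * (pow3 s * expR (lambda * tric s h + (2 * lambda + 3 * beta) * pow3 s)).
Proof.
apply: (@le_trans _ _ (pow3 (T (s + 1) (tri (s + 1) h)))).
  by rewrite -(side0 s h) ler_pow3// side_anti.
apply: le_trans (pow3_target_le _ _) _.
rewrite -[(tri (s + 1) h)%:~R * _]/(tric (s + 1) h) pow3S.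
have := tric_step s h; rewrite ler_norml => /andP[h1 h2].
have := ler_wpM2l l0 h1 => h3.
have he : expR (lambda * tric (s + 1) h + beta * (3 * pow3 s)) <=
    expR (lambda * tric s h + (2 * lambda + 3 * beta) * pow3 s) by rewrite ler_expR; lra.
have := ler_wpM2l (ltW (pow3_gt0 R s)) he; lra.
Qed.

End side.

End levels.

(** * Volume, diameter and neighbourhoods of the cells *)

Section factor.
Variables (R : realType) (n : euclideanLieAlgebra R) (m k : nat).
Variable F : orthonormal_frame n m k.
Local Notation br := (frame_bracket F).
Local Notation B := (bracket_bound F).
Local Notation pow3 := (pow3 R).
Implicit Types (s : int) (u : nat) (x y z : DRspace F).

Definition height x : R := ln (posval x.2).
Definition sheared x (j : 'I_k) : R := x.1.2 ord0 j - shear F x.1.1 j.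
(** With l = 3 ^ s, [DRcell_near] needs an exponent of at least 5/4 l in the X-side; 2 leaves room.
    By [pow3_side_le] the X-side is then at most 9 l exp (c / 2 + 7 l), so its square is controlled
    by the Z-side as soon as the exponent there is 2 * 7 + 1 = 15, the 1 being for l <= exp l; hence
    16. *)
Definition sideX s u (N : int) : int := @side R 2^-1 2 s u N.
Definition sideZ s u (N : int) : int := @side R 1 16 s u N.

Definition DRkey : countType := (int * {ffun 'I_m -> int} * {ffun 'I_k -> int})%type.

Definition DRidx s u x : DRkey := let N := tri s (height x) in
  (N, [ffun i => tri (sideX s u N) (x.1.1 ord0 i)],
      [ffun j => tri (sideZ s u N) (sheared x j)]).

Definition DRcell s u x : set (DRspace F) := [set y | DRidx s u y = DRidx s u x].

Let x0 : 0 <= 2^-1 :> R. Proof. by lra. Qed.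
Let x1 : 2^-1 <= 2 :> R. Proof. by lra. Qed.
Let z0 : 0 <= 1 :> R. Proof. by lra. Qed.
Let z1 : 1 <= 16 :> R. Proof. by lra. Qed.

Definition cellX s u x : R := pow3 (sideX s u (tri s (height x))).
Definition cellZ s u x : R := pow3 (sideZ s u (tri s (height x))).
Local Notation P := cellX.
Local Notation Q := cellZ.

Lemma DRidxP s u x y : DRidx s u y = DRidx s u x <->
  [/\ tri s (height y) = tri s (height x),
  forall i, tri (sideX s u (tri s (height x))) (y.1.1 ord0 i) =
            tri (sideX s u (tri s (height x))) (x.1.1 ord0 i) &
  forall j, tri (sideZ s u (tri s (height x))) (sheared y j) =
            tri (sideZ s u (tri s (height x))) (sheared x j)].
Proof.
rewrite /DRidx; split => [[-> /ffunP hX /ffunP hZ]|[-> hX hZ]].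
  by split => // [i|j]; [have := hX i|have := hZ j]; rewrite !ffunE.
by congr (_, _, _); apply/ffunP => i; rewrite !ffunE.
Qed.

Lemma DRcellE s u x : DRcell s u x =
  DRbox (fun i => ((tri (sideX s u (tri s (height x))) (x.1.1 ord0 i))%:~R - 2^-1) * P s u x)
    (P s u x)
    (fun X j => shear F X j +
      ((tri (sideZ s u (tri s (height x))) (sheared x j))%:~R - 2^-1) * Q s u x)
    (Q s u x) (((tri s (height x))%:~R - 2^-1) * pow3 s) (pow3 s).
Proof.
have tE i (t : R) N : tri i t = N <->
    (N%:~R - 2^-1) * pow3 i <= t < (N%:~R - 2^-1) * pow3 i + pow3 i.
  by rewrite triP; split => /andP[? ?]; apply/andP; split => //; lra.
apply/seteqP; split => y; rewrite /DRcell/=.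
  move=> /DRidxP[hN hX hZ]; split; last exact/tE.
    by move=> i; apply/tE.
  move=> j; have /tE/andP[h1 h2] := hZ j; rewrite /sheared in h1 h2.
  by apply/andP; split; rewrite /Q; lra.
move=> [hX hZ hN]; apply/DRidxP; split; first exact/tE.
  by move=> i; apply/tE; exact: hX.
move=> j; apply/tE; have /andP[h1 h2] := hZ j; rewrite /sheared.
by apply/andP; rewrite -/(Q s u x); split; lra.
Qed.

Lemma measurable_DRcell s u x : measurable (DRcell s u x).
Proof.
rewrite DRcellE; apply: measurable_DRbox => j.
by apply: measurable_funD => //; exact: measurable_shear.
Qed.

Lemma DRmeasure_cell s u x :
  DRmeasure F (DRcell s u x) = (P s u x ^+ m * Q s u x ^+ k * pow3 s)%:E.
Proof.
rewrite DRcellE DRmeasure_box ?pow3_gt0//; try exact: ltW (pow3_gt0 _ _).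
move=> j; apply: measurable_funD => //; exact: measurable_shear.
Qed.

Lemma DRidx_finer s u u' x y : (u <= u')%N ->
  DRidx s u' y = DRidx s u' x -> DRidx s u y = DRidx s u x.
Proof.
move=> uu' /DRidxP[hN hX hZ]; apply/DRidxP; split => // [i|j].
  by apply: tri_coarse (hX i); exact: (@side_anti R 2^-1 2).
by apply: tri_coarse (hZ j); exact: (@side_anti R 1 16).
Qed.

Lemma DRidx_lower s s' u u' x y : s' < s ->
  DRidx s' u' y = DRidx s' u' x -> DRidx s u y = DRidx s u x.
Proof.
move=> ss' /DRidxP[hN hX hZ].
have hNs : tri s (height y) = tri s (height x) by apply: tri_coarse hN; exact: ltW.
apply/DRidxP; split => // [i|j].
  by apply: tri_coarse (hX i); exact: side_mono.
by apply: tri_coarse (hZ j); exact: side_mono.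
Qed.

Lemma DRcell_split s u x : (DRmeasure F (DRcell s u x)
  <= (3 ^+ (m + k))%:E * DRmeasure F (DRcell s u.+1 x))%E.
Proof.
rewrite !DRmeasure_cell -EFinM lee_fin.
have hP : P s u x <= 3 * P s u.+1 x by rewrite /P -pow3S ler_pow3// /sideX side_step.
have hQ : Q s u x <= 3 * Q s u.+1 x by rewrite /Q -pow3S ler_pow3// /sideZ side_step.
rewrite exprD; rewrite (_ : 3 ^+ m * 3 ^+ k * _ =
  (3 * P s u.+1 x) ^+ m * (3 * Q s u.+1 x) ^+ k * pow3 s); last by rewrite !exprMn; ring.
rewrite ler_pM2r ?pow3_gt0//; apply: ler_pM; rewrite ?exprn_ge0//; try exact: ltW (pow3_gt0 _ _).
  by apply: lerXn2r; rewrite ?nnegrE//; try exact: ltW (pow3_gt0 _ _);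
    rewrite mulr_ge0// ltW// pow3_gt0.
by apply: lerXn2r; rewrite ?nnegrE//; try exact: ltW (pow3_gt0 _ _);
    rewrite mulr_ge0// ltW// pow3_gt0.
Qed.

(** Late stages of scale [s + 1] have the sides with which scale [s] starts, so only the height
    interval is cut. *)
Lemma DRcell_parent s x : exists u0 : nat, forall u, (u0 <= u)%N ->
  DRmeasure F (DRcell (s + 1) u x) = (3%:E * DRmeasure F (DRcell s 0 x))%E.
Proof.
have [u1 h1] := @side_stable R 2^-1 2 (s + 1) (tri (s + 1) (height x)).
have [u2 h2] := @side_stable R 1 16 (s + 1) (tri (s + 1) (height x)).
exists (maxn u1 u2) => u; rewrite geq_max => /andP[/h1 H1 /h2 H2].
rewrite !DRmeasure_cell -EFinM /P /Q /sideX /sideZ H1 H2 (side0 x0 x1) (side0 z0 z1).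
by rewrite pow3S; congr EFin; ring.
Qed.

(** All sides are at least 1 here. This bounds the scales of the cells around [x] of measure at most
    a given V. *)
Lemma DRcell_large s u x : 1 + `|height x| <= pow3 s ->
  ((pow3 s)%:E <= DRmeasure F (DRcell s u x))%E.
Proof.
move=> hs; rewrite DRmeasure_cell lee_fin -[leLHS]mul1r ler_pM2r ?pow3_gt0//.
have /andP[c1 c2] : - (`|height x| + pow3 s) <= tric s (height x) <= `|height x| + pow3 s.
  by rewrite -ler_norml tric_le.
have hn := normr_ge0 (height x).
have P1 : 1 <= P s u x.
  apply: le_trans (pow3_side_ge x0 x1 _ _ _).
  rewrite -[leLHS]mul1r; apply: ler_pM => //; first by apply: le_trans hs; rewrite lerDl.
  by rewrite -[leLHS]expR0 ler_expR; lra.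
have Q1 : 1 <= Q s u x.
  apply: le_trans (pow3_side_ge z0 z1 _ _ _).
  rewrite -[leLHS]mul1r; apply: ler_pM => //; first by apply: le_trans hs; rewrite lerDl.
  by rewrite -[leLHS]expR0 ler_expR; lra.
by apply: mulr_ege1; exact: exprn_ege1.
Qed.

Lemma cellX_gt0 s u x : 0 < P s u x. Proof. exact: pow3_gt0. Qed.
Lemma cellZ_gt0 s u x : 0 < Q s u x. Proof. exact: pow3_gt0. Qed.

Lemma cellX_ge s u x :
  pow3 s * expR (2^-1 * tric s (height x) + 2 * pow3 s) <= P s u x.
Proof. exact: pow3_side_ge x0 x1 _ _ _. Qed.

Lemma cellZ_ge s u x :
  pow3 s * expR (tric s (height x) + 16 * pow3 s) <= Q s u x.
Proof. by have := pow3_side_ge z0 z1 s u (height x); rewrite mul1r. Qed.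

Lemma cellX_le s u x :
  P s u x <= 9 * (pow3 s * expR (2^-1 * tric s (height x) + 7 * pow3 s)).
Proof.
apply: le_trans (pow3_side_le x0 x1 _ _ _) _.
by rewrite !ler_pM2l ?pow3_gt0// ler_expR; lra.
Qed.

Lemma cellZ_le s u x :
  Q s u x <= 9 * (pow3 s * expR (tric s (height x) + 50 * pow3 s)).
Proof.
apply: le_trans (pow3_side_le z0 z1 _ _ _) _.
by rewrite !ler_pM2l ?pow3_gt0// ler_expR; lra.
Qed.

Let expR_ge (t : R) : t <= expR t.
Proof. by apply: le_trans (expR_ge1Dx t); lra. Qed.

Let expRB1_le (t : R) : expR t - 1 <= t * expR t.
Proof.
have := ler_wpM2r (expR_ge0 t) (expR_ge1Dx (- t)).
by rewrite -expRD addNr expR0 mulrDl mul1r mulNr; lra.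
Qed.

(* At small scales this holds because the sides in v and z are both comparable
   with the radius, at large scales because the side in z is taken much longer. *)
Lemma cellX_sqr s u x : P s u x ^+ 2 <= 81 * Q s u x.
Proof.
have e0 := pow3_gt0 R s; have P0 := ltW (cellX_gt0 s u x).
have := ler_pM P0 P0 (cellX_le s u x) (cellX_le s u x); rewrite -expr2 => /le_trans; apply.
apply: (@le_trans _ _ (81 * (pow3 s * expR (tric s (height x) + 16 * pow3 s)))); last first.
  by rewrite ler_pM2l// cellZ_ge.
set c := tric s _; set l := pow3 s in e0 *.
have -> : 9 * (l * expR (2^-1 * c + 7 * l)) * (9 * (l * expR (2^-1 * c + 7 * l))) =
  81 * (l * (l * (expR (2^-1 * c + 7 * l) * expR (2^-1 * c + 7 * l)))) by ring.
rewrite ler_pM2l// ler_pM2l// -expRD.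
apply: le_trans (ler_wpM2r (expR_ge0 _) (expR_ge l)) _.
by rewrite -expRD ler_expR; lra.
Qed.

(** The shear contributes 2 B P ^ 2, which is at most 162 B Q by [cellX_sqr]. *)
Lemma DRcell_close s u x y : DRcell s u x y ->
  [/\ `|height y - height x| <= pow3 s,
   forall i, `|y.1.1 ord0 i - x.1.1 ord0 i| <= P s u x &
   forall j, `|y.1.2 ord0 j - x.1.2 ord0 j - 2^-1 * br x.1.1 y.1.1 ord0 j|
     <= (1 + 162 * B) * Q s u x].
Proof.
move=> /DRidxP[hN hX hZ]; split; first exact: tri_eq_close.
  by move=> i; exact: tri_eq_close.
move=> j; have := tri_eq_close (hZ j); have := shear_cell F j hX; rewrite /sheared.
have := ler_wpM2l (bracket_bound_ge0 F) (cellX_sqr s u x).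
rewrite -/(P s u x) -/(Q s u x) -/(cellX s u x).
set W := shear F y.1.1 j; set W' := shear F x.1.1 j.
set t := 2^-1 * _; rewrite !ler_norml => h /andP[h1 h2] /andP[h3 h4].
by apply/andP; split; lra.
Qed.

(** For the path at height c + 50 l: the climb and the descent take at most 51 l + 52 l, and up
    there each side has length at most 9 l, as 50 is the exponent in [cellZ_le]. The rest makes the
    inequality strict. *)
Definition ball_const : R := 104 + 9 * m%:R + 9 * k%:R * (1 + 162 * B).

Lemma DRcell_ball s u x y : DRcell s u x y -> DRdist x y < ball_const * pow3 s.
Proof.
move=> xy; have [hN hX hZ] := DRcell_close xy.
have := DRdist_le (tric s (height x) + 50 * pow3 s) hX hZ.
have cx := tric_close s (height x); have e0 := pow3_gt0 R s.
have b0 := bracket_bound_ge0 F.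
set h := tric s (height x) + _ => /le_lt_trans; apply.
have hP : expR (- h / 2) * P s u x <= 9 * pow3 s.
  apply: le_trans (ler_wpM2l (expR_ge0 _) (cellX_le s u x)) _.
  rewrite mulrCA ler_pM2l// mulrCA -[leRHS]mulr1 ler_pM2l// -expRD -[leRHS]expR0 ler_expR.
  by rewrite /h; lra.
have hQ : expR (- h) * Q s u x <= 9 * pow3 s.
  apply: le_trans (ler_wpM2l (expR_ge0 _) (cellZ_le s u x)) _.
  rewrite mulrCA ler_pM2l// mulrCA -[leRHS]mulr1 ler_pM2l// -expRD -[leRHS]expR0 ler_expR.
  by rewrite /h; lra.
have B1 : 0 <= 1 + 162 * B by lra.
have hQ' := ler_wpM2l B1 hQ.
have mP := ler_wpM2l (ler0n R m) hP; have kQ := ler_wpM2l (ler0n R k) hQ'.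
have a1 : `|h - ln (posval x.2)| <= 51 * pow3 s.
  move: cx; rewrite -/(height x) /h !ler_norml => /andP[? ?]; apply/andP; split; lra.
have a2 : `|ln (posval y.2) - h| <= 52 * pow3 s.
  move: cx hN; rewrite -/(height y) /h !ler_norml => /andP[? ?] /andP[? ?].
  apply/andP; split; lra.
rewrite /ball_const; lra.
Qed.

(** The coefficient 244 is 162 from [DRcell_close], 1 from the path and 81 from the bracket term. *)
Definition nbhd_const : R := 3 + 244 * B.

Lemma DRcell_near s u x y z : DRcell s u x y -> DRdist z y < pow3 s ->
  [/\ `|height z - tric s (height x)| <= 3 / 2 * pow3 s,
   forall i, `|z.1.1 ord0 i - x.1.1 ord0 i| <= 2 * P s u x &
   forall j, `|z.1.2 ord0 j - x.1.2 ord0 j - 2^-1 * br x.1.1 z.1.1 ord0 j|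
     <= nbhd_const * Q s u x].
Proof.
move=> xy /DRdist_lt_near[l ls [l0 hA hX hZ]].
have [yN yX yZ] := DRcell_close xy; have b0 := bracket_bound_ge0 F.
have e0 := pow3_gt0 R s; set c := tric s (height x).
have cy : `|height y - c| <= pow3 s / 2.
  have /DRidxP[hN _ _] := xy.
  by have := tric_close s (height y); rewrite (tri_eq_tric hN).
have hz : `|height z - c| <= 3 / 2 * pow3 s.
  move: cy hA; rewrite -/(height y) -/(height z) !ler_norml => /andP[? ?] /andP[? ?].
  by apply/andP; split; lra.
have zle : height z <= c + 3 / 2 * pow3 s.
  by move: hz; rewrite ler_norml => /andP[? ?]; lra.
have az : posval z.2 = expR (height z) by rewrite /height lnK// posrE posval_gt0.
have sz : Num.sqrt (posval z.2) = expR (height z / 2).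
  by rewrite az {1}(splitr (height z)) expRD -expr2 sqrtr_sqr ger0_norm// expR_ge0.
have el : expR (l / 2) - 1 <= 2^-1 * pow3 s * expR (pow3 s / 2).
  apply: le_trans (_ : expR (pow3 s / 2) - 1 <= _); first by rewrite lerB// ler_expR; lra.
  by rewrite [2^-1 * _]mulrC; exact: expRB1_le.
have el0 : 0 <= expR (l / 2) - 1 by rewrite subr_ge0 -[leLHS]expR0 ler_expR; lra.
have zX i : `|y.1.1 ord0 i - z.1.1 ord0 i| <= P s u x.
  apply: le_trans (hX i) _; rewrite sz; apply: le_trans (cellX_ge s u x).
  apply: (@le_trans _ _ (2 * expR (height z / 2) * (2^-1 * pow3 s * expR (pow3 s / 2)))).
    by rewrite ler_wpM2l// mulr_ge0// expR_ge0.
  have -> : 2 * expR (height z / 2) * (2^-1 * pow3 s * expR (pow3 s / 2)) =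
    pow3 s * (expR (height z / 2) * expR (pow3 s / 2)) by field.
  by rewrite ler_pM2l// -expRD ler_expR -/c; lra.
have zZ j : `|y.1.2 ord0 j - z.1.2 ord0 j - 2^-1 * br z.1.1 y.1.1 ord0 j|
    <= (1 + B) * Q s u x.
  apply: le_trans (hZ j) _; rewrite az.
  have h1 : expR l - 1 <= pow3 s * expR (2 * pow3 s).
    apply: le_trans (expRB1_le _) _; apply: ler_pM => //; rewrite ?expR_ge0//; first exact: ltW.
    by rewrite ler_expR; lra.
  have h2 : (expR (l / 2) - 1) ^+ 2 <= pow3 s * expR (2 * pow3 s).
    rewrite expr2; apply: le_trans (ler_pM el0 el0 el el) _.
    have -> : 2^-1 * pow3 s * expR (pow3 s / 2) * (2^-1 * pow3 s * expR (pow3 s / 2)) =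
      4^-1 * (pow3 s * (pow3 s * (expR (pow3 s / 2) * expR (pow3 s / 2)))) by field.
    have -> : expR (pow3 s / 2) * expR (pow3 s / 2) = expR (pow3 s) by rewrite -expRD -splitr.
    have : pow3 s * expR (pow3 s) <= expR (2 * pow3 s).
      apply: le_trans (ler_wpM2r (expR_ge0 _) (expR_ge (pow3 s))) _.
      by rewrite -expRD ler_expR; lra.
    move=> /(ler_wpM2l (ltW e0)) h; have := mulr_gt0 e0 (expR_gt0 (2 * pow3 s)); lra.
  apply: (@le_trans _ _ (expR (height z) * ((1 + B) * (pow3 s * expR (2 * pow3 s))))).
    rewrite ler_wpM2l ?expR_ge0//; have := ler_wpM2l b0 h2; lra.
  rewrite mulrCA ler_wpM2l//; first lra.
  apply: le_trans (cellZ_ge s u x); rewrite mulrCA ler_pM2l// -expRD ler_expR -/c; lra.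
split => // [i|j].
  have -> : z.1.1 ord0 i - x.1.1 ord0 i =
    (y.1.1 ord0 i - x.1.1 ord0 i) - (y.1.1 ord0 i - z.1.1 ord0 i) by ring.
  by apply: le_trans (ler_normB _ _) _; have := yX i; have := zX i; lra.
(* The Z-displacement from x to z is that from x to y minus that from z to y, up to the correction
   [x - z, y - x] / 2. *)
have Hb := @ler_frame_bracket R n m k F (x.1.1 - z.1.1) (y.1.1 - x.1.1)
  (2 * P s u x) (P s u x) j.
have {}Hb : `|br (x.1.1 - z.1.1) (y.1.1 - x.1.1) ord0 j| <= B * (2 * P s u x * P s u x).
  have P0 := ltW (cellX_gt0 s u x).
  apply: Hb => // [|i|i]; first by rewrite mulr_ge0.
    rewrite !mxE distrC (_ : _ - _ = (y.1.1 ord0 i - x.1.1 ord0 i) - (y.1.1 ord0 i - z.1.1 ord0 i)).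
      by apply: le_trans (ler_normB _ _) _; have := yX i; have := zX i; lra.
    by ring.
  by rewrite !mxE.
have Pq := ler_wpM2l b0 (cellX_sqr s u x).
move: (yZ j) (zZ j) Hb; rewrite frame_bracketDl !frame_bracketDr !frame_bracketNl !frame_bracketNr.
rewrite frame_bracketxx oppr0 addr0 (frame_bracketC F x.1.1 z.1.1).
have Q0 := cellZ_gt0 s u x.
move: (br x.1.1 y.1.1) (br z.1.1 y.1.1) (br x.1.1 z.1.1) => b1 b2 b3.
rewrite !mxE !ler_norml => /andP[? ?] /andP[? ?] /andP[? ?].
by apply/andP; rewrite /nbhd_const expr2 in Pq *; split; lra.
Qed.

End factor.

Section cell_geometry.
Variables (R : realType) (n : euclideanLieAlgebra R) (m k : nat).
Variable F : orthonormal_frame n m k.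
Local Notation br := (frame_bracket F).
Local Notation B := (bracket_bound F).
Local Notation pow3 := (pow3 R).
Local Notation c0 := (nbhd_const F).
Implicit Types (s : int) (u : nat) (x y z : DRspace F).

Lemma pow3_small (e : R) : 0 < e -> exists s0, forall s, s <= s0 -> pow3 s < e.
Proof.
move=> e0; exists (- level (ln e^-1) - 1) => s ss.
apply: le_lt_trans (ler_pow3 R ss) _.
have h3 := pow3P R (- level (ln e^-1)); have := pow3_gt0 R (- level (ln e^-1) - 1).
have := level_ge (ln e^-1); rewrite lnK ?posrE ?invr_gt0// => h.
have : pow3 (- level (ln e^-1)) <= e.
  by rewrite pow3N -[leRHS]invrK lef_pV2 ?posrE ?invr_gt0// pow3_gt0.
by lra.
Qed.

Lemma pow3_big (V : R) s : level V <= s -> V <= pow3 s.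
Proof.
move=> Vs; apply: le_trans (ler_pow3 R Vs); apply: le_trans (level_ge V).
by apply: le_trans (expR_ge1Dx V); lra.
Qed.

Definition nbhd_ratio : R := 5 ^+ m * (2 * c0 + 1) ^+ k * 4.

Lemma DRcell_nbhd s u x : exists D : set (DRspace F), [/\ measurable D,
  (forall y z, DRcell s u x y -> DRdist z y < pow3 s -> D z) &
  (DRmeasure F D <= nbhd_ratio%:E * DRmeasure F (DRcell s u x))%E].
Proof.
set c := tric s (height x); set P := cellX s u x; set Q := cellZ s u x.
have P0 : 0 < P by exact: cellX_gt0.
have Q0 : 0 < Q by exact: cellZ_gt0.
have l0 := pow3_gt0 R s.
have c00 : 0 <= c0 by rewrite /nbhd_const; have := bracket_bound_ge0 F; lra.
(* A left translate of a box; the sides exceed twice the bounds of [DRcell_near] because boxes are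
   half-open. *)
pose D : set (DRspace F) := DRbox (fun i => x.1.1 ord0 i - 2 * P) (5 * P)
  (fun X j => x.1.2 ord0 j + 2^-1 * br x.1.1 X ord0 j - c0 * Q) ((2 * c0 + 1) * Q)
  (c - 2 * pow3 s) (4 * pow3 s).
have mz j : measurable_fun setT
    (fun X => x.1.2 ord0 j + 2^-1 * br x.1.1 X ord0 j - c0 * Q).
  apply: measurable_funB => //; apply: measurable_funD => //; apply: measurable_funM => //.
  exact: measurable_frame_bracket.
exists D; split; first exact: measurable_DRbox.
  move=> y z xy zy; have [hN hX hZ] := DRcell_near xy zy; split.
  - move=> i; have := hX i; rewrite -/P ler_norml => /andP[? ?].
    by apply/andP; split; lra.
  - move=> j; have := hZ j; rewrite -/Q ler_norml => /andP[? ?].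
    by apply/andP; split; lra.
  - move: hN; rewrite -/(height z) -/c ler_norml => /andP[? ?].
    by apply/andP; split; lra.
rewrite DRmeasure_box ?DRmeasure_cell//; last 3 first.
- by rewrite mulr_ge0// ltW.
- by rewrite mulr_ge0 ?(ltW Q0)//; lra.
- by rewrite mulr_gt0.
rewrite -EFinM lee_fin /nbhd_ratio !exprMn -/P -/Q; apply: eq_ler; ring.
Qed.

Lemma DRcell_shrink x (e : R) : 0 < e -> exists s0, forall s, s <= s0 ->
  exists u0 : nat, forall u y, (u0 <= u)%N -> DRcell s u x y ->
  [/\ `|height y - height x| < e,
    forall i, `|y.1.1 ord0 i - x.1.1 ord0 i| < e &
    forall j, `|sheared y j - sheared x j| < e].
Proof.
(* When 3 ^ s < 1 the exponents of both targets are at most |height x| + 1 + 16. *)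
move=> e0; pose K := expR (`|height x| + 17).
have K0 : 0 < K by exact: expR_gt0.
have K1 : 1 <= K by rewrite -[leLHS]expR0 ler_expR addr_ge0.
have d0 : 0 < Num.min 1 (e / (3 * K)) by rewrite lt_min ltr01 divr_gt0// mulr_gt0.
have [s0 hs0] := pow3_small d0.
exists s0 => s /hs0; rewrite lt_min => /andP[l1 le].
have l0 := pow3_gt0 R s.
have le' : 3 * (pow3 s * K) < e by move: le; rewrite ltr_pdivlMr ?mulr_gt0//; lra.
have [u1 h1] := @side_stable R 2^-1 2 s (tri s (height x)).
have [u2 h2] := @side_stable R 1 16 s (tri s (height x)).
exists (maxn u1 u2) => u y; rewrite geq_max => /andP[/h1 H1 /h2 H2].
move=> /DRidxP[hN hX hZ].
have hc : tric s (height x) <= `|height x| + pow3 s.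
  by apply: le_trans (tric_le s (height x)); exact: ler_norm.
have hn := normr_ge0 (height x); have hx := ler_norm (height x).
have hP : pow3 (sideX R s u (tri s (height x))) < e.
  rewrite /sideX H1; apply: le_lt_trans le'; apply: le_trans (pow3_target_le _ _ _ _) _.
  by rewrite !ler_pM2l// ler_expR -/(tric _ _); lra.
have hQ : pow3 (sideZ R s u (tri s (height x))) < e.
  rewrite /sideZ H2; apply: le_lt_trans le'; apply: le_trans (pow3_target_le _ _ _ _) _.
  by rewrite !ler_pM2l// ler_expR mul1r -/(tric _ _); lra.
split.
- apply: le_lt_trans (tri_eq_close hN) _; apply: le_lt_trans le'.
  by rewrite mulrCA -[leLHS]mulr1 ler_pM2l//; lra.
- by move=> i; apply: le_lt_trans (tri_eq_close (hX i)) hP.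
- by move=> j; apply: le_lt_trans (tri_eq_close (hZ j)) hQ.
Qed.

Lemma measurable_DRspace d (T : measurableType d) (phi : T -> DRspace F) :
  (forall i, measurable_fun setT (fun t => (phi t).1.1 ord0 i)) ->
  (forall j, measurable_fun setT (fun t => sheared (phi t) j)) ->
  measurable_fun setT (fun t => height (phi t)) ->
  measurable_fun setT phi.
Proof.
move=> mX mZ mh.
have mX' : measurable_fun setT (fun t => (phi t).1.1) by exact: measurable_rVP.
apply/measurable_fun_pairP; split; first (apply/measurable_fun_pairP; split => //).
  apply: measurable_rVP => j.
  rewrite (_ : (fun t => _) = (fun t => sheared (phi t) j + shear F (phi t).1.1 j)).
    apply: measurable_funD => //.
    exact: (measurableT_comp (@measurable_shear R n m k F j) mX').
  by apply/funext => t; rewrite /sheared subrK.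
have ma : measurable_fun setT (fun t => posval (phi t).2).
  rewrite (_ : (fun t => _) = (fun t => expR (height (phi t)))).
    exact: (measurableT_comp (@measurable_expR R) mh).
  by apply/funext => t; rewrite /height lnK// posrE posval_gt0.
move=> _ _ [C mC <-]; have := ma measurableT C mC; rewrite !setTI.
exact.
Qed.

End cell_geometry.

(** * The product of two Damek-Ricci spaces *)

Section product.
Variables (R : realType) (n1 n2 : euclideanLieAlgebra R) (m1 k1 m2 k2 : nat).
Variables (F1 : orthonormal_frame n1 m1 k1) (F2 : orthonormal_frame n2 m2 k2).
Local Notation T := (DRspace F1 * DRspace F2)%type.
Local Notation pow3 := (pow3 R).
Local Notation mu := (prod_measure (DRmeasure F1) (DRmeasure F2)).

Definition stage : countType := (int * nat)%type.
Definition pkey : countType := (DRkey m1 k1 * DRkey m2 k2)%type.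

(** Coarse before fine: [s] decreases, and within a scale [u] increases. *)
Definition earlier (th th' : stage) : Prop :=
  th'.1 < th.1 \/ th.1 = th'.1 /\ (th.2 < th'.2)%N.

Definition pidx (th : stage) (x : T) : pkey :=
  (DRidx th.1 th.2 x.1, DRidx th.1 th.2 x.2).

Let cellE th x : cell pidx th x =
  DRcell th.1 th.2 x.1 `*` DRcell th.1 th.2 x.2.
Proof.
apply/seteqP; split => y; rewrite /cell/= /pidx; first move=> h.
  by split; [exact: (congr1 fst h)|exact: (congr1 snd h)].
by case=> /= h1 h2; rewrite /DRcell/= in h1 h2; rewrite h1 h2.
Qed.

Let measurable_pcell th x : measurable (cell pidx th x).
Proof. by rewrite cellE; apply: measurableX; exact: measurable_DRcell. Qed.

Let measure_pcell th x : mu (cell pidx th x) =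
  (DRmeasure F1 (DRcell th.1 th.2 x.1) * DRmeasure F2 (DRcell th.1 th.2 x.2))%E.
Proof.
by rewrite cellE /prod_measure product_measure1E//; exact: measurable_DRcell.
Qed.

(** 9 when the two height intervals are cut, a factor 3 per coordinate when the sides are; the
    product covers both cases. *)
Definition split_const : R := 9 * (3 ^+ (m1 + k1) * 3 ^+ (m2 + k2)).

Lemma ex_min_nat (P : nat -> Prop) : (exists i, P i) ->
  exists2 i, P i & forall j, (j < i)%N -> ~ P j.
Proof.
move=> [i Pi]; have ex : exists i, `[< P i >] by exists i; exact/asboolP.
case: (ex_minnP ex) => j /asboolP Pj jmin; exists j => // l lj /asboolP /jmin.
by rewrite leqNgt lj.
Qed.

(** From scale [S] on cells have measure above V, so the scales in question are bounded by [S]; the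
    first stage has the largest of them, and then the least [u]. *)
Let pcell_first x (V : R) (P : stage -> Prop) :
  (forall th, P th -> (mu (cell pidx th x) <= V%:E)%E) -> (exists th, P th) ->
  exists2 th, P th & forall th', earlier th' th -> ~ P th'.
Proof.
move=> PV Pex.
pose S := Num.max (level (1 + `|height x.1|))
  (Num.max (level (1 + `|height x.2|)) (level (1 + `|V|))).
have PS s u : P (s, u) -> s < S.
  move=> Psu; rewrite ltNge; apply/negP; rewrite !ge_max => /and3P[h1 h2 hV].
  have := PV _ Psu; apply/negP; rewrite -ltNge measure_pcell/=.
  apply: (@lt_le_trans _ _ ((pow3 s)%:E * (pow3 s)%:E)%E); last first.
    apply: lee_pmul; rewrite ?lee_fin ?(ltW (pow3_gt0 _ _))//.
      by apply: DRcell_large; exact: pow3_big.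
    by apply: DRcell_large; exact: pow3_big.
  have := pow3_big hV; have := ler_norm V; have := normr_ge0 V.
  by rewrite -EFinM lte_fin; nra.
have [d [u Pd] dmin] : exists2 d : nat, (exists u, P (S - d%:Z, u)) &
    forall j, (j < d)%N -> ~ exists u, P (S - j%:Z, u).
  apply: ex_min_nat; case: Pex => -[s u] Psu; have sS := PS _ _ Psu.
  exists `|S - s|%N, u; rewrite (_ : S - _ = s)//.
  by rewrite gez0_abs ?subr_ge0 ?ltW// subKr.
have [u' Pu' umin] := ex_min_nat (ex_intro (fun u => P (S - d%:Z, u)) u Pd).
exists (S - d%:Z, u') => // -[s w] [/= sd|/= [-> /umin//]] Psw.
have sS := PS _ _ Psw; apply: (dmin `|S - s|%N); first lia.
by exists w; rewrite (_ : S - _ = s)//; rewrite gez0_abs ?subr_ge0 ?ltW// subKr.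
Qed.

Lemma mule_le_ratio (a b a' b' : \bar R) (c d C : R) :
  (0 <= a)%E -> (0 <= b)%E -> (0 <= a')%E -> (0 <= b')%E ->
  (a' <= c%:E * a)%E -> (b' <= d%:E * b)%E -> c * d <= C ->
  (a' * b' <= C%:E * (a * b))%E.
Proof.
move=> a0 b0 a'0 b'0 ha hb cd; apply: le_trans (lee_pmul a'0 b'0 ha hb) _.
by rewrite muleACA -EFinM; apply: lee_wpmul2r; [exact: mule_ge0|rewrite lee_fin].
Qed.

Let pcell_parent th x : exists2 th', earlier th' th &
  (mu (cell pidx th' x) <= split_const%:E * mu (cell pidx th x))%E.
Proof.
have e1 (m : nat) : 1 <= 3 ^+ m :> R by apply: exprn_ege1; lra.
case: th => s [|u].
  have [u1 h1] := DRcell_parent s x.1; have [u2 h2] := DRcell_parent s x.2.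
  have H1 := h1 _ (leq_maxl u1 u2); have H2 := h2 _ (leq_maxr u1 u2).
  exists (s + 1, maxn u1 u2); first by left => /=; lia.
  rewrite (measure_pcell (s + 1, maxn u1 u2)) (measure_pcell (s, 0%N)).
  apply: (@mule_le_ratio _ _ _ _ 3 3); try exact: measure_ge0.
  - by rewrite /= H1.
  - by rewrite /= H2.
  - have := ler_pM ler01 ler01 (e1 (m1 + k1)%N) (e1 (m2 + k2)%N).
    rewrite /split_const; lra.
exists (s, u); first by right.
rewrite (measure_pcell (s, u)) (measure_pcell (s, u.+1)).
apply: mule_le_ratio; try exact: measure_ge0; try exact: DRcell_split.
by rewrite /split_const ler_peMl ?mulr_ge0 ?exprn_ge0//; lra.
Qed.

Let pcell_shrink (x : T) (e : R) : 0 < e -> exists th, forall y, cell pidx th x y ->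
  [/\ [/\ `|height y.1 - height x.1| < e,
    forall i, `|y.1.1.1 ord0 i - x.1.1.1 ord0 i| < e &
    forall j, `|sheared y.1 j - sheared x.1 j| < e] &
   [/\ `|height y.2 - height x.2| < e,
    forall i, `|y.2.1.1 ord0 i - x.2.1.1 ord0 i| < e &
    forall j, `|sheared y.2 j - sheared x.2 j| < e]].
Proof.
move=> e0; have [s1 h1] := DRcell_shrink x.1 e0; have [s2 h2] := DRcell_shrink x.2 e0.
have [|u1 {}h1] := h1 (Num.min s1 s2); first by rewrite ge_min lexx.
have [|u2 {}h2] := h2 (Num.min s1 s2); first by rewrite ge_min lexx orbT.
exists (Num.min s1 s2, maxn u1 u2) => y; rewrite cellE => -[/= y1 y2].
split; first by apply: h1 y1; exact: leq_maxl.
by apply: h2 y2; exact: leq_maxr.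
Qed.

Let pcells : set (set T) := [set A | exists th x, A = cell pidx th x].

(** Continuous functions for the cell topology are measurable, its open sets being countable unions
    of cells. *)
Let measurable_pcells_fun (c : T -> R) :
  (forall x (e : R), 0 < e -> exists th, forall y, cell pidx th x y -> `|c y - c x| < e) ->
  measurable_fun (setT : set (g_sigma_algebraType pcells)) c.
Proof.
move=> hc mT; apply: (measurability _ (RGenOInfty.measurableE R)) => // _ [_ [r ->] <-].
rewrite setTI.
have oU : cell_open pidx (c @^-1` `]r, +oo[).
  move=> x; rewrite /= in_itv/= andbT -subr_gt0 => /(hc x)[th hth]; exists th => y /hth.
  by rewrite /= in_itv/= andbT ltr_norml => /andP[? ?]; lra.
have [A [-> cA]] := cell_openE oU; apply: bigcupT_measurable => i.
have [->|[th [x ->]]] := cA i; first exact: measurable0.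
by apply: sub_sigma_algebra; exists th, x.
Qed.

(** The heights, X-coordinates and sheared Z-coordinates are continuous for the cell topology and
    determine the point measurably, so the identity is measurable from the sigma-algebra of the
    cells. *)
Let pcell_generate : measurable `<=` <<s pcells >>.
Proof.
have mid : measurable_fun (setT : set (g_sigma_algebraType pcells)) (id : T -> T).
  apply/measurable_fun_pairP; split; apply: measurable_DRspace => [i|j|];
    apply: measurable_pcells_fun => x e e0; have [th hth] := pcell_shrink x e0;
    exists th => y /hth[[? ? ?] [? ? ?]] //=.
move=> A mA; have := mid measurableT A mA; rewrite setTI.
exact.
Qed.

Lemma product_cell_system : cell_system mu earlier pidx split_const.
Proof.
split.
- move=> [s u] [s' u'] ne; rewrite /earlier/=.
  have [ss|ss|ss] := ltgtP s s'; [by right; left|by left; left|].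
  have [uu|uu|uu] := ltngtP u u'; [by left; right|by right; right|].
  by case: ne; rewrite ss uu.
- move=> [s u] [s' u'] x y ord e.
  have e1 : DRidx s' u' x.1 = DRidx s' u' y.1 := congr1 fst e.
  have e2 : DRidx s' u' x.2 = DRidx s' u' y.2 := congr1 snd e.
  suff [H1 H2] : DRidx s u x.1 = DRidx s u y.1 /\ DRidx s u x.2 = DRidx s u y.2.
    by rewrite /pidx H1 H2.
  case: ord => /= [ss|[-> /ltnW uu]].
    by split; [exact: DRidx_lower ss e1|exact: DRidx_lower ss e2].
  by split; [exact: DRidx_finer uu e1|exact: DRidx_finer uu e2].
- exact: measurable_pcell.
- move=> th x; suff : (0 < mu (cell pidx th x))%E by [].
  rewrite measure_pcell !DRmeasure_cell -EFinM lte_fin.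
  by rewrite !mulr_gt0 ?exprn_gt0 ?pow3_gt0.
- move=> th x; suff : (mu (cell pidx th x) < +oo)%E by [].
  by rewrite measure_pcell !DRmeasure_cell -EFinM ltry.
- exact: pcell_parent.
- exact: pcell_first.
- exact: pcell_generate.
Qed.

Definition CZ_const : R := 2 + 2 * split_const +
  (`|ball_const F1| + `|ball_const F2|) + `|nbhd_ratio F1 * nbhd_ratio F2|.

Let dmax := dist_max (@DRdist R n1 m1 k1 F1) (@DRdist R n2 m2 k2 F2).

Lemma CZ_set0 (kappa : R) : CZ_set mu dmax kappa set0.
Proof.
exists 1 => //; split.
  by exists point, (kappa * 1); split => // x.
rewrite measure0 mule0 (_ : [set _ | _] = set0) ?measure0//.
apply/seteqP; split => // x /=; rewrite /dist_to_set.
rewrite (_ : [set _ | _ in _] = set0); last by apply/seteqP; split => // y [].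
by rewrite ereal_inf0.
Qed.

Lemma CZ_set_cell th x : CZ_set mu dmax CZ_const (cell pidx th x).
Proof.
have C0 : 0 <= split_const by rewrite /split_const !mulr_ge0 ?exprn_ge0.
have n1' := normr_ge0 (ball_const F1); have n2' := normr_ge0 (ball_const F2).
have n3 := normr_ge0 (nbhd_ratio F1 * nbhd_ratio F2).
have b1 := ler_norm (ball_const F1); have b2 := ler_norm (ball_const F2).
have b3 := ler_norm (nbhd_ratio F1 * nbhd_ratio F2).
case: th => s u; have l0 := pow3_gt0 R s; exists (pow3 s) => //; split.
  exists x, (CZ_const * pow3 s); split => // y; rewrite cellE => -[/= y1 y2].
  rewrite gt_max; apply/andP; split.
    by apply: lt_le_trans (DRcell_ball y1) _; rewrite ler_pM2r// /CZ_const; lra.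
  by apply: lt_le_trans (DRcell_ball y2) _; rewrite ler_pM2r// /CZ_const; lra.
have [D1 [mD1 hD1 D1m]] := DRcell_nbhd s u x.1.
have [D2 [mD2 hD2 D2m]] := DRcell_nbhd s u x.2.
apply: (@le_trans _ _ (mu (D1 `*` D2))).
  apply: prod_measure_mono.
    by move=> A B AB; apply: prod_measure_mono => //; exact: posreal_haar_mono.
  move=> z /= /ereal_inf_lt[_ [y + <-]]; rewrite cellE => -[/= y1 y2].
  rewrite lte_fin gt_max => /andP[z1 z2].
  by split; [exact: hD1 y1 z1|exact: hD2 y2 z2].
suff : (mu (D1 `*` D2) <= CZ_const%:E * mu (cell pidx (s, u) x))%E by [].
rewrite (measure_pcell (s, u)) [leLHS]product_measure1E//.
apply: mule_le_ratio D1m D2m _; try exact: measure_ge0.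
by rewrite /CZ_const; lra.
Qed.

(** Taking all measurable sets that satisfy [CZ_set] makes the geometric condition hold by
    definition; it remains that the cells are among them. *)
Lemma product_CZ_space :
  is_CZ_space mu dmax [set A | measurable A /\ CZ_set mu dmax CZ_const A] CZ_const.
Proof.
have C0 : 0 <= split_const by rewrite /split_const !mulr_ge0 ?exprn_ge0.
have n1' := normr_ge0 (ball_const F1); have n2' := normr_ge0 (ball_const F2).
have n3 := normr_ge0 (nbhd_ratio F1 * nbhd_ratio F2).
split; [by rewrite /CZ_const; lra|by move=> A []|by move=> A []|].
move=> f alpha fint a0 _.
apply: (cell_CZ_decomposition product_cell_system (0, 0%N)) => //.
- by rewrite /CZ_const; lra.
- by rewrite /CZ_const; lra.
- by split; [exact: measurable0|exact: CZ_set0].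
- by move=> th x; split; [exact: measurable_pcell|exact: CZ_set_cell].
Qed.

End product.

Theorem theorem3p37 (R : realType)
  (n1 n2 : euclideanLieAlgebra R) (m1 k1 m2 k2 : nat)
  (F1 : orthonormal_frame n1 m1 k1) (F2 : orthonormal_frame n2 m2 k2) :
  is_htype n1 -> is_htype n2 ->
  exists (Rfam : set (set (DRspace F1 * DRspace F2))) (kappa : R),
    is_CZ_space (prod_measure (DRmeasure F1) (DRmeasure F2))
      (dist_max (@DRdist R n1 m1 k1 F1) (@DRdist R n2 m2 k2 F2)) Rfam kappa.
Proof.
move=> _ _; eexists; exists (CZ_const F1 F2); exact: product_CZ_space.
Qed.
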